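(* Let $X$ be a finite, nonempty symmetric $\Delta$-complex and let $f$ be a discrete Morse function on $X$. Then the geometric realization $|X|$ is homotopy equivalent to a symmetric CW-complex with exactly one $p$-cell $(B^p)^\circ/G$ for each critical symmetric orbit $[\alpha]$ of dimension $p$ with respect to $f$, where $G\subset O(p)$ is finite and isomorphic to $\operatorname{Aut}(\alpha)$.
   Context: Symmetric $\Delta$-complexes. Put $[p]=\{0,1,\dots,p\}$ for $p\ge 0$ and $[-1]=\emptyset$. Let $I$ be the category with objects $[p]$, $p\geq -1$, and morphisms all injections. A symmetric $\Delta$-complex is a functor $X: I^{\mathrm{op}}\to \mathrm{Sets}$. Write $X_p=X([p])$ and $\theta^*=X(\theta):X_q\to X_p$ for an injection $\theta:[p]\to[q]$. A $p$-simplex ($p\ge 0$) is an element $\alpha\in X_p$, also written $\alpha^{(p)}$. $X$ is finite (nonempty) if it has finitely many simplices (at least one simplex) of dimension $\ge 0$. The symmetric orbit of $\alpha\in X_p$ is $[\alpha]=\{\rho^*(\alpha):\rho\in S_{p+1}\}$, where $S_{p+1}$ is the group of permutations of $[p]$; its dimension is $p$. If $\theta^*(\beta)=\alpha$ for an injection $\theta$, we say that $\theta$ glues $\alpha$ to $\beta$ and $\alpha$ is a face of $\beta$, written $\alpha<\beta$; this depends only on the orbits. $\operatorname{Aut}(\alpha)=\{\rho\in S_{p+1}:\rho^*(\alpha)=\alpha\}$ for $\alpha\in X_p$. Geometric realization. For $\theta:[p]\to[q]$ let $\theta_*:\Delta^p\to\Delta^q$ be the induced affine map of standard simplices, $e_i\mapsto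 e_{\theta(i)}$. Then $|X|=\left(\coprod_{p\ge 0} X_p\times\Delta^p\right)/\sim$, where $(x,\theta_*a)\sim(\theta^*x,a)$ for $x\in X_q$, $\theta:[p]\to[q]$ an injection and $a\in\Delta^p$. Permissible faces. Let $\rho$ glue $\alpha^{(p)}$ to $\beta^{(p+1)}$ ($p\ge0$). Then $\alpha$ is a permissible face of $\beta$ if: (1) any two injections $\theta,\theta':[p]\to[p+1]$ with $\theta^*(\beta)=(\theta')^*(\beta)=\alpha$ satisfy $\operatorname{Im}\theta=\operatorname{Im}\theta'$; (2) the map $f_\rho:\operatorname{Aut}(\beta)\to\operatorname{Aut}(\alpha)$, $f_\rho(\pi)=\rho^{-1}|_{\operatorname{Im}\rho}\circ\pi\circ\rho$ (well defined given (1)), is an isomorphism. Permissibility depends only on the symmetric orbits. Discrete Morse functions. A discrete Morse function on $X$ is a function $f:\coprod_{p\ge0}X_p\to\mathbb{R}$ such that: (i) $f$ is constant on symmetric orbits; (ii) if $\alpha^{(p)}<\beta^{(p+1)}$ is not permissible, then $f(\alpha)<f(\beta)$; (iii) for every $\alpha^{(p)}$, $u_f(\alpha):=\#\{[\beta^{(p+1)}]:\alpha<\beta\text{ is permissible and }f(\alpha)\ge f(\beta)\}\le1$; (iv) for every $\alpha^{(p)}$, $d_f(\alpha):=\#\{[\gamma^{(p-1)}]:\gamma<\alpha\text{ is permissible and }f(\alpha)\le f(\gamma)\}\le1$. A simplex $\alpha$ (or its orbit $[\alpha]$) is critical if $u_f(\alpha)=d_f(\alpha)=0$. Symmetric CW-complexes.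 $B^p$ is the closed unit ball in $\mathbb{R}^p$, $(B^p)^\circ$ its interior, and $O(p)$ the orthogonal group. A symmetric CW-complex is a Hausdorff topological space $Y$ with a partition into locally closed cells such that for each cell $C$ there are $p\ge 0$, a finite subgroup $G\subset O(p)$ and a continuous map $B^p/G\to Y$ such that $(B^p)^\circ/G$ maps homeomorphically onto $C$ (then $C$ is called a $p$-cell $(B^p)^\circ/G$) and the image of the boundary $\partial B^p/G$ meets only finitely many cells, each of dimension less than $p$; moreover a subset of $Y$ is closed if and only if its intersection with the closure of each cell is closed. *)

(* Defs.v *)
From HB Require Import structures.
From mathcomp Require Import all_boot all_order all_algebra all_fingroup.
From mathcomp Require Import all_classical all_reals all_analysis.
From Stdlib Require Import Relation_Operators.
Set Implicit Arguments.
Unset Strict Implicit.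
Unset Printing Implicit Defensive.
Import Order.TTheory GRing.Theory Num.Theory.
Import numFieldNormedType.Exports.

Local Open Scope classical_set_scope.
Local Open Scope card_scope.
Local Open Scope ring_scope.
Local Open Scope quotient_scope.

(** The objects of the category I are indexed by cardinality: [n : nat] stands
    for {0, ..., n-1}, so the object {0, ..., p}, p >= -1, is [p.+1] here, and
    the empty set is [0]. *)

Definition injn (m n : nat) : Type := {h : {ffun 'I_m -> 'I_n} | injectiveb h}.

Definition injn_fun m n (t : injn m n) : 'I_m -> 'I_n := val t.
Coercion injn_fun : injn >-> Funclass.

Lemma injn_inj m n (t : injn m n) : injective t.
Proof. exact/injectiveP/(valP t). Qed.

Lemma injn_of_subproof m n (h : 'I_m -> 'I_n) :
  injective h -> injectiveb (finfun h).
Proof. by move=> hI; apply/injectiveP => i j; rewrite !ffunE => /hI. Qed.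

Definition injn_of m n (h : 'I_m -> 'I_n) (hI : injective h) : injn m n :=
  exist _ (finfun h) (injn_of_subproof hI).

Definition injn_id n : injn n n := injn_of (fun x y (e : x = y :> 'I_n) => e).

Definition injn_comp m n k (t : injn n k) (u : injn m n) : injn m k :=
  injn_of (ssrfun.inj_comp (@injn_inj _ _ t) (@injn_inj _ _ u)).

Definition injn_perm n (s : 'S_n) : injn n n := injn_of (@perm_inj _ s).

(** [simp X p.+1] is the set X_p of p-simplices, and [pull X t] is t^*. *)
Record symDelta := SymDelta {
  simp :> nat -> choiceType;
  pull : forall m n, injn m n -> simp n -> simp m;
  pull_id : forall n (x : simp n), pull (injn_id n) x = x;
  pull_comp : forall m n k (t : injn n k) (u : injn m n) (x : simp k),
    pull (injn_comp t u) x = pull u (pull t x) }.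

Arguments pull {s m n} t x.

Section SymDelta.
Variable X : symDelta.

Definition simplices := {p : nat & X p.+1}.

Definition finite_complex := finite_set [set: simplices].
Definition nonempty_complex := [set: simplices] !=set0.

Definition sym_orbit p (a : X p.+1) : set (X p.+1) :=
  [set pull (injn_perm s) a | s in [set: 'S_p.+1]].

Definition glues p q (t : injn p.+1 q.+1) (a : X p.+1) (b : X q.+1) : Prop :=
  pull t b = a.

Definition face p q (a : X p.+1) (b : X q.+1) : Prop :=
  exists t : injn p.+1 q.+1, glues t a b.

Definition sym_aut p (a : X p.+1) : {set 'S_p.+1} :=
  [set s | pull (injn_perm s) a == a]%SET.

(** [restrict_perm r s] is r^-1 o s o r, which makes sense as soon as [s] maps
    the image of [r] to itself; it is the identity permutation otherwise. *)
Definition restrict_perm m n (r : injn m n) (s : 'S_n) : 'S_m :=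
  insubd (1%g : 'S_m) [ffun i => odflt i [pick j | r j == s (r i)]].

Definition permissible p (a : X p.+1) (b : X p.+2) : Prop :=
  exists r : injn p.+1 p.+2,
    [/\ glues r a b,
        forall t u : injn p.+1 p.+2, glues t a b -> glues u a b ->
          range t = range u
      & misom (sym_aut b) (sym_aut a) (restrict_perm r)].

Section Morse.
Variables (R : realType) (f : forall p, X p.+1 -> R).

Definition up_orbits p (a : X p.+1) : set (set (X p.+2)) :=
  [set sym_orbit b | b in
    [set b | [/\ face a b, permissible a b & f b <= f a]]].

(** Simplices of dimension -1 are not faces here, so a vertex has no
    lower orbits. *)
Definition down_orbits p : X p.+1 -> set (set (X p)) :=
  match p with
  | 0 => fun _ => set0
  | _.+1 => fun a =>
      [set sym_orbit c | c in
        [set c | [/\ face c a, permissible c a & f a <= f c]]]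
  end.

Definition discrete_morse : Prop :=
  [/\ forall p (a b : X p.+1), sym_orbit a b -> f a = f b,
      forall p (a : X p.+1) (b : X p.+2),
        face a b -> ~ permissible a b -> f a < f b,
      forall p (a : X p.+1), up_orbits a #<= `I_1
    & forall p (a : X p.+1), down_orbits a #<= `I_1].

Definition critical p (a : X p.+1) : Prop :=
  up_orbits a #= `I_0 /\ down_orbits a #= `I_0.

Definition critical_orbits p : set (set (X p.+1)) :=
  [set sym_orbit a | a in [set a | critical a]].

End Morse.
End SymDelta.
Arguments critical_orbits {X R} f p _.

Section Realization.
Variables (R : realType) (X : symDelta).

(** The standard simplex with [n] vertices, of dimension n - 1. *)
Definition stdsimplex n : set 'rV[R]_n :=
  [set a | (forall i, 0 <= a 0 i) /\ \sum_i a 0 i = 1].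
Arguments stdsimplex : clear implicits.

Definition push_fun m n (t : injn m n) (a : 'rV[R]_m) : 'rV[R]_n :=
  \row_j \sum_(i | t i == j) a 0 i.

Lemma push_subproof m n (t : injn m n) (a : stdsimplex m) :
  push_fun t (val a) \in stdsimplex n.
Proof.
have /set_mem[a0 a1] := valP a; apply/mem_set; split => [j|].
  by rewrite mxE; apply: sumr_ge0 => i _; exact: a0.
rewrite -[RHS]a1 (partition_big t xpredT) //=.
by apply: eq_bigr => j _; rewrite mxE.
Qed.

Definition push m n (t : injn m n) (a : stdsimplex m) : stdsimplex n :=
  exist (fun b => b \in stdsimplex n) (push_fun t (val a)) (push_subproof t a).

(** The coproduct of the X_p x Delta^p, p >= 0, with X_p discrete. *)
Definition prerealization : topologicalType :=
  {s : simplices X & stdsimplex (tag s).+1}.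

Definition cell_point p (x : X p.+1) (a : stdsimplex p.+1) : prerealization :=
  existT (fun s : simplices X => stdsimplex (tag s).+1 : Type)
    (existT _ p x) a.

Definition glue (u v : prerealization) : Prop :=
  exists p q (t : injn p.+1 q.+1) (x : X q.+1) (a : stdsimplex p.+1),
    u = cell_point x (push t a) /\ v = cell_point (pull t x) a.

Definition glue_equiv_def (u v : prerealization) : bool :=
  `[< clos_refl_sym_trans _ glue u v >].

Lemma glue_equiv_refl : reflexive glue_equiv_def.
Proof. by move=> u; apply/asboolP; exact: rst_refl. Qed.

Lemma glue_equiv_sym : symmetric glue_equiv_def.
Proof.
by move=> u v; apply/asbool_equiv_eq; split => h; exact: rst_sym.
Qed.

Lemma glue_equiv_trans : transitive glue_equiv_def.
Proof.
move=> v u w /asboolP uv /asboolP vw; apply/asboolP; exact: rst_trans uv vw.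
Qed.

Definition glue_equiv :=
  EquivRel glue_equiv_def glue_equiv_refl glue_equiv_sym glue_equiv_trans.

Definition realization : topologicalType :=
  quotient_topology {eq_quot glue_equiv}.

End Realization.
Arguments stdsimplex : clear implicits.

Section Homotopy.
Variable R : realType.

Definition homotopic (T U : topologicalType) (f g : T -> U) : Prop :=
  exists H : T * R -> U,
    [/\ {within [set: T] `*` `[0, 1], continuous H},
        forall x, H (x, 0) = f x & forall x, H (x, 1) = g x].

Definition homotopy_equivalent (T U : topologicalType) : Prop :=
  exists (f : T -> U) (g : U -> T),
    [/\ continuous f, continuous g,
        homotopic (g \o f) idfun & homotopic (f \o g) idfun].

End Homotopy.

Definition locally_closed (T : topologicalType) (A : set T) : Prop :=
  exists U F : set T, [/\ open U, closed F & A = U `&` F].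

Definition maps_homeomorphically (T U : topologicalType)
    (A : set T) (B : set U) (h : T -> U) : Prop :=
  [/\ set_bij A B h, {within A, continuous h}
    & exists g : U -> T,
        {within B, continuous g} /\ forall x, A x -> g (h x) = x].

Section SymCW.
Variable R : realType.

Record finOrthGroup (p : nat) := FinOrthGroup {
  orth_set :> set 'M[R]_p;
  orth_finite : finite_set orth_set;
  orth_orthogonal : forall A, orth_set A -> A *m A^T = 1%:M;
  orth_1 : orth_set 1%:M;
  orth_M : forall A B, orth_set A -> orth_set B -> orth_set (A *m B);
  orth_V : forall A, orth_set A -> orth_set (invmx A) }.

(** The norm of the library on matrices is the sup norm, hence the explicit
    Euclidean norm. *)
Definition sqnorm p (x : 'cV[R]_p) : R := \sum_i x i 0 ^+ 2.
Definition cball p : set 'cV[R]_p := [set x | sqnorm x <= 1].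
Arguments cball : clear implicits.

Section OrbitSpace.
Variables (p : nat) (G : finOrthGroup p).

Definition orth_equiv_def (x y : cball p) : bool :=
  `[< exists2 A, orth_set G A & val y = A *m val x >].

Lemma orth_equiv_refl : reflexive orth_equiv_def.
Proof.
by move=> x; apply/asboolP; exists 1%:M; [exact: orth_1|rewrite mul1mx].
Qed.

Lemma orth_equiv_sym : symmetric orth_equiv_def.
Proof.
suff h x y : orth_equiv_def x y -> orth_equiv_def y x.
  by move=> x y; apply/idP/idP => /h.
move=> /asboolP[A GA xy]; apply/asboolP; exists (invmx A); first exact: orth_V.
have [uA _] := mulmx1_unit (orth_orthogonal GA).
by rewrite xy mulmxA mulVmx // mul1mx.
Qed.

Lemma orth_equiv_trans : transitive orth_equiv_def.
Proof.
move=> y x z /asboolP[A GA xy] /asboolP[B GB yz]; apply/asboolP.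
by exists (B *m A); [exact: orth_M|rewrite yz xy mulmxA].
Qed.

Definition orth_equiv :=
  EquivRel orth_equiv_def orth_equiv_refl orth_equiv_sym orth_equiv_trans.

Definition ball_quot : topologicalType :=
  quotient_topology {eq_quot orth_equiv}.

Definition ball_pi (x : cball p) : ball_quot := \pi_{eq_quot orth_equiv} x.

Definition ball_quot_interior : set ball_quot :=
  ball_pi @` [set x | sqnorm (val x) < 1].
Definition ball_quot_boundary : set ball_quot :=
  ball_pi @` [set x | sqnorm (val x) = 1].

End OrbitSpace.
Arguments ball_quot_interior {p} G _.
Arguments ball_quot_boundary {p} G _.

(** [C] is a p-cell (B^p)° / G of [Y], where [cells] is the family of all the
    cells and [dim] gives their dimensions, to which the condition on the
    boundary refers. *)
Definition is_cell (Y : topologicalType) (cells : set (set Y))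
    (dim : set Y -> nat) (C : set Y) (p : nat) (G : finOrthGroup p) : Prop :=
  dim C = p /\
  exists chi : ball_quot G -> Y,
    let touched := [set D | cells D /\
      D `&` (chi @` ball_quot_boundary G) !=set0] in
    [/\ continuous chi,
        maps_homeomorphically (ball_quot_interior G) C chi,
        finite_set touched
      & forall D, touched D -> (dim D < p)%N].

Record symCW := SymCW {
  cw_space :> topologicalType;
  cw_cells : set (set cw_space);
  cw_dim : set cw_space -> nat;
  cw_hausdorff : hausdorff_space cw_space;
  cw_partition : partition cw_cells id [set: cw_space];
  cw_locally_closed : forall C, cw_cells C -> locally_closed C;
  cw_cell : forall C, cw_cells C ->
    exists (p : nat) (G : finOrthGroup p), is_cell cw_cells cw_dim C G;
  cw_closed : forall A : set cw_space,
    closed A <-> forall C, cw_cells C -> closed (A `&` closure C) }.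

Definition cells_of_dim (Y : symCW) (p : nat) : set (set Y) :=
  [set C | cw_cells C /\ cw_dim C = p].

(** The library's product of permutations is composition in the reverse order,
    which does not change the isomorphism class of a group of permutations. *)
Definition orth_isog n p (A : {set 'S_n}) (G : finOrthGroup p) : Prop :=
  exists h : 'S_n -> 'M[R]_p,
    set_bij [set` A] G h /\
    forall s t, s \in A -> t \in A -> h (s * t)%g = h s *m h t.

End SymCW.
Arguments cball : clear implicits.
Arguments cw_cells {R} s _.
Arguments cw_dim {R} s _.
Arguments cells_of_dim {R} Y p _.

(* Main.v *)
From Stdlib Require Import Relation_Operators.
Require Import Defs.
From mathcomp Require Import all_boot all_order all_algebra all_fingroup finmap.
From mathcomp Require Import all_classical all_reals all_analysis.
From mathcomp Require Import ring lra zify.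
Set Implicit Arguments.
Unset Strict Implicit.
Unset Printing Implicit Defensive.
Import Order.TTheory GRing.Theory Num.Theory.
Import numFieldNormedType.Exports.

Local Open Scope classical_set_scope.
Local Open Scope card_scope.
Local Open Scope ring_scope.

(** A matched pair [(a, b)] is collapsed by sliding the simplex [b] off its free
    facet [a], equivariantly under [Aut b = Aut a]. Adding the critical simplices
    and the matched pairs one by one to subcomplexes closed under the matching, we
    maintain a closed equivalence relation [E] on the realized subcomplex [B]
    together with a homotopy [h : B x [0, 1] -> B] from the identity such that [h t]
    preserves [E] and [h 1] is constant on its classes; then [h 1] and [h] descend to
    [B / E] and show that [B -> B / E] is a homotopy equivalence, with no gluing
    lemma for homotopy equivalences. When a critical simplex is attached, [h] is
    extended by the homotopy extension property and [E] by the identity; when a pair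
    is attached, [E] is pulled back along the retraction. In the end every class of
    [E] contains exactly one point lying in an open critical simplex, so these are
    the cells of [|X| / E]. Collapses do not raise the dimension of the carrier of a
    point, hence the boundary of a critical p-simplex is sent to cells of dimension
    less than p, whatever the order in which simplices are added. *)

(** * Continuity on closed subsets and compact quotients *)

(** The obstacle is symmetry. A closed simplex is not embedded in the realization: its interior
    appears modulo [Aut], and its boundary may be glued to itself. A map on a simplex [x] must
    therefore commute with [Aut x] and agree with what is already given on the boundary, so depth in
    a simplex is measured by minima of coordinates. For a matched pair [(a, b)], condition (1) makes
    every automorphism of [b] fix the vertex opposite to [a], so that sliding towards this vertex is
    equivariant; condition (2) lifts identifications inside [a] to automorphisms of [b], so that
    sliding is well defined on [a] too.

    The relation [E] lives on the realization of [X] throughout, and a single quotient is formed at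
    the end. Compactness makes it Hausdorff, as [E] is closed, and makes the descended homotopies
    continuous. The simplex or pair added last is found by maximizing a value that is constant on
    matched pairs and increases strictly along all other facets. *)

Section ContOn.
Context {S T U : topologicalType}.

(** With [C] the whole space this includes that [A] is closed. Pasting two pieces and descending
    along a compact image become computations with closed sets of the ambient space. *)
Definition cont_on (A : set S) (f : S -> T) : Prop :=
  forall C, closed C -> closed (A `&` f @^-1` C).

Lemma cont_onP (A : set S) (f : S -> T) :
  closed A -> cont_on A f <-> {within A, continuous f}.
Proof.
move=> cA; rewrite continuous_closedP; split=> h C /h.
  by rewrite closed_setSI.
by rewrite -[X in X -> _]closed_setSI.
Qed.

Lemma cont_onT (A : set S) (f : S -> T) :
  closed A -> continuous f -> cont_on A f.
Proof.
by move=> cA cf C cC; apply: closedI => //; move/continuous_closedP: cf; exact.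
Qed.

Lemma eq_cont_on (A : set S) (f g : S -> T) :
  (forall x, A x -> f x = g x) -> cont_on A f -> cont_on A g.
Proof.
move=> fg cf C cC; suff -> : A `&` g @^-1` C = A `&` f @^-1` C by exact: cf.
by apply/seteqP; split=> x [Ax] /=; rewrite fg.
Qed.

Lemma cont_onU (A B : set S) (f : S -> T) :
  cont_on A f -> cont_on B f -> cont_on (A `|` B) f.
Proof.
by move=> cA cB C cC; rewrite setIUl; apply: closedU; [exact: cA|exact: cB].
Qed.

(** The last hypothesis and the conclusion are [cont_on B g] and [cont_on A (g \o f)], unfolded
    because inside the section [cont_on] is fixed to maps from [S] to [T]. *)
Lemma cont_on_comp (A : set S) (B : set T) (f : S -> T) (g : T -> U) :
  closed B -> (forall x, A x -> B (f x)) -> cont_on A f ->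
  (forall C, closed C -> closed (B `&` g @^-1` C)) ->
  forall C, closed C -> closed (A `&` (g \o f) @^-1` C).
Proof.
move=> cB AB cf cg C cC.
suff -> : A `&` (g \o f) @^-1` C = A `&` f @^-1` (B `&` g @^-1` C).
  by apply: cf; exact: cg.
apply/seteqP; split=> x /= [Ax]; last by case.
by move=> gfx; split=> //; split=> //; exact: AB.
Qed.

End ContOn.

Lemma cont_on_closed_image {S T : topologicalType} (A : set S) (q : S -> T) :
  compact A -> closed A -> hausdorff_space T -> cont_on A q ->
  forall C, closed (A `&` C) -> closed (q @` (A `&` C)).
Proof.
move=> kA cA hT cq C cC; apply: compact_closed => //.
apply: continuous_compact; last first.
  by apply: subclosed_compact kA _ => // x [].
by apply: (@continuous_subspaceW _ _ _ A) => [x []//|]; apply/cont_onP.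
Qed.

(** A continuous map from a compact set to a Hausdorff space is closed, hence a quotient map onto
    its image. Applied to maps times the identity of the unit interval, this is how homotopies
    descend to quotients. *)
Lemma cont_on_image {S T U : topologicalType} (A : set S) (q : S -> T)
    (g : T -> U) :
  compact A -> closed A -> hausdorff_space T -> cont_on A q ->
  cont_on A (g \o q) -> cont_on (q @` A) g.
Proof.
move=> kA cA hT cq cgq C cC.
suff -> : q @` A `&` g @^-1` C = q @` (A `&` (g \o q) @^-1` C).
  by apply: cont_on_closed_image => //; exact: cgq.
apply/seteqP; split=> [_ [[x Ax <-] gx]|_ [x [Ax gx] <-]]; first by exists x.
by split=> //; exists x.
Qed.

Lemma hausdorff_prod (S T : topologicalType) :
  hausdorff_space S -> hausdorff_space T -> hausdorff_space (S * T)%type.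
Proof.
move=> hS hT [x1 y1] [x2 y2] h; congr pair.
  apply: hS => A B nA nB.
  have [||[z1 z2] [[/= ? _] [/= ? _]]] := h (A `*` setT) (B `*` setT).
  - by exists (A, setT) => //; split => //; exact: filterT.
  - by exists (B, setT) => //; split => //; exact: filterT.
  by exists z1.
apply: hT => A B nA nB.
have [||[z1 z2] [[/= _ ?] [/= _ ?]]] := h (setT `*` A) (setT `*` B).
- by exists (setT, A) => //; split => //; exact: filterT.
- by exists (setT, B) => //; split => //; exact: filterT.
by exists z2.
Qed.

Lemma continuous_pair (S T U : topologicalType) (f : S -> T) (g : S -> U) :
  continuous f -> continuous g -> continuous (fun x => (f x, g x)).
Proof. by move=> cf cg x; apply: cvg_pair; [exact: cf|exact: cg]. Qed.

Lemma cont_on_pair (S T U : topologicalType) (A : set S) (f : S -> T)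
    (g : S -> U) :
  closed A -> cont_on A f -> cont_on A g -> cont_on A (fun x => (f x, g x)).
Proof.
move=> cA cf cg; apply/cont_onP => // x.
by apply: cvg_pair; [move/cont_onP: cf|move/cont_onP: cg]; apply.
Qed.

Lemma fst_continuous (S T : topologicalType) : continuous (@fst S T).
Proof. by move=> x; exact: cvg_fst. Qed.

Lemma snd_continuous (S T : topologicalType) : continuous (@snd S T).
Proof. by move=> x; exact: cvg_snd. Qed.

Lemma closed_diagonal (S : topologicalType) :
  hausdorff_space S -> closed [set u : S * S | u.1 = u.2].
Proof.
move=> hS [x y] cxy /=; apply: hS => A B nA nB.
have [|[z w] [/= <- [? ?]]] := cxy (A `*` B); first by exists (A, B).
by exists z.
Qed.

(** * Closed equivalence relations on compact Hausdorff spaces *)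

Section QuotientHausdorff.
Variables (R : realType) (T : topologicalType) (Q : quotType T).
Local Open Scope quotient_scope.
Local Notation Qt := (quotient_topology Q).
Hypotheses (kT : compact [set: T]) (hT : hausdorff_space T).
Hypothesis cE : closed [set u : T * T | \pi_Qt u.1 = \pi_Qt u.2].

(** The saturation is the projection of a closed, hence compact, part of [T * T]. *)
Let closed_sat (C : set T) :
  closed C -> closed [set y | exists2 x, C x & \pi_Qt x = \pi_Qt y].
Proof.
move=> cC.
pose D := [set u : T * T | C u.1] `&` [set u : T * T | \pi_Qt u.1 = \pi_Qt u.2].
have -> : [set y | exists2 x, C x & \pi_Qt x = \pi_Qt y] = snd @` ([set: T * T] `&` D).
  apply/seteqP; split=> [y [x Cx xy]|_ [[x y] [_ [/= Cx xy]] <-]].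
    by exists (x, y).
  by exists x.
have kTT : compact [set: T * T] by rewrite -setXTT; exact: compact_setX.
have cTT : closed [set: T * T] by exact: closedT.
apply: (cont_on_closed_image kTT cTT hT).
  by apply: cont_onT => //; exact: snd_continuous.
rewrite setTI; apply: closedI => //.
by move/continuous_closedP: (@fst_continuous T T); exact.
Qed.

Lemma quotient_hausdorff : hausdorff_space Qt.
Proof.
rewrite open_hausdorff => p p' pp'.
pose fib (q : Qt) := [set y : T | \pi_Qt y = q :> Qt].
have cfib q : closed (fib q).
  rewrite (_ : fib q = [set y | exists2 x, [set generic_quotient.repr q] x &
      \pi_Qt x = \pi_Qt y]).
    apply: closed_sat; apply: accessible_closed_set1.
    exact: hausdorff_accessible.
  apply/seteqP; split=> y /=.
    by move=> e; exists (generic_quotient.repr q); rewrite // reprK.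
  by case=> _ -> /esym; rewrite reprK.
have sep : fib p `&` fib p' = set0.
  by apply/seteqP; split=> // y [/= yp yp']; move: pp'; rewrite -yp -yp' eqxx.
have [U [V [oU oV pU p'V UV0]]] := (@normal_openP R T).1
  (compact_normal hT kT) (fib p) (fib p') (cfib p) (cfib p') sep.
(* The classes contained in [W]. This turns disjoint neighbourhoods of two fibres into disjoint open
   sets of the quotient, because saturations of closed sets are closed. *)
pose core (W : set T) : set Qt :=
  ~` [set q | exists2 x, (~` W) x & \pi_Qt x = q :> Qt].
have ocore W : open W -> open (core W).
  move=> oW; rewrite /open /= /quotient_open.
  rewrite [X in open X](_ : _ = ~` [set y | exists2 x, (~` W) x & \pi_Qt x = \pi_Qt y]).
    by apply: closed_openC; apply: closed_sat; exact: open_closedC.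
  by apply/seteqP; split.
exists (core U, core V) => /=.
  rewrite !inE; split; move=> [x nW xp]; apply: nW; [exact: pU|exact: p'V].
split; [exact: ocore|exact: ocore|].
apply/eqP/seteqP; split=> // q [/= cU cV].
have : (U `&` V) (generic_quotient.repr q).
  by split; apply: contrapT => nW; [apply: cU|apply: cV];
    exists (generic_quotient.repr q) => //; rewrite reprK.
by rewrite UV0.
Qed.

End QuotientHausdorff.

(** * Injections of finite ordinals and points of simplices *)

Section Injections.

Lemma injn_eq m n (t u : injn m n) : t =1 u -> t = u.
Proof. by move=> tu; apply: val_inj; apply/ffunP. Qed.

Lemma injn_ofE m n (h : 'I_m -> 'I_n) (hI : injective h) i : injn_of hI i = h i.
Proof. exact: ffunE. Qed.

Lemma injn_idE n i : injn_id n i = i.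
Proof. exact: ffunE. Qed.

Lemma injn_compE m n k (t : injn n k) (u : injn m n) i :
  injn_comp t u i = t (u i).
Proof. exact: ffunE. Qed.

Lemma injn_permE n (s : 'S_n) i : injn_perm s i = s i.
Proof. exact: ffunE. Qed.

Lemma injn_le m n (t : injn m n) : (m <= n)%N.
Proof. by have := leq_card t (@injn_inj _ _ t); rewrite !card_ord. Qed.

Lemma injn_factor m n k (t : injn m k) (r : injn n k) :
  range t `<=` range r -> exists u : injn m n, t = injn_comp r u.
Proof.
move=> tr.
have hP i : exists j, r j = t i by have [|j _ <-] := tr (t i); [exists i|exists j].
pose h i := projT1 (cid (hP i)).
have rh i : r (h i) = t i by rewrite /h; case: cid.
have hI : injective h by move=> i j /(congr1 r); rewrite !rh => /injn_inj.
by exists (injn_of hI); apply: injn_eq => i; rewrite injn_compE injn_ofE rh.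
Qed.

Lemma injn_inv m n (t : injn m n) :
  (forall j, exists i, t i = j) ->
  exists u : injn n m, injn_comp t u = injn_id n /\ injn_comp u t = injn_id m.
Proof.
move=> tS; have [|u tu] := @injn_factor n m n (injn_id n) t.
  by move=> j _; have [i <-] := tS j; exists i.
exists u; split=> //; apply: injn_eq => i.
by apply: (@injn_inj _ _ t); rewrite injn_compE injn_idE -injn_compE -tu injn_idE.
Qed.

Lemma injn_endo_perm n (t : injn n n) : exists s : 'S_n, t = injn_perm s.
Proof.
exists (perm (@injn_inj _ _ t)); apply: injn_eq => i.
by rewrite injn_permE permE.
Qed.

Lemma injn_comp_id m n (t : injn m n) : injn_comp t (injn_id m) = t.
Proof. by apply: injn_eq => i; rewrite injn_compE injn_idE. Qed.

Lemma injn_id_comp m n (t : injn m n) : injn_comp (injn_id n) t = t.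
Proof. by apply: injn_eq => i; rewrite injn_compE injn_idE. Qed.

Lemma injn_compA m n k l (t : injn k l) (u : injn n k) (v : injn m n) :
  injn_comp t (injn_comp u v) = injn_comp (injn_comp t u) v.
Proof. by apply: injn_eq => i; rewrite !injn_compE. Qed.

End Injections.

Section Push.
Variable R : realType.

Lemma push_fun_im m n (t : injn m n) (a : 'rV[R]_m) i :
  push_fun t a 0 (t i) = a 0 i.
Proof.
rewrite mxE (big_pred1 i) // => j; apply/eqP/eqP => [|->//].
exact: (@injn_inj _ _ t).
Qed.

Lemma push_fun_out m n (t : injn m n) (a : 'rV[R]_m) j :
  (forall i, t i <> j) -> push_fun t a 0 j = 0.
Proof. by move=> tj; rewrite mxE big_pred0 // => i; apply/eqP/tj. Qed.

Lemma push_funP m n (t : injn m n) (a : 'rV[R]_m) (b : 'rV[R]_n) :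
  (forall i, b 0 (t i) = a 0 i) ->
  (forall j, (forall i, t i <> j) -> b 0 j = 0) -> b = push_fun t a.
Proof.
move=> h0 h1; apply/rowP => j.
have [[i <-]|nj] := pselect (exists i, t i = j); first by rewrite push_fun_im h0.
have nj' i : t i <> j by move=> ij; apply: nj; exists i.
by rewrite push_fun_out // h1.
Qed.

Lemma push_fun_comp m n k (t : injn n k) (u : injn m n) (a : 'rV[R]_m) :
  push_fun (injn_comp t u) a = push_fun t (push_fun u a).
Proof.
apply/esym/push_funP => [i|j nj]; first by rewrite injn_compE !push_fun_im.
have [[i ij]|nj'] := pselect (exists i, t i = j); last first.
  by rewrite push_fun_out // => i ij; apply: nj'; exists i.
rewrite -ij push_fun_im push_fun_out // => l li; apply: (nj l).
by rewrite injn_compE li.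
Qed.

Lemma push_fun_id n (a : 'rV[R]_n) : push_fun (injn_id n) a = a.
Proof.
by apply/rowP => i; rewrite -{1}(injn_idE i) push_fun_im.
Qed.

Lemma push_fun_inj m n (t : injn m n) : injective (@push_fun R m n t).
Proof.
by move=> a b ab; apply/rowP => i; rewrite -(push_fun_im t) ab push_fun_im.
Qed.

Lemma push_std m n (t : injn m n) (a : 'rV[R]_m) :
  stdsimplex R m a -> stdsimplex R n (push_fun t a).
Proof.
move=> /mem_set aS; have := push_subproof t (exist _ a aS : stdsimplex R m).
by move/set_mem.
Qed.

Definition opensimplex n : set 'rV[R]_n :=
  [set a | stdsimplex R n a /\ forall i, 0 < a 0 i].
Arguments opensimplex : clear implicits.

Lemma opensimplex_std n (a : 'rV[R]_n) : opensimplex n a -> stdsimplex R n a.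
Proof. by case. Qed.

(** Positivity of [a] makes the support of [push_fun t a] all of [range t], while the support of
    [push_fun u b] lies in [range u]. *)
Lemma push_open_range m n k (t : injn m k) (u : injn n k) (a : 'rV[R]_m)
    (b : 'rV[R]_n) :
  (forall i, 0 < a 0 i) -> push_fun t a = push_fun u b -> range t `<=` range u.
Proof.
move=> a0 ab _ [i _ <-]; apply: contrapT => nu.
have : push_fun u b 0 (t i) = 0.
  by apply: push_fun_out => j uj; apply: nu; exists j.
by rewrite -ab push_fun_im => /eqP; rewrite gt_eqF.
Qed.

Lemma push_facet n (a : 'rV[R]_n.+1) j : stdsimplex R n.+1 a -> a 0 j = 0 ->
  exists2 b, stdsimplex R n b & a = push_fun (injn_of (@lift_inj _ j)) b.
Proof.
move=> aS aj; exists (\row_i a 0 (lift j i)); last first.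
  apply: push_funP => [i|i]; first by rewrite injn_ofE mxE.
  case: (unliftP j i) => [l ->|->//] /(_ l); rewrite injn_ofE.
  by move/(_ erefl).
split=> [i|]; first by rewrite mxE; exact: aS.1.
rewrite -[RHS]aS.2 [RHS](bigD1 j) //= aj add0r.
rewrite [RHS](reindex_omap (lift j) (unlift j)) /=; last first.
  by move=> i ij; case: (unliftP j i) => [l ->//|e]; rewrite e eqxx in ij.
apply: eq_big => [i|i _]; last by rewrite mxE.
by rewrite liftK eqxx andbT eq_sym neq_lift.
Qed.

Lemma open_push n (a : 'rV[R]_n.+1) : stdsimplex R n.+1 a ->
  exists k (t : injn k.+1 n.+1) (c : 'rV[R]_k.+1),
    opensimplex k.+1 c /\ a = push_fun t c.
Proof.
elim: n a => [|n IH] a aS.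
  exists 0%N, (injn_id 1), a; split; last by rewrite push_fun_id.
  split=> // i; case: aS => _; rewrite big_ord_recl big_ord0 addr0 => e.
  by rewrite ord1 e.
have [a0|/existsNP[j /negP]] := pselect (forall i, 0 < a 0 i).
  by exists n.+1, (injn_id _), a; rewrite push_fun_id.
rewrite -leNgt => aj; have {}aj : a 0 j = 0.
  by apply/eqP; rewrite eq_le aj (aS.1 j).
have [b bS ab] := push_facet aS aj.
have [k [u [c [c0 bc]]]] := IH b bS.
exists k, (injn_comp (injn_of (@lift_inj _ j)) u), c.
by split=> //; rewrite push_fun_comp -bc.
Qed.

End Push.
Arguments opensimplex : clear implicits.

(** * The geometric realization of a finite complex *)

Section RealContinuity.
Variable R : realType.

Lemma continuous_mx (T : topologicalType) m n (f : T -> 'M[R]_(m, n)) :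
  (forall i j, continuous (fun x => f x i j)) -> continuous f.
Proof.
move=> cf x A [P nP PA].
apply: (@filterS _ (nbhs x) _ [set y | forall i j, P i j (f y i j)]).
  by move=> y Py; apply: PA.
apply: filter_forall => i; apply: filter_forall => j.
exact: (cf i j x) (nP i j).
Qed.

Lemma continuous_sum (T : topologicalType) (I : Type) (r : seq I) (P : pred I)
    (f : I -> T -> R) :
  (forall i, continuous (f i)) ->
  continuous (fun x => \sum_(i <- r | P i) f i x).
Proof.
move=> cf x; elim: r => [|i r IH].
  by under eq_fun do rewrite big_nil; exact: cvg_cst.
under eq_fun do rewrite big_cons.
by case: ifP => _; [apply: cvgD; [exact: cf|exact: IH]|exact: IH].
Qed.

Lemma continuous_bigmin (T : topologicalType) (I : Type) (r : seq I) (P : pred I)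
    (f : I -> T -> R) (c : R) :
  (forall i, continuous (f i)) ->
  continuous (fun x => \big[Num.min/c]_(i <- r | P i) f i x).
Proof.
move=> cf x; elim: r => [|i r IH].
  by under eq_fun do rewrite big_nil; exact: cvg_cst.
under eq_fun do rewrite big_cons; case: ifP => _ //.
by apply: (@continuous_min R T (f i)); [exact: cf|exact: IH].
Qed.

Lemma stdsimplex_le1 n (a : 'rV[R]_n) i : stdsimplex R n a -> a 0 i <= 1.
Proof.
move=> [a0 a1]; rewrite -a1 (bigD1 i) //= lerDl.
by apply: sumr_ge0 => j _; exact: a0.
Qed.

Lemma closed_stdsimplex n : closed (stdsimplex R n).
Proof.
rewrite (_ : stdsimplex R n =
   \bigcap_(i in [set: 'I_n]) ((fun a : 'rV[R]_n => a 0 i) @^-1` [set x | 0 <= x])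
   `&` (fun a : 'rV[R]_n => \sum_i a 0 i) @^-1` [set 1]); last first.
  apply/seteqP; split=> a [a0 a1]; split=> // i; first by move=> _; exact: a0.
  exact: a0.
apply: closedI.
  apply: closed_bigI => i _.
  by move/continuous_closedP: (@coord_continuous R 1 n 0 i); apply; exact: closed_ge.
have /continuous_closedP : continuous (fun a : 'rV[R]_n => \sum_i a 0 i).
  by apply: continuous_sum => i; exact: coord_continuous.
by apply; exact: closed_eq.
Qed.

Lemma compact_stdsimplex n : compact (stdsimplex R n).
Proof.
have K : compact [set a : 'rV[R]_n | forall i, a ord0 i \in `[0, 1]].
  have := @rV_compact R n (fun=> `[0, 1]%classic) (fun=> @segment_compact R 0 1). exact.
apply: (subclosed_compact _ K); first exact: closed_stdsimplex.
move=> a aS i; rewrite in_itv /=; apply/andP; split; first exact: aS.1.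
exact: stdsimplex_le1.
Qed.

Lemma push_continuous m n (t : injn m n) : continuous (@push_fun R m n t).
Proof.
apply: continuous_mx => i j; under eq_fun do rewrite mxE.
by apply: continuous_sum => k; exact: coord_continuous.
Qed.

Lemma mx_hausdorff m n : hausdorff_space 'M[R]_(m, n).
Proof. exact: norm_hausdorff. Qed.

Definition barycenter n : 'rV[R]_n.+1 := const_mx (n.+1%:R^-1).

Lemma barycenter_std n : stdsimplex R n.+1 (barycenter n).
Proof.
split=> [i|]; first by rewrite mxE invr_ge0.
under eq_bigr do rewrite mxE.
by rewrite sumr_const card_ord -[LHS]mulr_natr mulVf // pnatr_eq0.
Qed.

Lemma barycenterP n : barycenter n \in stdsimplex R n.+1.
Proof. exact/mem_set/barycenter_std. Qed.

End RealContinuity.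

Section RealizationPoints.
Variables (R : realType) (X : symDelta).
Local Open Scope quotient_scope.
Local Notation Z := (realization R X).

Definition to_std n (a : 'rV[R]_n.+1) : stdsimplex R n.+1 :=
  insubd (exist (fun b => b \in stdsimplex R n.+1) _ (barycenterP R n)) a.

Lemma to_stdK n (a : 'rV[R]_n.+1) : stdsimplex R n.+1 a -> val (to_std a) = a.
Proof. by move=> aS; rewrite insubdK //; exact/mem_set. Qed.

(** Meaningful only on the standard simplex: other points go to the barycenter. *)
Definition simplex_pt p (x : X p.+1) (a : 'rV[R]_p.+1) : Z :=
  \pi_Z (cell_point x (to_std a)).

Lemma simplex_pt_cont p (x : X p.+1) :
  {within stdsimplex R p.+1, continuous (simplex_pt x)}.
Proof.
apply/subspace_sigL_continuousP.
rewrite (_ : sigL _ _ = \pi_Z \o cell_point x); last first.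
  by apply/funext => a; rewrite /sigL /= /simplex_pt /to_std valKd.
move=> a; apply: continuous_comp; last exact: pi_continuous.
exact: (@existT_continuous (simplices X) (fun s => stdsimplex R (tag s).+1) (existT _ p x)).
Qed.

Lemma simplex_pt_cont_on p (x : X p.+1) :
  cont_on (stdsimplex R p.+1) (simplex_pt x).
Proof. apply/cont_onP; [exact: closed_stdsimplex|exact: simplex_pt_cont]. Qed.

(** The explicit form of the gluing relation: both points have the same interior
    representative in a common face. *)
Definition same_point (u v : prerealization R X) : Prop :=
  exists k (t : injn k.+1 (tag (tag u)).+1) (t' : injn k.+1 (tag (tag v)).+1)
    (c : 'rV[R]_k.+1),
    [/\ opensimplex R k.+1 c,
        val (tagged u : stdsimplex R _) = push_fun t c,
        val (tagged v : stdsimplex R _) = push_fun t' c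
      & pull t (tagged (tag u)) = pull t' (tagged (tag v))].

Lemma same_point_refl u : same_point u u.
Proof.
have [k [t [c [c0 uc]]]] := open_push (set_mem (valP (tagged u : stdsimplex R _))).
by exists k, t, t, c.
Qed.

Lemma same_point_sym u v : same_point u v -> same_point v u.
Proof. by move=> [k [t [t' [c []]]]]; exists k, t', t, c. Qed.

(** Two interior representatives of [v] are compared: positivity of the coordinates of [d] makes [s]
    factor through [t'], so that [d] serves for [u] as well. *)
Lemma same_point_trans u v w :
  same_point u v -> same_point v w -> same_point u w.
Proof.
move=> [k [t [t' [c [c0 uc vc x]]]]] [l [s [s' [d [d0 vd wd y]]]]].
have [r sr] : exists r, s = injn_comp t' r.
  by apply/injn_factor/(@push_open_range R _ _ _ _ _ d c d0.2); rewrite -vd -vc.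
have {}cd : c = push_fun r d.
  by apply/(@push_fun_inj _ _ _ t'); rewrite -push_fun_comp -sr -vd -vc.
exists l, (injn_comp t r), s', d; split=> //.
  by rewrite push_fun_comp -cd.
by rewrite pull_comp x -y sr pull_comp.
Qed.

Lemma glue_same_point u v : Defs.glue u v -> same_point u v.
Proof.
move=> [p [q [t [x [a [-> ->]]]]]].
have [k [s [c [c0 ac]]]] := open_push (set_mem (valP a)).
exists k, (injn_comp t s), s, c; split=> //=.
  by rewrite push_fun_comp -ac.
by rewrite pull_comp.
Qed.

Lemma same_pointP u v : \pi_Z u = \pi_Z v <-> same_point u v.
Proof.
split.
  move/eqmodP/asboolP; elim=> {u v} [u v|u|u v _|u v w _ + _].
  - exact: glue_same_point.
  - exact: same_point_refl.
  - exact: same_point_sym.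
  - exact: same_point_trans.
move=> [k [t [t' [c [c0 uc vc xy]]]]].
apply/eqmodP/asboolP.
have cS : c \in stdsimplex R k.+1 by apply/mem_set; case: c0.
pose c' : stdsimplex R k.+1 := exist _ c cS.
apply: (@rst_trans _ _ _ (cell_point (pull t (tagged (tag u))) c')).
  apply: rst_step; exists k, _, t, (tagged (tag u)), c'; split=> //.
  case: u t uc xy => -[p x] a /= t uc xy; rewrite /cell_point.
  by congr existT; apply: val_inj.
apply: rst_sym; rewrite xy.
apply: rst_step; exists k, _, t', (tagged (tag v)), c'; split=> //.
case: v t' vc xy => -[p x] a /= t' vc xy; rewrite /cell_point.
by congr existT; apply: val_inj.
Qed.

End RealizationPoints.

Lemma inj_hausdorff (S T : topologicalType) (f : S -> T) :
  injective f -> continuous f -> hausdorff_space T -> hausdorff_space S.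
Proof.
move=> fI cf hT x y xy; apply: fI; apply: hT => A B nA nB.
have [z [Az Bz]] := xy (f @^-1` A) (f @^-1` B) (cf _ _ nA) (cf _ _ nB).
by exists (f z).
Qed.

Lemma compact_set_type (T : topologicalType) (A : set T) (a0 : A) :
  closed A -> compact A -> compact [set: A].
Proof.
move=> cA kA; rewrite (_ : [set: _] = insubd a0 @` A).
  apply: continuous_compact kA; apply/subspace_sigL_continuousP.
  rewrite (_ : sigL _ _ = id); first exact: (fun a => cvg_id).
  by apply/funext => a; rewrite /sigL /= valKd.
apply/seteqP; split=> // a _; exists (val a); first exact: set_mem (valP a).
by rewrite valKd.
Qed.

(** * Carriers of points, compactness and the Hausdorff property *)

Section RealizationSpace.
Variables (R : realType) (X : symDelta).
Local Open Scope quotient_scope.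
Local Notation Z := (realization R X).

Lemma simplex_pt_push p q (t : injn p.+1 q.+1) (x : X q.+1) (c : 'rV[R]_p.+1) :
  stdsimplex R p.+1 c -> simplex_pt x (push_fun t c) = simplex_pt (pull t x) c.
Proof.
move=> cS; apply/same_pointP.
have [k [s [d [d0 cd]]]] := open_push cS.
exists k, (injn_comp t s), s, d; split=> //=.
- by rewrite to_stdK ?cd ?push_fun_comp //; apply: push_std; rewrite -cd.
- by rewrite to_stdK.
- by rewrite pull_comp.
Qed.

Lemma simplex_pt_surj (z : Z) :
  exists p (x : X p.+1) a, opensimplex R p.+1 a /\ z = simplex_pt x a.
Proof.
have -> : z = \pi_Z (generic_quotient.repr z) by rewrite reprK.
case: (generic_quotient.repr z) => -[p x] a.
have [k [s [c [c0 ac]]]] := open_push (set_mem (valP (a : stdsimplex R p.+1))).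
exists k, (pull s x), c; split=> //; rewrite -simplex_pt_push; last by case: c0.
rewrite -ac /simplex_pt /cell_point; congr (\pi_Z (existT _ _ _)).
by apply: val_inj; rewrite to_stdK //; exact: set_mem (valP a).
Qed.

(** The simplex of an interior point is its carrier, hence a face of every closed simplex through
    the point. For [y = x] this says that the open simplex is glued to itself only by
    automorphisms. *)
Lemma simplex_pt_eq p q (x : X p.+1) (y : X q.+1) a b :
  opensimplex R p.+1 a -> stdsimplex R q.+1 b -> simplex_pt x a = simplex_pt y b ->
  exists t : injn p.+1 q.+1, b = push_fun t a /\ pull t y = x.
Proof.
move=> a0 bS /same_pointP[k [t [t' [c [c0 /= + + xy]]]]].
rewrite !to_stdK //; last by case: a0.
move=> ac bc; have [|u [tu ut]] := @injn_inv _ _ t.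
  move=> j; apply: contrapT => tj.
  have := a0.2 j; rewrite ac push_fun_out ?ltxx // => i ij.
  by apply: tj; exists i.
exists (injn_comp t' u); split.
  by rewrite push_fun_comp ac -(push_fun_comp u) ut push_fun_id.
by rewrite pull_comp -xy -pull_comp tu pull_id.
Qed.

Hypothesis Xfin : finite_complex X.

Lemma to_std_cont n : cont_on (stdsimplex R n.+1) (@to_std R n).
Proof.
apply/cont_onP; first exact: closed_stdsimplex.
apply/subspace_sigL_continuousP.
rewrite (_ : sigL _ _ = id); first exact: (fun a => cvg_id).
by apply/funext => a; rewrite /sigL /= /to_std valKd.
Qed.

Lemma compact_std_type n : compact [set: stdsimplex R n.+1].
Proof.
exact: (@compact_set_type _ (stdsimplex R n.+1)
  (exist (fun b => b \in stdsimplex R n.+1) _ (barycenterP R n))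
  (@closed_stdsimplex R n.+1) (@compact_stdsimplex R n.+1)).
Qed.

Lemma prerealization_compact : compact [set: prerealization R X].
Proof. by apply: sigT_compact => // -[p x]; exact: compact_std_type. Qed.

Lemma prerealization_hausdorff : hausdorff_space (prerealization R X).
Proof.
apply: sigT_hausdorff => -[p x].
apply: (@inj_hausdorff _ _ (val : stdsimplex R p.+1 -> 'rV_p.+1)).
- exact: val_inj.
- exact: initial_continuous.
- exact: mx_hausdorff.
Qed.

Lemma cell_point_cont p (x : X p.+1) : continuous (@cell_point R X p x).
Proof.
exact: (@existT_continuous (simplices X) (fun s => stdsimplex R (tag s).+1) (existT _ p x)).
Qed.

(** The parameter [c] runs over the closed simplex, so that each piece is compact; the points stay
    equal on the boundary by [simplex_pt_push]. The types of [t] and [t'] are [injn] unfolded to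
    finite subtypes, since [closed_same_point] takes finite unions over them. *)
Let glued (s s' : simplices X) k
    (t : {h : {ffun 'I_k.+1 -> 'I_(tag s).+1} | injectiveb h})
    (t' : {h : {ffun 'I_k.+1 -> 'I_(tag s').+1} | injectiveb h}) :
    set (prerealization R X * prerealization R X) :=
  [set u | pull (t : injn _ _) (tagged s) = pull (t' : injn _ _) (tagged s') /\
    exists2 c : 'rV[R]_k.+1, stdsimplex R k.+1 c &
      (cell_point (tagged s) (to_std (push_fun (t : injn _ _) c)),
       cell_point (tagged s') (to_std (push_fun (t' : injn _ _) c))) = u].

Let closed_glued s s' k t t' : closed (@glued s s' k t t').
Proof.
have [xy|xy] := pselect (pull (t : injn _ _) (tagged s) =
                         pull (t' : injn _ _) (tagged s')); last first.
  rewrite (_ : glued _ _ = set0); first exact: closed0.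
  by apply/seteqP; split=> // u [].
pose F (c : 'rV[R]_k.+1) := (cell_point (tagged s) (to_std (push_fun (t : injn _ _) c)),
             cell_point (tagged s') (to_std (push_fun (t' : injn _ _) c))).
rewrite (_ : glued _ _ = F @` stdsimplex R k.+1); last first.
  by apply/seteqP; split=> [u [_ [c cS <-]]|_ [c cS <-]]; [exists c|split=> //; exists c].
apply: compact_closed.
  by apply: hausdorff_prod; exact: prerealization_hausdorff.
apply: continuous_compact; last exact: compact_stdsimplex.
have cS := @closed_stdsimplex R k.+1.
have side (r : simplices X) (w : injn k.+1 (tag r).+1) :
    cont_on (stdsimplex R k.+1)
      (fun c => cell_point (tagged r) (to_std (push_fun w c)) : prerealization R X).
  apply: (@cont_on_comp _ _ _ _ (stdsimplex R (tag r).+1) (push_fun w)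
      (fun c => cell_point (tagged r) (to_std c) : prerealization R X)).
  - exact: closed_stdsimplex.
  - by move=> c; exact: push_std.
  - by apply: cont_onT => //; exact: push_continuous.
  apply: (@cont_on_comp _ _ _ _ [set: stdsimplex R (tag r).+1] (@to_std R _)
      (fun c => cell_point (tagged r) c : prerealization R X)).
  - exact: closedT.
  - by [].
  - exact: to_std_cont.
  by apply: cont_onT; [exact: closedT|exact: cell_point_cont].
by apply/cont_onP => //; apply: cont_on_pair => //; exact: side.
Qed.

Lemma closed_same_point :
  closed [set u : prerealization R X * prerealization R X | \pi_Z u.1 = \pi_Z u.2].
Proof.
rewrite (_ : [set u | _] = \bigcup_(s in [set: simplices X])
   \bigcup_(s' in [set: simplices X]) \bigcup_(k in `I_(tag s).+1)
   \bigcup_(t in [set: {h : {ffun 'I_k.+1 -> 'I_(tag s).+1} | injectiveb h}])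
   \bigcup_(t' in [set: {h : {ffun 'I_k.+1 -> 'I_(tag s').+1} | injectiveb h}])
   glued t t').
  apply: closed_bigcup => // s _; apply: closed_bigcup => // s' _.
  apply: closed_bigcup => // k _.
  apply: closed_bigcup => [|t _]; first exact: finite_finset.
  by apply: closed_bigcup => [|t' _]; [exact: finite_finset|exact: closed_glued].
apply/seteqP; split=> [[[s a] [s' b]] /= /same_pointP[k [t [t' [c [c0 /= ac bc xy]]]]]|].
  exists s => //; exists s' => //; exists k; first exact: (injn_le t).
  exists t => //; exists t' => //; split=> //; exists c; first by case: c0.
  case: s a t ac xy => p x a t /= ac xy; case: s' b t' bc xy => q y b t' /= bc xy.
  have eqa : to_std (push_fun (t : injn _ _) c) = a.
    by apply: val_inj; rewrite to_stdK ?ac //; apply: push_std; case: c0.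
  have eqb : to_std (push_fun (t' : injn _ _) c) = b.
    by apply: val_inj; rewrite to_stdK ?bc //; apply: push_std; case: c0.
  by rewrite eqa eqb.
move=> u [s _ [s' _ [k _ [t _ [t' _ [xy [c cS <-]]]]]]] /=.
have := @simplex_pt_push _ _ (t : injn _ _) (tagged s) c cS.
have := @simplex_pt_push _ _ (t' : injn _ _) (tagged s') c cS.
by rewrite -xy /simplex_pt => <- ->.
Qed.

Lemma realization_hausdorff : hausdorff_space Z.
Proof.
apply: (@quotient_hausdorff R).
- exact: prerealization_compact.
- exact: prerealization_hausdorff.
- exact: closed_same_point.
Qed.

Lemma realization_compact : compact [set: Z].
Proof.
rewrite (_ : [set: Z] = \pi_Z @` [set: prerealization R X]).
  apply: continuous_compact; last exact: prerealization_compact.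
  by apply: continuous_subspaceT; exact: pi_continuous.
apply/seteqP; split=> // z _; exists (generic_quotient.repr z) => //.
by rewrite reprK.
Qed.

End RealizationSpace.

(** * Permissible faces and discrete Morse functions *)

Lemma injn_miss n (r : injn n n.+1) :
  exists v, (forall i, r i <> v) /\ forall j, j <> v -> exists i, r i = j.
Proof.
have card_r : #|~: [set r i | i : 'I_n]%SET| = 1%N.
  have := cardsC [set r i | i : 'I_n]%SET.
  rewrite (card_imset _ (@injn_inj _ _ r)) card_ord card_ord; lia.
have /cards1P[v rv] : #|~: [set r i | i : 'I_n]%SET| == 1%N by rewrite card_r.
exists v; split=> [i ri|j jv].
  have : v \in ~: [set r i | i : 'I_n]%SET by rewrite rv inE.
  by rewrite inE -ri imset_f.
have : j \notin ~: [set r i | i : 'I_n]%SET by rewrite rv inE; apply/eqP.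
by rewrite inE negbK => /imsetP[i _ ->]; exists i.
Qed.

Lemma injn_extend m n (t : injn m n) : (m < n)%N ->
  exists (r : injn m.+1 n) (u : injn m m.+1), t = injn_comp r u.
Proof.
move=> mn.
have [v tv] : exists v, forall i, t i <> v.
  apply: contrapT => /forallNP h.
  have tS j : exists i, t i = j.
    by have /existsNP[i /contrapT <-] := h j; exists i.
  have [u _] := injn_inv tS; have := injn_le u; lia.
(* The extra vertex [v] is put first, so that omitting index 0 gives back [t]. *)
pose h (i : 'I_m.+1) := if unlift ord0 i is Some k then t k else v.
have hI : injective h.
  move=> i j; rewrite /h; case: unliftP => [k ->|->]; case: unliftP => [l ->|->] //.
  - by move=> /injn_inj ->.
  - by move=> /tv.
  - by move=> /esym /tv.
exists (injn_of hI), (injn_of (@lift_inj _ ord0)).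
by apply: injn_eq => i; rewrite injn_compE !injn_ofE /h liftK.
Qed.

Lemma injn_permV n (s : injn n n) :
  exists s', injn_comp s s' = injn_id n /\ injn_comp s' s = injn_id n.
Proof.
apply: injn_inv => j; exists (finv s j).
by rewrite f_finv //; exact: injn_inj.
Qed.

Lemma range_comp_endo m n (t : injn m n) (s : injn m m) :
  range (injn_comp t s) = range t.
Proof.
have [s' [ss' _]] := injn_permV s.
apply/seteqP; split=> _ [i _ <-]; first by exists (s i); rewrite ?injn_compE.
by exists (s' i) => //; rewrite -injn_compE -injn_compA ss' injn_comp_id.
Qed.

(** * Orbits and permissible faces *)

Section Orbits.
Variable X : symDelta.

Definition orb p (a b : X p.+1) := exists t : injn p.+1 p.+1, pull t a = b.

Lemma orb_refl p (a : X p.+1) : orb a a.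
Proof. by exists (injn_id _); rewrite pull_id. Qed.

Lemma orb_sym p (a b : X p.+1) : orb a b -> orb b a.
Proof.
move=> [t <-]; have [s [ts _]] := injn_permV t; exists s.
by rewrite -pull_comp ts pull_id.
Qed.

Lemma orb_trans p (a b c : X p.+1) : orb a b -> orb b c -> orb a c.
Proof. by move=> [t <-] [s <-]; exists (injn_comp t s); rewrite pull_comp. Qed.

Lemma sym_orbitP p (a b : X p.+1) : sym_orbit a b <-> orb a b.
Proof.
split=> [[s _ <-]|[t <-]]; first by exists (injn_perm s).
by have [s ->] := injn_endo_perm t; exists s.
Qed.

Lemma sym_orbit_eq p (a b : X p.+1) : sym_orbit a = sym_orbit b <-> orb a b.
Proof.
split=> [e|ab].
  by apply/sym_orbitP; rewrite e; apply/sym_orbitP; exact: orb_refl.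
apply/seteqP; split=> c /sym_orbitP ac; apply/sym_orbitP.
  exact: orb_trans (orb_sym ab) ac.
exact: orb_trans ab ac.
Qed.

Lemma restrict_permE m n (r : injn m n) (s : 'S_n) :
  (forall i, exists j, r j = s (r i)) ->
  forall i, r (restrict_perm r s i) = s (r i).
Proof.
move=> h i; rewrite /restrict_perm.
set g := [ffun i => odflt i [pick j | r j == s (r i)]].
have rg k : r (g k) = s (r k).
  rewrite ffunE; case: pickP => [j /eqP //|nj].
  by have [j rj] := h k; have := nj j; rewrite rj eqxx.
have gI : injectiveb g.
  by apply/injectiveP => k l /(congr1 r); rewrite !rg => /perm_inj /injn_inj.
have e : pval (insubd (1%g : 'S_m) g) = g by exact: (insubdK (1%g : 'S_m) gI).
by rewrite -rg -[in RHS]e -pvalE.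
Qed.

Lemma permissible_fix p (a : X p.+1) (b : X p.+2) (r : injn p.+1 p.+2)
    (s : injn p.+2 p.+2) :
  (forall t u : injn p.+1 p.+2, glues t a b -> glues u a b -> range t = range u) ->
  glues r a b -> pull s b = b -> forall i, exists j, r j = s (r i).
Proof.
move=> ru rab sb i.
have sr : glues (injn_comp s r) a b by rewrite /glues pull_comp sb.
have [j _ rj] : range r (s (r i)).
  by rewrite (ru _ _ rab sr); exists i; rewrite ?injn_compE.
by exists j.
Qed.

(** Surjectivity of the restriction map is what condition (2) adds to (1): an
    automorphism fixing a facet pointwise is the identity. *)
Lemma permissibleP p (a : X p.+1) (b : X p.+2) : permissible a b <->
  exists r : injn p.+1 p.+2,
    [/\ glues r a b,
        forall t u : injn p.+1 p.+2, glues t a b -> glues u a b ->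
          range t = range u
      & forall s : injn p.+1 p.+1, pull s a = a ->
          exists2 s' : injn p.+2 p.+2, pull s' b = b &
            injn_comp s' r = injn_comp r s].
Proof.
split=> -[r [rab ru h]]; exists r; split=> //.
  move=> s' /[dup] s'a; have [s ->] := injn_endo_perm s' => sa.
  (* [misom] compares the non-identity elements of the two sets, so the identity is lifted
     separately. *)
  have [s1|s1] := eqVneq s 1%g.
    exists (injn_id _); rewrite ?pull_id //.
    apply: injn_eq => i; rewrite injn_compE injn_idE injn_compE injn_permE.
    by rewrite s1 perm1.
  have /imsetP[pi] : s \in restrict_perm r @: (sym_aut b)^#%g.
    by case/andP: h => _ /eqP ->; rewrite !inE s1 /=; apply/eqP.
  rewrite !inE => /andP[_ /eqP pib] ->; exists (injn_perm pi) => //.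
  apply: injn_eq => i; rewrite !injn_compE !injn_permE restrict_permE // => j.
  have [l rl] := permissible_fix ru rab pib j.
  by exists l; rewrite rl injn_permE.
have fixr pi : pi \in sym_aut b -> forall i, r (restrict_perm r pi i) = pi (r i).
  rewrite inE => /eqP pib; apply: restrict_permE => i.
  have [l rl] := permissible_fix ru rab pib i.
  by exists l; rewrite rl injn_permE.
have [v [rv vr]] := injn_miss r.
(* [pi] permutes the range of [r], whose complement is the single vertex [v]. *)
have fixv pi : pi \in sym_aut b -> pi v = v.
  move=> pib; apply: contrapT => /vr[i ri].
  have /permP/(_ i) := mulVg (restrict_perm r pi); rewrite permM perm1 => e.
  have := fixr pi pib ((restrict_perm r pi)^-1%g i).
  by rewrite e ri => /perm_inj/esym/rv.
apply/andP; split.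
  apply/morphicP => s t sb tb; apply/permP => i; apply: (@injn_inj _ _ r).
  have stb : (s * t)%g \in sym_aut b.
    rewrite inE (_ : injn_perm (s * t)%g = injn_comp (injn_perm t) (injn_perm s)).
      by move: sb tb; rewrite pull_comp !inE => /eqP sb /eqP ->; rewrite sb.
    by apply: injn_eq => j; rewrite injn_compE !injn_permE permM.
  by rewrite permM !fixr // permM.
rewrite /isom; apply/eqP/setP => s; apply/imsetP/idP => [[pi]|].
  rewrite !inE => /andP[pi1 pib] ->; apply/andP; split.
    apply: contra_neq pi1 => e; apply/permP => j; rewrite perm1.
    have [->|/eqP/vr[i <-]] := eqVneq j v; first by apply: fixv; rewrite inE.
    by rewrite -fixr ?inE // e perm1.
  apply/eqP; rewrite -[in RHS]rab -[in LHS]rab.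
  rewrite -pull_comp (_ : injn_comp _ _ = injn_comp (injn_perm pi) r).
    by rewrite pull_comp (eqP pib).
  by apply: injn_eq => i; rewrite !injn_compE !injn_permE fixr ?inE.
rewrite !inE => /andP[s1 /eqP /h[s' s'b s'r]].
have [pi s'pi] := injn_endo_perm s'; move: s'b s'r; rewrite {s'}s'pi => pib pir.
have spi : s = restrict_perm r pi.
  apply/permP => i; apply: (@injn_inj _ _ r); rewrite fixr ?inE; last exact/eqP.
  by have /(congr1 (fun t : injn _ _ => t i)) := pir; rewrite !injn_compE !injn_permE.
exists pi => //; rewrite !inE; apply/andP; split; last exact/eqP.
apply: contra_neq s1 => pi1; rewrite spi; apply/permP => i.
by apply: (@injn_inj _ _ r); rewrite fixr ?inE ?pi1 ?perm1 // -pi1; exact/eqP.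
Qed.

Lemma permissible_face p (a : X p.+1) (b : X p.+2) : permissible a b -> face a b.
Proof. by move=> [r []]; exists r. Qed.

Lemma permissible_orb p (a a' : X p.+1) (b b' : X p.+2) :
  orb a a' -> orb b b' -> permissible a b -> permissible a' b'.
Proof.
move=> [s <-] [t <-] /permissibleP[r [rab ru h]]; apply/permissibleP.
have [s' [ss' s's]] := injn_permV s; have [t' [tt' t't]] := injn_permV t.
have tK u : injn_comp t (injn_comp t' u) = u :> injn p.+1 p.+2.
  by rewrite injn_compA tt' injn_id_comp.
have glE u : glues u (pull s a) (pull t b) ->
    glues (injn_comp t (injn_comp u s')) a b.
  by rewrite /glues !pull_comp => ->; rewrite -pull_comp ss' pull_id.
exists (injn_comp t' (injn_comp r s)); split.
- by rewrite /glues -pull_comp tK pull_comp rab.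
- move=> u v /glE uab /glE vab; have := ru _ _ uab vab.
  rewrite !injn_compA !range_comp_endo => uv.
  apply/seteqP; split=> _ [i _ <-].
    have [j _] : range (injn_comp t v) (injn_comp t u i) by rewrite -uv; exists i.
    by rewrite !injn_compE => /injn_inj <-; exists j.
  have [j _] : range (injn_comp t u) (injn_comp t v i) by rewrite uv; exists i.
  by rewrite !injn_compE => /injn_inj <-; exists j.
move=> u ua; have [|w wb wr] := h (injn_comp s (injn_comp u s')).
  by rewrite !pull_comp ua -pull_comp ss' pull_id.
exists (injn_comp t' (injn_comp w t)).
  by rewrite !pull_comp -(pull_comp t) tt' pull_id wb.
rewrite -!injn_compA; congr injn_comp.
rewrite (injn_compA t) tt' injn_id_comp (injn_compA w) wr -!injn_compA.
by rewrite s's injn_comp_id.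
Qed.

(** [b'] is the other facet of [c] through this copy of [a]: it omits the vertex [r v] of [b]
    opposite to [a]. If it lay in the orbit of [b], then [b] would be glued to [c] with two
    different images, against condition (1). *)
Lemma permissible_diamond p (a : X p.+1) (b : X p.+2) (c : X p.+3) :
  face a b -> permissible b c ->
  exists b' : X p.+2, [/\ face a b', face b' c & ~ orb b b'].
Proof.
move=> [t tab] [r [rbc ru _]]; have [v [tv vt]] := injn_miss t.
pose r' : injn p.+2 p.+3 := injn_of (@lift_inj _ (r v)).
have [u tu] : exists u, injn_comp r t = injn_comp r' u.
  apply: injn_factor => _ [i _ <-].
  have : injn_comp r t i != r v by rewrite injn_compE; apply/eqP => /injn_inj/tv.
  by rewrite eq_sym => /unlift_some[j e _]; exists j => //; rewrite injn_ofE.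
exists (pull r' c); split; [|by exists r'|].
  by exists u; rewrite /glues -pull_comp -tu pull_comp rbc.
move=> /orb_sym[s sb].
have sr : glues (injn_comp r' s) b c by rewrite /glues pull_comp.
have : range r (r v) by exists v.
rewrite (ru _ _ rbc sr) range_comp_endo => -[i _]; rewrite injn_ofE.
by move/eqP; rewrite eq_sym (negbTE (neq_lift _ _)).
Qed.

End Orbits.

Lemma card_le1_unique (T : Type) (A : set T) x y :
  A #<= `I_1 -> A x -> A y -> x = y.
Proof.
move=> /card_leP[g] Ax Ay.
have I1 z : val (g z) = 0%N.
  by have /set_mem := valP (g z); rewrite /= ltnS leqn0 => /eqP.
suff [] : exist (fun z => z \in A) x (mem_set Ax) = exist _ y (mem_set Ay) by [].
by apply: (inj (f := g)); rewrite ?inE //; apply: val_inj; rewrite !I1.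
Qed.

Lemma finite_set_argmax (R : realType) (T : choiceType) (A : set T) (g : T -> R) :
  finite_set A -> A !=set0 -> exists2 x, A x & forall y, A y -> g y <= g x.
Proof.
move=> /finite_seqP[s ->]; elim: s => [[x]|x s IH _]; first by rewrite /= in_nil.
have [s0|] := eqVneq s [::].
  by exists x; rewrite ?s0 /= ?mem_head // => y; rewrite /= inE => /eqP ->.
case: s IH => // z s IH _; have [|w ws wmax] := IH; first by exists z; exact: mem_head.
have [xw|wx] := leP (g x) (g w).
  exists w => [|y]; rewrite /= inE; first by rewrite [_ \in _]ws orbT.
  by move=> /orP[/eqP ->//|]; exact: wmax.
exists x => [|y]; rewrite /= inE ?eqxx // => /orP[/eqP ->//|ys].
exact: le_trans (wmax _ ys) (ltW wx).
Qed.

(** * Matched pairs and the order of removal *)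

Section Morse.
Variables (R : realType) (X : symDelta) (f : forall p, X p.+1 -> R).
Hypothesis fmorse : discrete_morse f.

Definition matched p (a : X p.+1) (b : X p.+2) :=
  permissible a b /\ f b <= f a.

Lemma morse_orb p (a b : X p.+1) : orb a b -> f a = f b.
Proof. by case: fmorse => h _ _ _ /sym_orbitP; exact: h. Qed.

Lemma matched_orb p (a a' : X p.+1) (b b' : X p.+2) :
  orb a a' -> orb b b' -> matched a b -> matched a' b'.
Proof.
move=> aa bb [pab fab]; split; first exact: permissible_orb pab.
by rewrite -(morse_orb aa) -(morse_orb bb).
Qed.

Lemma matched_up p (a : X p.+1) (b b' : X p.+2) :
  matched a b -> matched a b' -> orb b b'.
Proof.
case: fmorse => _ _ h _ [pb fb] [pb' fb']; apply/sym_orbit_eq.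
apply: (card_le1_unique (h _ a)).
  by exists b => //; split=> //; exact: permissible_face.
by exists b' => //; split=> //; exact: permissible_face.
Qed.

Lemma matched_down p (a a' : X p.+1) (b : X p.+2) :
  matched a b -> matched a' b -> orb a a'.
Proof.
case: fmorse => _ _ _ h [pb fb] [pb' fb']; apply/sym_orbit_eq.
apply: (card_le1_unique (h _ b)).
  by exists a => //; split=> //; exact: permissible_face.
by exists a' => //; split=> //; exact: permissible_face.
Qed.

Lemma unmatched_lt p (a : X p.+1) (b : X p.+2) :
  face a b -> ~ matched a b -> f a < f b.
Proof.
move=> ab nab; have [pab|] := pselect (permissible a b).
  by rewrite ltNge; apply/negP => fba; apply: nab.
by case: fmorse => _ h _ _; exact: h.
Qed.

(** For the second facet [b'] between [a] and [c], neither [(a, b')] nor [(b', c)] is matched, as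
    [a] and [c] already have partners outside the orbit of [b']. This gives the cycle
    [f a < f b' < f c <= f b <= f a]. *)
Lemma matched_exclusive p (a : X p.+1) (b : X p.+2) (c : X p.+3) :
  matched a b -> matched b c -> False.
Proof.
move=> ab bc; have [b' [ab' b'c bb']] :=
  permissible_diamond (permissible_face ab.1) bc.1.
have h1 : f a < f b'.
  by apply: unmatched_lt ab' _ => /(matched_up ab).
have h2 : f b' < f c.
  by apply: unmatched_lt b'c _ => /(matched_down bc).
case: ab bc => _ fab [_ fbc].
have := lt_le_trans (lt_trans h1 h2) (le_trans fbc fab).
by rewrite ltxx.
Qed.

(** A lower partner can exist only when [p] is a successor, while [a] has arbitrary dimension; hence
    the equation between dependent pairs. *)
Lemma criticalP p (a : X p.+1) : critical f a <->
  (forall b : X p.+2, ~ matched a b) /\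
  (forall q (c : X q.+1) (b : X q.+2),
     q.+1 = p -> existT (fun q => X q.+1) p a = existT _ q.+1 b -> ~ matched c b).
Proof.
rewrite /critical !II0 !card_eq0; split.
  move=> [/eqP up /eqP dn]; split=> [b [pab fba]|q c b qp].
    suff : up_orbits f a (sym_orbit b) by rewrite up.
    by exists b => //; split=> //; exact: permissible_face.
  case: p / qp a up dn => a up dn /eqP; rewrite eq_Tagged /= => /eqP ab.
  move: dn; rewrite {}ab => dn [pcb fcb].
  suff : down_orbits f b (sym_orbit c) by rewrite dn.
  by exists c => //; split=> //; exact: permissible_face.
move=> [up dn]; split; apply/eqP/seteqP; split=> //.
  by move=> O [b [_ pab fba] _]; exact: (up b).
case: p a up dn => [a _ _ O []|p a up dn O [c [_ pca fca] _]].
exact: (dn p c a).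
Qed.

Lemma critical_up p (a : X p.+1) (b : X p.+2) : critical f a -> ~ matched a b.
Proof. by move=> /criticalP[h _]; exact: h. Qed.

Lemma critical_down p (a : X p.+1) (b : X p.+2) : critical f b -> ~ matched a b.
Proof. by move=> /criticalP[_ h]; exact: (h p a b). Qed.

Lemma critical_orb p (a b : X p.+1) : orb a b -> critical f a -> critical f b.
Proof.
move=> ab ca; apply/criticalP; split=> [c|q c d qp].
  by move/(matched_orb (orb_sym ab) (orb_refl c)); exact: critical_up.
case: p / qp a b ab ca => a b ab ca /eqP; rewrite eq_Tagged /= => /eqP bd.
rewrite -{d}bd => /(matched_orb (orb_refl c) (orb_sym ab)).
exact: critical_down.
Qed.

(** The value of a matched pair is that of its larger simplex: it is in this
    order, rather than in that of [f], that cofaces come later. *)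
Definition pair_value p (a : X p.+1) : R :=
  match pselect (exists b, matched a b) with
  | left h => f (projT1 (cid h))
  | right _ => f a
  end.

Lemma pair_value_up p (a : X p.+1) (b : X p.+2) :
  matched a b -> pair_value a = f b.
Proof.
move=> ab; rewrite /pair_value; case: pselect => [h|[]]; last by exists b.
by case: cid => c ac /=; apply: morse_orb; exact: matched_up ac ab.
Qed.

Lemma pair_value_le p (a : X p.+1) : pair_value a <= f a.
Proof.
rewrite /pair_value; case: pselect => [h|//].
by case: cid => c [_ ac] /=.
Qed.

Lemma pair_value_none p (a : X p.+1) :
  (forall b, ~ matched a b) -> pair_value a = f a.
Proof.
by move=> h; rewrite /pair_value; case: pselect => [[b ab]|//]; case: (h b).
Qed.

Lemma pair_value_matched p (a : X p.+1) (b : X p.+2) :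
  matched a b -> pair_value a = pair_value b.
Proof.
move=> ab; rewrite (pair_value_up ab) pair_value_none // => c.
exact: matched_exclusive ab.
Qed.

(** The delicate case is [b] matched with [c], where the value of [b] drops to [f c]. The comparison
    then goes through the other facet [b'] of [c] above [a], which is not matched with [c] and so
    satisfies [f b' < f c]. *)
Lemma pair_value_lt p (a : X p.+1) (b : X p.+2) :
  face a b -> ~ matched a b -> pair_value a < pair_value b.
Proof.
move=> ab nab; have [[c bc]|nb] := pselect (exists c, matched b c); last first.
  rewrite (@pair_value_none _ b) => [|c bc]; last by apply: nb; exists c.
  exact: le_lt_trans (pair_value_le a) (unmatched_lt ab nab).
rewrite (pair_value_up bc).
have [b' [ab' b'c bb']] := permissible_diamond ab bc.1.
have b'c_lt : f b' < f c.
  by apply: unmatched_lt b'c _ => /(matched_down bc).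
have [mab'|nab'] := pselect (matched a b'); first by rewrite (pair_value_up mab').
apply: le_lt_trans (pair_value_le a) _.
exact: lt_trans (unmatched_lt ab' nab') b'c_lt.
Qed.

(** A matched pair belongs to such a subcomplex as soon as its smaller simplex
    does; the converse follows from closure under faces. *)
Record subcomplex (K : forall p, set (X p.+1)) : Prop := Subcomplex {
  sub_face : forall p q (t : injn p.+1 q.+1) (y : X q.+1), K q y -> K p (pull t y);
  sub_matched : forall p (a : X p.+1) (b : X p.+2), matched a b -> K p a -> K p.+1 b }.

Definition remove_star (K : forall p, set (X p.+1)) p (a : X p.+1) :
  forall q, set (X q.+1) := fun q y => K q y /\ ~ face a y.

Lemma face_trans p q r (a : X p.+1) (b : X q.+1) (c : X r.+1) :
  face a b -> face b c -> face a c.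
Proof.
by move=> [t <-] [u <-]; exists (injn_comp u t); rewrite /glues pull_comp.
Qed.

Lemma face_le p q (a : X p.+1) (b : X q.+1) : face a b -> (p <= q)%N.
Proof. by move=> [t _]; have := injn_le t. Qed.

Lemma orb_face p (a b : X p.+1) : orb a b <-> face b a.
Proof. by split=> -[t]; exists t. Qed.

(** The index is the simplex whose star is removed. In the second case [b] is maximal in [K] and [a]
    is a free facet: every coface of [a] in [K] lies in the orbit of [a] or of [b]. *)
Variant removable (K : forall p, set (X p.+1)) : forall p, X p.+1 -> Prop :=
| RemoveCritical p (x : X p.+1) : critical f x -> K p x ->
    (forall q (y : X q.+1), K q y -> face x y -> q = p) -> removable K x
| RemovePair p (a : X p.+1) (b : X p.+2) : matched a b -> K p.+1 b ->
    (forall q (y : X q.+1), K q y -> face b y -> q = p.+1) ->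
    (forall q (y : X q.+1), K q y -> face a y -> q = p \/ q = p.+1 /\ face y b) ->
    removable K a.

Section Removal.
Variable K : forall p, set (X p.+1).
Arguments K : clear implicits.
Hypothesis Ksub : subcomplex K.

Lemma coface1 p q (a : X p.+1) (y : X q.+1) : face a y -> (p < q)%N -> K q y ->
  exists b : X p.+2, [/\ face a b, face b y & K p.+1 b].
Proof.
move=> [t ta] pq Ky; have [|r [u tu]] := @injn_extend _ _ t; first by [].
exists (pull r y); split; [|by exists r|exact: sub_face].
by exists u; rewrite /glues -pull_comp -tu.
Qed.

(** At a simplex of maximal [pair_value], [pair_value_lt] leaves room for no coface in [K] other
    than a matched partner; [coface1] reduces higher cofaces to codimension one. *)
Lemma exists_removable : finite_complex X ->
  (exists p (x : X p.+1), K p x) ->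
  exists p (x : X p.+1), K p x /\ removable K x.
Proof.
move=> Xfin [p0 [x0 Kx0]].
pose A := [set s : simplices X | K _ (tagged s)].
have Afin : finite_set A by apply: sub_finite_set Xfin.
have [s Ks smax] := finite_set_argmax (fun s => pair_value (tagged s)) Afin
  (ex_intro A (existT _ p0 x0) Kx0).
have vmax p (x : X p.+1) : K p x -> pair_value x <= pair_value (tagged s).
  by move=> Kx; exact: (smax (existT _ p x)).
(* Stated for any [a] reaching the maximum, because the maximal simplex found may be the upper
   member of its pair; the lower member then has the same value. *)
have pairR p (a : X p.+1) (b : X p.+2) : matched a b -> K p a ->
    pair_value (tagged s) <= pair_value a -> removable K a.
  move=> ab Ka amax; have Kb : K p.+1 b by exact: sub_matched Ka.
  have bmax q (y : X q.+1) : K q y -> face b y -> q = p.+1.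
    move=> Ky bY; apply/eqP; rewrite eqn_leq (face_le bY) andbT leqNgt.
    apply/negP => pq; have [c [bc _ Kc]] := coface1 bY pq Ky.
    have := pair_value_lt bc (matched_exclusive ab).
    rewrite -(pair_value_matched ab) ltNge => /negP; apply.
    exact: le_trans (vmax _ _ Kc) amax.
  apply: (RemovePair ab) => // q y Ky aY.
  have := face_le aY; rewrite leq_eqVlt => /orP[/eqP pq|pq]; [by left|right].
  have [c [ac cY Kc]] := coface1 aY pq Ky.
  have mac : matched a c.
    apply: contrapT => /(pair_value_lt ac); rewrite ltNge => /negP; apply.
    exact: le_trans (vmax _ _ Kc) amax.
  have cb := matched_up mac ab.
  have bY : face b y by apply: face_trans cY; apply/orb_face.
  have qp := bmax _ _ Ky bY; split=> //.
  have e := esym qp; case: q / e y Ky pq aY cY bY {qp} => y _ _ _ _ bY.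
  exact/orb_face/orb_sym/orb_face.
case: s Ks smax vmax pairR => p x /= Kx _ vmax pairR.
have [[b xb]|nup] := pselect (exists b, matched x b).
  by exists p, x; split=> //; exact: pairR xb _ _.
have [cx|ncx] := pselect (critical f x).
  exists p, x; split=> //; apply: RemoveCritical => // q y Ky xy.
  apply/eqP; rewrite eqn_leq (face_le xy) andbT leqNgt.
  apply/negP => pq; have [c [xc _ Kc]] := coface1 xy pq Ky.
  have := pair_value_lt xc (critical_up cx).
  by rewrite ltNge vmax.
have [q [c [b [qp e cb]]]] : exists q (c : X q.+1) (b : X q.+2),
    [/\ q.+1 = p, existT (fun q => X q.+1) p x = existT _ q.+1 b & matched c b].
  apply: contrapT => h; apply: ncx; apply/criticalP; split=> [b xb|q c b qp e cb].
    by apply: nup; exists b.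
  by apply: h; exists q, c, b.
case: p / qp x e Kx vmax pairR {nup ncx} => x /eqP.
rewrite eq_Tagged /= => /eqP -> Kb vmax pairR.
have Kc : K q c.
  by have [t <-] := permissible_face cb.1; exact: sub_face.
exists q, c; split=> //; apply: (pairR _ _ _ cb Kc).
by rewrite (pair_value_matched cb).
Qed.

(** The danger is a pair [(c, d)] losing only [d]. The removed orbits are those of one critical
    simplex or of one matched pair, so [d] would be critical, or the lower member of another pair,
    or matched from below by both [c] and [a]. *)
Lemma remove_star_sub p (a : X p.+1) : removable K a ->
  subcomplex (remove_star K a).
Proof.
move=> rem; split=> [q r t y [Ky ay]|q c d cd [Kc ac]].
  split; first exact: sub_face.
  by move=> h; apply: ay; apply: face_trans h _; exists t.
have Kd : K q.+1 d by exact: sub_matched Kc.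
split=> // ad; case: rem ac ad => {p a} [p x cx _ xmax|p a b ab _ bmax amax] ac ad.
  have qp := xmax _ _ Kd ad; case: p / qp x cx ac ad {xmax} => x cx _ xd.
  by apply: (@critical_down _ c d); [apply: critical_orb cx; exact/orb_sym/orb_face|].
have [qp|[[qp] db]] := amax _ _ Kd ad.
  case: p / qp a b ab ac ad {bmax amax} => a b ab _ /orb_face da.
  exact: matched_exclusive cd (matched_orb (orb_sym da) (orb_refl b) ab).
case: p / qp a b ab db ac ad {bmax amax} => a b ab /orb_face bd ac _.
apply: ac; apply/orb_face; apply: matched_down cd _.
exact: matched_orb (orb_refl a) bd ab.
Qed.

End Removal.

End Morse.

(** * Deformations compatible with an equivalence relation *)

Section MinCoord.
Variable R : realType.

(** The initial value 1 is harmless: coordinates in a simplex are at most 1. *)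
Definition min_coord n (P : pred 'I_n) (a : 'rV[R]_n) : R :=
  \big[Num.min/1]_(i | P i) a 0 i.

Lemma min_coord_le n (P : pred 'I_n) (a : 'rV[R]_n) i :
  P i -> min_coord P a <= a 0 i.
Proof. exact: bigmin_le_cond. Qed.

Lemma min_coord_ge n (P : pred 'I_n) (a : 'rV[R]_n) m :
  m <= 1 -> (forall i, P i -> m <= a 0 i) -> m <= min_coord P a.
Proof. by move=> m1 ma; apply/bigmin_geP; split. Qed.

Lemma min_coord_eq n (P : pred 'I_n) (a : 'rV[R]_n) i :
  P i -> a 0 i <= 1 -> (forall j, P j -> a 0 i <= a 0 j) ->
  min_coord P a = a 0 i.
Proof.
move=> Pi ai1 h; apply/eqP; rewrite eq_le min_coord_le //=.
exact: min_coord_ge.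
Qed.

Lemma min_coord_attained n (P : pred 'I_n) (a : 'rV[R]_n) i0 :
  P i0 -> stdsimplex R n a -> exists2 i, P i & min_coord P a = a 0 i.
Proof.
move=> Pi0 aS; have := @bigmin_eq_arg _ R _ 1 i0 P (fun i => a 0 i) Pi0.
move=> e; eexists; last exact: (e (fun i _ => stdsimplex_le1 i aS)).
by case: arg_minP.
Qed.

Lemma min_coord_ge0 n (P : pred 'I_n) (a : 'rV[R]_n) :
  stdsimplex R n a -> 0 <= min_coord P a.
Proof. by move=> aS; apply: min_coord_ge => // i _; exact: aS.1. Qed.

Lemma min_coord_push n (P Q : pred 'I_n) (a : 'rV[R]_n) (t : injn n n) :
  (forall i, Q (t i) = P i) -> min_coord Q (push_fun t a) = min_coord P a.
Proof.
move=> QP; rewrite /min_coord (reindex t).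
  by apply: eq_big => [i|i _]; rewrite ?QP // push_fun_im.
have [s [ts st]] := injn_permV t; exists s => i _.
  by rewrite -injn_compE st injn_idE.
by rewrite -injn_compE ts injn_idE.
Qed.

Lemma min_coord_continuous n (P : pred 'I_n) : continuous (@min_coord n P).
Proof. by apply: continuous_bigmin => i; exact: coord_continuous. Qed.

End MinCoord.

Section Stage.
Variables (R : realType) (X : symDelta) (f : forall p, X p.+1 -> R).
Hypothesis Xfin : finite_complex X.
Local Notation Z := (realization R X).
Local Notation I01 := (`[0, 1]%classic : set R).
Local Notation Delta p := (stdsimplex R p.+1).

Definition critical_pt p (z : Z) :=
  exists x : X p.+1, critical f x /\
    exists2 a, opensimplex R p.+1 a & z = simplex_pt x a.

(** This bounds the dimension of the carrier of [z] without naming the carrier, which is a face of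
    every closed simplex containing [z]. *)
Definition dim_le d (z : Z) := exists q (y : X q.+1) b,
  [/\ (q <= d)%N, Delta q b & z = simplex_pt y b].

(** A deformation of [B] whose flow respects the equivalence relation [E] and
    whose final map collapses its classes exhibits [B -> B / E] as a homotopy
    equivalence. *)
Record stage (B : set Z) (E : Z -> Z -> Prop) (h : Z * R -> Z) : Prop := Stage {
  st_closed : closed B;
  st_sub : forall z w, E z w -> B z /\ B w;
  st_refl : forall z, B z -> E z z;
  st_sym : forall z w, E z w -> E w z;
  st_trans : forall z w u, E z w -> E w u -> E z u;
  st_Eclosed : closed [set u : Z * Z | E u.1 u.2];
  st_cont : cont_on (B `*` I01) h;
  st_in : forall z t, B z -> I01 t -> B (h (z, t));
  st_0 : forall z, B z -> h (z, 0) = z;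
  st_pres : forall z w t, E z w -> I01 t -> E (h (z, t)) (h (w, t));
  st_1 : forall z w, E z w -> h (z, 1) = h (w, 1);
  st_crit : forall z d, B z -> dim_le d z ->
    exists k w, [/\ (k <= d)%N, critical_pt k w & E z w];
  st_uniq : forall z w k l, E z w -> critical_pt k z -> critical_pt l w -> z = w }.

Lemma closed_I01 : closed (I01 : set R).
Proof. exact: interval_closed. Qed.

Lemma I01P (t : R) : I01 t <-> 0 <= t <= 1.
Proof. by rewrite /= in_itv. Qed.

Lemma I01_0 : I01 (0 : R). Proof. by apply/I01P; rewrite lexx ler01. Qed.
Lemma I01_1 : I01 (1 : R). Proof. by apply/I01P; rewrite lexx ler01. Qed.

Lemma closed_setX (S T : topologicalType) (A : set S) (B : set T) :
  closed A -> closed B -> closed (A `*` B).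
Proof.
move=> cA cB; rewrite (_ : A `*` B = fst @^-1` A `&` snd @^-1` B) //.
by apply: closedI; [move/continuous_closedP: (@fst_continuous S T)|
  move/continuous_closedP: (@snd_continuous S T)]; exact.
Qed.

Lemma simplex_pt_closed_image p (x : X p.+1) : closed (simplex_pt x @` Delta p).
Proof.
rewrite -[Delta p]setTI setIC; apply: cont_on_closed_image.
- exact: compact_stdsimplex.
- exact: closed_stdsimplex.
- exact: realization_hausdorff.
- exact: simplex_pt_cont_on.
- by rewrite setIT; exact: closed_stdsimplex.
Qed.

Lemma cont_on_simplex_pt (S : topologicalType) (A : set S) p (x : X p.+1)
    (g : S -> 'rV[R]_p.+1) :
  closed A -> cont_on A g -> (forall s, A s -> Delta p (g s)) ->
  cont_on A (fun s => simplex_pt x (g s)).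
Proof.
move=> cA cg Ag; apply: (@cont_on_comp _ _ _ A (Delta p) g (simplex_pt x)) => //.
  exact: closed_stdsimplex.
exact: simplex_pt_cont_on.
Qed.

(** Both attaching a critical simplex and collapsing a pair use this. Compatibility of [e] with the
    gluing is asked only outside [B], since on [B] the values are prescribed by [h]. *)
Lemma extend_homotopy (B : set Z) (h : Z * R -> Z) p (x : X p.+1)
    (e : 'rV[R]_p.+1 * R -> Z) :
  closed B -> cont_on (B `*` I01) h -> cont_on (Delta p `*` I01) e ->
  (forall a b t, Delta p a -> Delta p b -> I01 t ->
    simplex_pt x a = simplex_pt x b -> ~ B (simplex_pt x a) -> e (a, t) = e (b, t)) ->
  (forall a t, Delta p a -> I01 t -> B (simplex_pt x a) ->
    e (a, t) = h (simplex_pt x a, t)) ->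
  exists h' : Z * R -> Z,
    [/\ cont_on ((B `|` simplex_pt x @` Delta p) `*` I01) h',
        forall z t, B z -> h' (z, t) = h (z, t)
      & forall a t, Delta p a -> I01 t -> h' (simplex_pt x a, t) = e (a, t)].
Proof.
move=> cB ch ce eE eB.
pose h' (u : Z * R) := if pselect (B u.1) then h u else
  if pselect (exists a, Delta p a /\ simplex_pt x a = u.1) is left w
  then e (projT1 (cid w), u.2) else u.1.
have h'B z t : B z -> h' (z, t) = h (z, t) by rewrite /h' /=; case: pselect.
have h'x a t : Delta p a -> I01 t -> h' (simplex_pt x a, t) = e (a, t).
  move=> aS tI; have [Ba|nBa] := pselect (B (simplex_pt x a)).
    by rewrite h'B // eB.
  rewrite /h' /=; case: pselect => [//|nB]; case: pselect => [w|[]]; last by exists a.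
  by case: cid => b [bS ba] /=; apply: eE => //; rewrite ba.
exists h'; split=> //.
rewrite (_ : _ `*` _ = B `*` I01 `|`
    (fun u => (simplex_pt x u.1, u.2)) @` (Delta p `*` I01)).
  apply: cont_onU; first by apply: eq_cont_on ch => -[z t] [/= Bz _]; rewrite h'B.
  have cD : closed (Delta p `*` (I01 : set R)).
    by apply: closed_setX; [exact: closed_stdsimplex|exact: closed_I01].
  apply: cont_on_image => //.
  - by apply: compact_setX; [exact: compact_stdsimplex|exact: segment_compact].
  - by apply: hausdorff_prod; [exact: realization_hausdorff|exact: Rhausdorff].
  - apply: cont_on_pair => //; last by apply: cont_onT => //; exact: snd_continuous.
    apply: cont_on_simplex_pt => //; last by move=> u [].
    by apply: cont_onT => //; exact: fst_continuous.
  by apply: eq_cont_on ce => -[a t] [/= aS tI]; rewrite h'x.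
apply/seteqP; split=> [[z t] [/= [Bz|[a aS <-]] tI]|[z t]].
- by left.
- by right; exists (a, t).
- move=> [[/= Bz tI]|[[a s] [/= aS sI] [<- <-]]]; split=> //=; first by left.
  by right; exists a.
Qed.

End Stage.

(** * Attaching a critical simplex *)

Section Attach.
Variables (R : realType) (X : symDelta) (f : forall p, X p.+1 -> R).
Hypothesis Xfin : finite_complex X.
Local Notation Z := (realization R X).
Local Notation I01 := (`[0, 1]%classic : set R).
Local Notation Delta p := (stdsimplex R p.+1).
Local Notation minc := (@min_coord R _ xpredT).

(** Writing a point of the simplex as [m *: barycenter + (1 - m) *: b] with [b]
    in the boundary, [m] is [p.+1%:R * min_coord a]; the retraction of
    [simplex x [0, 1]] onto [simplex x {0}] and [boundary x [0, 1]] sends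
    [(a, t)] to [(radial a t, t - 2 * radial_depth a t)]. *)
Definition radial_depth p (a : 'rV[R]_p.+1) (t : R) : R :=
  Num.min (p.+1%:R * minc a) (Num.min t 1 / 2).

Definition radial p (a : 'rV[R]_p.+1) (t : R) : 'rV[R]_p.+1 :=
  (1 - radial_depth a t)^-1 *: (a - radial_depth a t *: barycenter R p).

(** Capping [t] at 1 keeps the depth at most 1/2 for all [a] and [t], so the divisor in [radial]
    never vanishes and [radial] is continuous on the whole space. *)
Lemma radial_depth_lt1 p (a : 'rV[R]_p.+1) t : 0 < 1 - radial_depth a t.
Proof.
have : radial_depth a t <= 1 / 2.
  by rewrite ge_min; apply/orP; right; rewrite ler_pM2r // ge_min lexx orbT.
lra.
Qed.

Lemma radial_depth_ge0 p (a : 'rV[R]_p.+1) t :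
  Delta p a -> 0 <= t -> 0 <= radial_depth a t.
Proof.
move=> aS t0; rewrite le_min; apply/andP; split.
  by apply: mulr_ge0 => //; exact: min_coord_ge0.
by apply: divr_ge0 => //; rewrite le_min t0 ler01.
Qed.

Lemma radial_depth_le p (a : 'rV[R]_p.+1) t : t <= 1 -> radial_depth a t <= t / 2.
Proof.
move=> t1; rewrite ge_min; apply/orP; right.
by rewrite ler_pM2r // ge_min lexx.
Qed.

Lemma radialE p (a : 'rV[R]_p.+1) t i :
  radial a t 0 i = (1 - radial_depth a t)^-1 *
    (a 0 i - radial_depth a t / p.+1%:R).
Proof. by rewrite !mxE. Qed.

Lemma radial_std p (a : 'rV[R]_p.+1) t : Delta p a -> Delta p (radial a t).
Proof.
move=> aS; have d0 := radial_depth_lt1 a t; split=> [i|].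
  rewrite radialE; apply: mulr_ge0; first by rewrite invr_ge0 ltW.
  rewrite subr_ge0 ler_pdivrMr ?ltr0n // ge_min; apply/orP; left.
  by rewrite mulrC ler_pM2r ?ltr0n //; exact: min_coord_le.
under eq_bigr do rewrite radialE.
rewrite -mulr_sumr sumrB aS.2 sumr_const card_ord -[(_ / _) *+ _]mulr_natl.
rewrite mulrCA divff ?pnatr_eq0 // mulr1.
by rewrite mulVf // gt_eqF.
Qed.

Lemma radial_depth_continuous p :
  continuous (fun u : 'rV[R]_p.+1 * R => radial_depth u.1 u.2).
Proof.
move=> u; apply: (@continuous_min R _ (fun u : 'rV[R]_p.+1 * R => p.+1%:R * minc u.1)
  (fun u => Num.min u.2 1 / 2)).
  apply: cvgM; first exact: cvg_cst.
  apply: (@continuous_comp _ _ _ fst minc); first exact: fst_continuous.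
  exact: min_coord_continuous.
apply: cvgM; last exact: cvg_cst.
apply: (@continuous_min R _ snd (fun=> 1)); first exact: snd_continuous.
exact: cvg_cst.
Qed.

Lemma radial_continuous p :
  continuous (fun u : 'rV[R]_p.+1 * R => radial u.1 u.2).
Proof.
apply: continuous_mx => i j; rewrite ord1.
under eq_fun do rewrite radialE.
move=> u; apply: cvgM.
  apply: cvgV; first by rewrite gt_eqF //; exact: radial_depth_lt1.
  by apply: cvgB; [exact: cvg_cst|exact: radial_depth_continuous].
apply: cvgB.
  apply: (@continuous_comp _ _ _ fst (fun a : 'rV[R]_p.+1 => a 0 j)).
    exact: fst_continuous.
  exact: coord_continuous.
by apply: cvgM; [exact: radial_depth_continuous|exact: cvg_cst].
Qed.

Lemma radial_push p (a : 'rV[R]_p.+1) t (s : injn p.+1 p.+1) :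
  radial (push_fun s a) t = push_fun s (radial a t).
Proof.
apply: push_funP => [i|j nj].
  by rewrite !radialE push_fun_im /radial_depth (@min_coord_push _ _ xpredT).
by have [s' [ss' _]] := injn_permV s; case: (nj (s' j)); rewrite -injn_compE ss' injn_idE.
Qed.

Lemma radial_depth_push p (a : 'rV[R]_p.+1) t (s : injn p.+1 p.+1) :
  radial_depth (push_fun s a) t = radial_depth a t.
Proof. by rewrite /radial_depth (@min_coord_push _ _ xpredT). Qed.

Lemma radial_zero p (a : 'rV[R]_p.+1) t i : Delta p a -> 0 <= t ->
  a 0 i = 0 -> radial a t = a /\ radial_depth a t = 0.
Proof.
move=> aS t0 ai; have d0 : radial_depth a t = 0.
  apply/eqP; rewrite eq_le radial_depth_ge0 // andbT ge_min; apply/orP; left.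
  by rewrite pmulr_rle0 ?ltr0n // -ai min_coord_le.
by split=> //; rewrite /radial d0 scale0r !subr0 invr1 scale1r.
Qed.

Lemma radial_t0 p (a : 'rV[R]_p.+1) : Delta p a ->
  radial a 0 = a /\ radial_depth a 0 = 0.
Proof.
move=> aS; have d0 : radial_depth a 0 = 0.
  apply/eqP; rewrite eq_le radial_depth_ge0 // andbT ge_min; apply/orP; right.
  by rewrite min_l // mul0r.
by split=> //; rewrite /radial d0 scale0r !subr0 invr1 scale1r.
Qed.

Lemma radial_boundary p (a : 'rV[R]_p.+1) t : Delta p a -> t <= 1 ->
  p.+1%:R * minc a <= t / 2 -> exists i, radial a t 0 i = 0.
Proof.
move=> aS t1 le; have [i _ ai] := @min_coord_attained R _ xpredT a ord0 isT aS.
exists i; rewrite radialE (_ : radial_depth a t = p.+1%:R * a 0 i).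
  by rewrite mulrAC divff ?pnatr_eq0 // mul1r subrr mulr0.
by rewrite /radial_depth ai min_l // (min_l t1) -ai.
Qed.

Section AttachStage.
Variables (B : set Z) (E : Z -> Z -> Prop) (h : Z * R -> Z) (p : nat) (x : X p.+1).
Hypothesis st : stage f B E h.
Hypothesis cx : critical f x.
Hypothesis xbd : forall a i, Delta p a -> a 0 i = 0 -> B (simplex_pt x a).
Hypothesis xopen : forall a, opensimplex R p.+1 a -> ~ B (simplex_pt x a).

Let openP a : Delta p a -> ~ B (simplex_pt x a) -> opensimplex R p.+1 a.
Proof.
move=> aS nB; split=> // i; rewrite lt_neqAle aS.1 andbT; apply/eqP => ai.
exact/nB/(xbd aS (esym ai)).
Qed.

Let closedp a : Delta p a -> B (simplex_pt x a) -> exists i, a 0 i = 0.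
Proof.
move=> aS Ba; apply: contrapT => /forallNP ai; apply: (xopen (a := a)) => //.
split=> // i; rewrite lt_neqAle aS.1 andbT; apply/eqP => e.
exact: (ai i).
Qed.

(** The homotopy composed with the retraction: [h] where the retraction lands on the boundary times
    the interval, the identity where it lands on the bottom. The test separates the two because [h]
    is controlled only over [B]. *)
Let e (u : 'rV[R]_p.+1 * R) : Z :=
  if p.+1%:R * minc u.1 <= u.2 / 2
  then h (simplex_pt x (radial u.1 u.2), u.2 - 2 * radial_depth u.1 u.2)
  else simplex_pt x (radial u.1 u.2).

Let time_in a t : Delta p a -> I01 t -> I01 (t - 2 * radial_depth a t).
Proof.
move=> aS /I01P/andP[t0 t1]; apply/I01P.
have := radial_depth_ge0 aS t0; have := radial_depth_le a t1.
by move=> ? ?; apply/andP; split; lra.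
Qed.

Let radial_in a t : Delta p a -> I01 t -> p.+1%:R * minc a <= t / 2 ->
  B (simplex_pt x (radial a t)).
Proof.
move=> aS /I01P/andP[t0 t1] le; have [i ai] := radial_boundary aS t1 le.
exact: (xbd (radial_std t aS) ai).
Qed.

Let cont_radial (A : set ('rV[R]_p.+1 * R)) : closed A -> A `<=` Delta p `*` I01 ->
  cont_on A (fun u => simplex_pt x (radial u.1 u.2)).
Proof.
move=> cA AD; apply: cont_on_simplex_pt => //.
  by apply: cont_onT => //; exact: radial_continuous.
by move=> u /AD[/= aS _]; exact: radial_std.
Qed.

Let e_cont : cont_on (Delta p `*` I01) e.
Proof.
pose lo := [set u : 'rV[R]_p.+1 * R | p.+1%:R * minc u.1 <= u.2 / 2].
pose hi := [set u : 'rV[R]_p.+1 * R | u.2 / 2 <= p.+1%:R * minc u.1].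
have cm : continuous (fun u : 'rV[R]_p.+1 * R => p.+1%:R * minc u.1 - u.2 / 2).
  move=> u; apply: cvgB.
    apply: cvgM; first exact: cvg_cst.
    apply: (@continuous_comp _ _ _ fst minc); first exact: fst_continuous.
    exact: min_coord_continuous.
  by apply: cvgM; [exact: snd_continuous|exact: cvg_cst].
have clo : closed lo.
  rewrite (_ : lo = (fun u : 'rV[R]_p.+1 * R => p.+1%:R * minc u.1 - u.2 / 2)
      @^-1` [set y | y <= 0]).
    by move/continuous_closedP: cm; apply; exact: closed_le.
  by apply/seteqP; split=> u /=; rewrite subr_le0.
have chi : closed hi.
  rewrite (_ : hi = (fun u : 'rV[R]_p.+1 * R => p.+1%:R * minc u.1 - u.2 / 2)
      @^-1` [set y | 0 <= y]).
    by move/continuous_closedP: cm; apply; exact: closed_ge.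
  by apply/seteqP; split=> u /=; rewrite subr_ge0.
have cD : closed (Delta p `*` I01).
  by apply: closed_setX; [exact: closed_stdsimplex|exact: closed_I01].
rewrite (_ : _ `*` _ = (Delta p `*` I01) `&` lo `|` (Delta p `*` I01) `&` hi).
  apply: cont_onU.
    have cA : closed (Delta p `*` I01 `&` lo) by exact: closedI.
    apply: (@eq_cont_on _ _ _ (h \o
        (fun u => (simplex_pt x (radial u.1 u.2), u.2 - 2 * radial_depth u.1 u.2)))).
      by move=> u [_ /= le]; rewrite /e le.
    apply: (@cont_on_comp _ _ _ _ (B `*` I01)).
    - by apply: closed_setX; [exact: st_closed st|exact: closed_I01].
    - move=> [a t] [/= [aS tI] le]; split; first exact: radial_in.
      exact: time_in.
    - apply: cont_on_pair => //; first by apply: cont_radial => // u [].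
      apply: cont_onT => // u; apply: cvgB; first exact: snd_continuous.
      by apply: cvgM; [exact: cvg_cst|exact: radial_depth_continuous].
    - exact: st_cont st.
  apply: (@eq_cont_on _ _ _ (fun u => simplex_pt x (radial u.1 u.2))).
    move=> [a t] [[/= aS tI]]; rewrite /hi /e /= => ge; case: ifP => // le.
    (* On the overlap the depth is [t / 2], so the remaining time is 0, where [h] is the
       identity. *)
    rewrite (_ : t - _ = 0) ?(st_0 st) //; first exact: radial_in.
    have eq : p.+1%:R * minc a = t / 2 by apply/eqP; rewrite eq_le le ge.
    move/I01P/andP: tI => [t0 t1].
    rewrite /radial_depth eq (min_l t1) minxx; lra.
  by apply: cont_radial => [|u []//]; exact: closedI.
apply/seteqP; split=> u; last by case=> -[].
by move=> uD; have [?|/ltW ?] := leP (p.+1%:R * minc u.1) (u.2 / 2); [left|right].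
Qed.

Let B' := B `|` simplex_pt x @` Delta p.
Let E' z w := E z w \/ z = w /\ B' z.

Lemma attach_stage : exists h', stage f B' E' h'.
Proof.
have [||h' [ch' h'B h'x]] :=
  extend_homotopy (x := x) Xfin (st_closed st) (st_cont st) e_cont.
- move=> a b t aS bS tI ab nB; have ao := openP aS nB.
  have [s [-> sx]] := simplex_pt_eq ao bS ab.
  rewrite /e /= radial_push radial_depth_push (@min_coord_push _ _ xpredT) //.
  by rewrite simplex_pt_push ?sx //; exact: radial_std.
- move=> a t aS tI Ba; have [i ai] := closedp aS Ba.
  move/I01P/andP: tI => [t0 t1].
  have [e1 e2] := radial_zero aS t0 ai.
  rewrite /e /= e1 e2 mulr0 subr0 ifT //.
  rewrite (le_trans _ (divr_ge0 t0 (ler0n _ 2))) // pmulr_rle0 ?ltr0n //.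
  by rewrite -ai min_coord_le.
have cB := st_closed st.
have inB' z t : B' z -> I01 t -> B' (h' (z, t)).
  move=> Bz tI; have [Bz'|nBz] := pselect (B z).
    by left; rewrite h'B //; exact: st_in st _ _ Bz' tI.
  case: Bz => // -[a aS <-]; rewrite h'x // /e /=; case: ifP => le; last first.
    by right; exists (radial a t) => //; exact: radial_std.
  by left; apply: (st_in st); [exact: radial_in|exact: time_in].
exists h'.
split.
- by apply: closedU => //; exact: simplex_pt_closed_image.
- move=> z w [/(st_sub st)[Bz Bw]|[<- Bz]] //; by split; left.
- by move=> z Bz; right.
- by move=> z w [/(st_sym st) ?|[<- ?]]; [left|right].
- move=> z w u [zw|[<- Bz]] // [wu|[<- _]]; left => //; exact: (st_trans st zw).
- rewrite (_ : [set u | _] = [set u : Z * Z | E u.1 u.2] `|`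
    [set u : Z * Z | u.1 = u.2] `&` fst @^-1` B').
    apply: closedU; first exact: st_Eclosed st.
    apply: closedI; first exact/closed_diagonal/realization_hausdorff.
    move/continuous_closedP: (@fst_continuous Z Z); apply.
    by apply: closedU => //; exact: simplex_pt_closed_image.
  by apply/seteqP; split.
- exact: ch'.
- exact: inB'.
- move=> z [Bz|[a aS <-]]; first by rewrite h'B // (st_0 st).
  rewrite h'x //; last exact: I01_0.
  have [e1 e2] := radial_t0 aS; rewrite /e /= e1 e2 mulr0 subr0.
  case: ifP => // le; rewrite (st_0 st) //.
  by have := radial_in aS (I01_0 R) le; rewrite e1.
- move=> z w t [zw tI|[<- Bz] tI].
    have [Bz Bw] := st_sub st zw.
    by left; rewrite !h'B //; exact: st_pres st _ _ _ zw tI.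
  by right; split=> //; exact: inB'.
- move=> z w [zw|[<- _]] //; have [Bz Bw] := st_sub st zw.
  by rewrite !h'B //; exact: st_1 st _ _ zw.
(* A new point lies in the open critical simplex and represents its own class; [p <= d] because [x]
   is its carrier. *)
- move=> z d Bz zd; have [Bz'|nBz] := pselect (B z).
    by have [k [w [kd kw zw]]] := st_crit st Bz' zd; exists k, w; split=> //; left.
  case: Bz => // -[a aS az]; have ao : opensimplex R p.+1 a.
    by apply: openP => //; rewrite az.
  exists p, z; split; [|by exists x; split=> //; exists a|
    by right; split=> //; right; exists a].
  have [q [y [b [qd bS zb]]]] := zd; rewrite -az in zb.
  have [t _] := simplex_pt_eq ao bS zb.
  by apply: leq_trans qd; exact: (injn_le t).
- move=> z w k l [zw|[//]]; exact: st_uniq st _ _ _ _ zw.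
Qed.

End AttachStage.
End Attach.

(** * Collapsing a matched pair *)

Section Collapse.
Variables (R : realType) (X : symDelta) (f : forall p, X p.+1 -> R).
Hypothesis Xfin : finite_complex X.
Local Notation Z := (realization R X).
Local Notation I01 := (`[0, 1]%classic : set R).
Local Notation Delta p := (stdsimplex R p.+1).

Section PushIn.
Variables (p : nat) (v : 'I_p.+2).
Local Notation minv := (@min_coord R p.+2 (predC1 v)).

(** [push_in c 1] projects the simplex onto the union of its facets other than
    the one opposite [v], and [push_in c s] slides along the projection lines. *)
Definition push_in (c : 'rV[R]_p.+2) (s : R) : 'rV[R]_p.+2 :=
  \row_i if i == v then c 0 v + s * (p.+1%:R * minv c) else c 0 i - s * minv c.

Lemma push_in_v c s : push_in c s 0 v = c 0 v + s * (p.+1%:R * minv c).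
Proof. by rewrite mxE eqxx. Qed.

Lemma push_in_nv c s i : i != v -> push_in c s 0 i = c 0 i - s * minv c.
Proof. by rewrite mxE => /negbTE ->. Qed.

Lemma other_vertex : lift v ord0 != v.
Proof. by rewrite eq_sym neq_lift. Qed.

Lemma push_in_std c s : Delta p.+1 c -> I01 s -> Delta p.+1 (push_in c s).
Proof.
move=> cS /I01P/andP[s0 s1]; have m0 := min_coord_ge0 (predC1 v) cS.
split=> [i|].
  have [->|iv] := eqVneq i v; last first.
    rewrite push_in_nv // subr_ge0; apply: (@le_trans _ _ (minv c)).
      by rewrite ler_piMl.
    exact: min_coord_le.
  rewrite push_in_v; apply: addr_ge0; first exact: cS.1.
  by rewrite !mulr_ge0.
rewrite (bigD1 v) //= push_in_v (eq_bigr (fun i => c 0 i - s * minv c)); last first.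
  by move=> i iv; rewrite push_in_nv.
rewrite sumrB sumr_const -[RHS]cS.2 [RHS](bigD1 v) //=.
have -> : #|predC1 v| = p.+1 by rewrite cardC1 card_ord.
by rewrite -[(_ * minv c) *+ _]mulr_natl; ring.
Qed.

Lemma min_push_in c s : Delta p.+1 c -> I01 s ->
  minv (push_in c s) = (1 - s) * minv c.
Proof.
move=> cS sI; have [i iv ci] := min_coord_attained (P := predC1 v) other_vertex cS.
have cSs := push_in_std cS sI.
rewrite (@min_coord_eq _ _ _ _ i) //.
- by rewrite push_in_nv // -ci; ring.
- exact: stdsimplex_le1.
- by move=> j jv; rewrite !push_in_nv // lerD2r -ci min_coord_le.
Qed.

(** Sliding stays on the projection line. This gives [rt_d] below, which makes the slide preserve
    the pulled back relation. *)
Lemma push_in_push_in c s : Delta p.+1 c -> I01 s ->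
  push_in (push_in c s) 1 = push_in c 1.
Proof.
move=> cS sI; apply/rowP => i; have [->|iv] := eqVneq i v.
  by rewrite !push_in_v min_push_in //; ring.
by rewrite !push_in_nv // min_push_in //; ring.
Qed.

Lemma push_in_0 c : push_in c 0 = c.
Proof.
apply/rowP => i; have [->|iv] := eqVneq i v.
  by rewrite push_in_v mul0r addr0.
by rewrite push_in_nv // mul0r subr0.
Qed.

Lemma push_in_id c s : minv c = 0 -> push_in c s = c.
Proof.
move=> c0; apply/rowP => i; have [->|iv] := eqVneq i v.
  by rewrite push_in_v c0 !mulr0 addr0.
by rewrite push_in_nv // c0 mulr0 subr0.
Qed.

Lemma min_coord_zero c i : Delta p.+1 c -> i != v -> c 0 i = 0 -> minv c = 0.
Proof.
move=> cS iv ci; apply/eqP; rewrite eq_le min_coord_ge0 // andbT -ci.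
exact: min_coord_le.
Qed.

Lemma push_in_1 c : Delta p.+1 c -> exists2 i, i != v & push_in c 1 0 i = 0.
Proof.
move=> cS; have [i iv ci] := min_coord_attained (P := predC1 v) other_vertex cS.
by exists i => //; rewrite push_in_nv // mul1r ci subrr.
Qed.

(** The slide singles out [v], so it commutes only with permutations fixing [v]; [aut_fix] shows
    that the automorphisms of [b] are such. *)
Lemma push_in_push c s (t : injn p.+2 p.+2) : t v = v ->
  push_in (push_fun t c) s = push_fun t (push_in c s).
Proof.
move=> tv; have mt : minv (push_fun t c) = minv c.
  apply: min_coord_push => i /=; congr (~~ _); apply/eqP/eqP => [|->//].
  by rewrite -[in RHS]tv => /injn_inj.
have tE i : (t i == v) = (i == v).
  by apply/eqP/eqP => [|->//]; rewrite -[in RHS]tv => /injn_inj.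
apply: push_funP => [i|j nj].
  have [->|iv] := eqVneq i v; last by rewrite !push_in_nv ?tE // mt push_fun_im.
  by rewrite tv !push_in_v mt; congr (_ + _); rewrite -{1}tv push_fun_im.
by have [t' [tt' _]] := injn_permV t; case: (nj (t' j)); rewrite -injn_compE tt' injn_idE.
Qed.

Lemma push_in_continuous :
  continuous (fun u : 'rV[R]_p.+2 * R => push_in u.1 u.2).
Proof.
have cm : continuous (fun u : 'rV[R]_p.+2 * R => minv u.1).
  move=> u; apply: (@continuous_comp _ _ _ fst minv); first exact: fst_continuous.
  exact: min_coord_continuous.
have cc i : continuous (fun u : 'rV[R]_p.+2 * R => u.1 0 i).
  move=> u; apply: (@continuous_comp _ _ _ fst (fun a : 'rV[R]_p.+2 => a 0 i)).
    exact: fst_continuous.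
  exact: coord_continuous.
apply: continuous_mx => i j; rewrite ord1; have [->|jv] := eqVneq j v.
  under eq_fun do rewrite push_in_v.
  move=> u; apply: cvgD; first exact: cc.
  apply: cvgM; first exact: snd_continuous.
  by apply: cvgM; [exact: cvg_cst|exact: cm].
under eq_fun do rewrite push_in_nv //.
move=> u; apply: cvgB; first exact: cc.
by apply: cvgM; [exact: snd_continuous|exact: cm].
Qed.

End PushIn.

Section CollapseStage.
Variables (B : set Z) (E : Z -> Z -> Prop) (h : Z * R -> Z).
Variables (p : nat) (a : X p.+1) (b : X p.+2) (r : injn p.+1 p.+2) (v : 'I_p.+2).
Hypothesis st : stage f B E h.
Hypotheses (rv : forall i, r i <> v) (vr : forall j, j <> v -> exists i, r i = j).
Hypothesis rab : glues r a b.
Hypothesis ru : forall t u : injn p.+1 p.+2, glues t a b -> glues u a b ->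
  range t = range u.
Hypothesis rlift : forall s : injn p.+1 p.+1, pull s a = a ->
  exists2 s' : injn p.+2 p.+2, pull s' b = b & injn_comp s' r = injn_comp r s.

(** The open simplex of [b] together with its open facet [a]. *)
Definition free_part : set 'rV[R]_p.+2 :=
  [set c | Delta p.+1 c /\ forall i, i != v -> 0 < c 0 i].

Hypothesis xbd : forall c i, Delta p.+1 c -> i != v -> c 0 i = 0 -> B (simplex_pt b c).
Hypothesis xopen : forall c, free_part c -> ~ B (simplex_pt b c).
Hypothesis xcrit : forall c k, free_part c -> ~ critical_pt f k (simplex_pt b c).

Let free_partP c : Delta p.+1 c -> ~ B (simplex_pt b c) -> free_part c.
Proof.
move=> cS nB; split=> // i iv; rewrite lt_neqAle cS.1 andbT; apply/eqP => ci.
exact/nB/(xbd cS iv (esym ci)).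
Qed.

(** By condition (1) automorphisms of [b] preserve the range of [r]. If [t v] lay in this range, the
    inverse automorphism would carry it out of the range, to [v]. *)
Let aut_fix t : pull t b = b -> t v = v.
Proof.
move=> tb; apply: contrapT => /vr[i ri]; have [t' [tt' t't]] := injn_permV t.
have t'b : pull t' b = b by rewrite -[in LHS]tb -pull_comp tt' pull_id.
have [j rj] := permissible_fix ru rab t'b i.
by apply: (rv (i := j)); rewrite rj ri -injn_compE t't injn_idE.
Qed.

Lemma free_facet c : free_part c -> c 0 v = 0 ->
  exists2 c0, opensimplex R p.+1 c0 & c = push_fun r c0.
Proof.
move=> [cS c0] cv; have e : c = push_fun r (\row_i c 0 (r i)).
  apply: push_funP => [i|j nj]; first by rewrite mxE.
  have [->//|/eqP/vr[i ri]] := eqVneq j v; by case: (nj i).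
exists (\row_i c 0 (r i)) => //; split; last first.
  by move=> i; rewrite mxE; apply: c0; apply/eqP/rv.
split=> [i|]; first by rewrite mxE; exact: cS.1.
rewrite -[RHS]cS.2 [in RHS]e; under [RHS]eq_bigr do rewrite mxE.
by rewrite [LHS](partition_big r xpredT).
Qed.

Lemma free_open c : free_part c -> c 0 v != 0 -> opensimplex R p.+2 c.
Proof.
move=> [cS c0] cv; split=> // i; have [->|iv] := eqVneq i v; last exact: c0.
by rewrite lt_neqAle eq_sym cv; exact: cS.1.
Qed.

(** In the open simplex of [b] only automorphisms of [b] identify points. In the open facet,
    condition (1) turns an identification into an automorphism of [a], and [rlift], which is
    condition (2), extends it to [b]. *)
Let free_eq c c' : free_part c -> Delta p.+1 c' ->
  simplex_pt b c = simplex_pt b c' ->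
  exists t : injn p.+2 p.+2, [/\ c' = push_fun t c, pull t b = b & t v = v].
Proof.
move=> cf c'S cc'; have [cv|cv] := eqVneq (c 0 v) 0; last first.
  have co := free_open cf cv.
  have [t [ct tb]] := simplex_pt_eq co c'S cc'.
  by exists t; split=> //; exact: aut_fix.
have [c0 c0o cr] := free_facet cf cv.
move: cc'; rewrite cr simplex_pt_push; last by case: c0o.
rewrite rab => cc'; have [t [ct tb]] := simplex_pt_eq c0o c'S cc'.
have [s ts] : exists s, t = injn_comp r s.
  by apply: injn_factor; rewrite (ru tb rab).
have [s' s'b s'r] : exists2 s' : injn p.+2 p.+2, pull s' b = b &
    injn_comp s' r = injn_comp r s.
  by apply: rlift; rewrite -[in LHS]rab -pull_comp -ts.
exists s'; split=> //; last exact: aut_fix.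
by rewrite ct ts -s'r push_fun_comp.
Qed.

Let B' := B `|` simplex_pt b @` Delta p.+1.

Let BP z : B' z -> B z \/ exists2 c, free_part c & z = simplex_pt b c.
Proof.
move=> [Bz|[c cS <-]]; first by left.
have [Bc|nB] := pselect (B (simplex_pt b c)); first by left.
by right; exists c => //; exact: free_partP.
Qed.

(** The carrier of a free point is [a] or [b]. Since the retraction sends it into a facet of
    dimension [p], the bound [d] survives the collapse. *)
Let free_dim c d : free_part c -> dim_le d (simplex_pt b c) -> (p <= d)%N.
Proof.
move=> cf [q [y [b' [qd b'S cb']]]].
have [cv|cv] := eqVneq (c 0 v) 0; last first.
  have co := free_open cf cv.
  have [t _] := simplex_pt_eq co b'S cb'.
  by have := injn_le t; lia.
have [c0 c0o cr] := free_facet cf cv.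
move: cb'; rewrite cr simplex_pt_push; last by case: c0o.
by move=> cb'; have [t _] := simplex_pt_eq c0o b'S cb'; have := injn_le t; lia.
Qed.

Lemma collapse_retraction : exists d : Z * R -> Z,
  [/\ cont_on (B' `*` I01) d,
      forall z s, B z -> d (z, s) = z,
      forall c s, Delta p.+1 c -> I01 s ->
        d (simplex_pt b c, s) = simplex_pt b (push_in v c s)
    & forall z, B' z -> d (z, 0) = z].
Proof.
have cB := st_closed st.
(* The homotopy to be extended is the stationary one on [B], namely [fst]. *)
have [||||d [cd dB db]] := @extend_homotopy _ _ Xfin B fst _ b
  (fun u => simplex_pt b (push_in v u.1 u.2)) cB.
- apply: cont_onT; last exact: fst_continuous.
  by apply: closed_setX => //; exact: closed_I01.
- have cD : closed (Delta p.+1 `*` I01).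
    by apply: closed_setX; [exact: closed_stdsimplex|exact: closed_I01].
  apply: cont_on_simplex_pt => //.
    by apply: cont_onT => //; exact: push_in_continuous.
  by move=> [c s] [/= cS sI]; exact: push_in_std.
- move=> c c' s cS c'S sI cc' nB /=.
  have [t [-> tb tv]] := free_eq (free_partP cS nB) c'S cc'.
  by rewrite push_in_push // simplex_pt_push ?tb //; exact: push_in_std.
- move=> c s cS sI /= Bc; rewrite push_in_id //.
  apply: contrapT => /eqP m0; apply: (xopen (c := c)) => //; split=> // i iv.
  rewrite lt_neqAle cS.1 andbT; apply: contra_neq m0 => /esym.
  exact: min_coord_zero.
exists d; split=> // z [Bz|[c cS <-]]; first by rewrite dB.
by rewrite db // ?push_in_0 //; exact: I01_0.
Qed.

Lemma collapse_stage : exists E' h', stage f B' E' h'.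
Proof.
have [d [cd dB db d0]] := collapse_retraction.
pose rt z := d (z, 1).
have rtB z : B z -> rt z = z by move=> Bz; rewrite /rt dB.
have rt_in z : B' z -> B (rt z).
  move=> [Bz|[c cS <-]]; first by rewrite rtB.
  rewrite /rt db //; last exact: I01_1.
  have [i iv ci] := push_in_1 v cS.
  by apply: (xbd _ iv ci); apply: push_in_std => //; exact: I01_1.
have d_in z s : B' z -> I01 s -> B' (d (z, s)).
  move=> [Bz|[c cS <-]] sI; first by rewrite dB //; left.
  by rewrite db //; right; exists (push_in v c s) => //; exact: push_in_std.
have rt_d z s : B' z -> I01 s -> rt (d (z, s)) = rt z.
  move=> [Bz|[c cS <-]] sI; first by rewrite dB.
  rewrite db // /rt !db ?push_in_push_in //; try exact: I01_1.
  exact: push_in_std.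
have cB := st_closed st.
have cB' : closed B' by apply: closedU => //; exact: simplex_pt_closed_image.
have crt : cont_on B' rt.
  apply: (@cont_on_comp _ _ _ _ (B' `*` I01) (fun z => (z, 1)) d) => //.
  - by apply: closed_setX => //; exact: closed_I01.
  - by move=> z Bz; split=> //; exact: I01_1.
  apply: cont_on_pair => //; apply: cont_onT => // z; first exact: cvg_id.
  exact: cst_continuous.
have BB' z : B z -> B' z by left.
(* First slide onto [B], then apply [h] there. The halves agree at time 1/2, where both give
   [rt z]. *)
pose h' (u : Z * R) := if u.2 <= 1 / 2 then d (u.1, 2 * u.2)
  else h (rt u.1, 2 * u.2 - 1).
have loI (t : R) : I01 t -> t <= 1 / 2 -> I01 (2 * t).
  by move=> /I01P/andP[t0 t1] t2; apply/I01P/andP; split; lra.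
have hiI (t : R) : I01 t -> 1 / 2 <= t -> I01 (2 * t - 1).
  by move=> /I01P/andP[t0 t1] t2; apply/I01P/andP; split; lra.
exists (fun z w => [/\ B' z, B' w & E (rt z) (rt w)]), h'; split.
- exact: cB'.
- by move=> z w [].
- by move=> z Bz; split=> //; apply: (st_refl st); exact: rt_in.
- by move=> z w [Bz Bw zw]; split=> //; exact: st_sym st _ _ zw.
- by move=> z w u [Bz _ zw] [_ Bu wu]; split=> //; exact: st_trans st _ _ _ zw wu.
- rewrite (_ : [set u | _] = (B' `*` B') `&`
     (fun u => (rt u.1, rt u.2)) @^-1` [set u : Z * Z | E u.1 u.2]).
    have cBB : closed (B' `*` B') by exact: closed_setX.
    have cside (g : Z * Z -> Z) : continuous g ->
        (forall u, (B' `*` B') u -> B' (g u)) -> cont_on (B' `*` B') (rt \o g).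
      by move=> cg gB; apply: (@cont_on_comp _ _ _ _ B') => //; exact: cont_onT.
    have := cont_on_pair cBB (cside fst (@fst_continuous Z Z) _)
      (cside snd (@snd_continuous Z Z) _).
    by apply; [move=> u []|move=> u []|exact: st_Eclosed st].
  by apply/seteqP; split=> u /=; [case=> ? ? ?|case=> -[]].
- pose lo := [set u : Z * R | u.2 <= 1 / 2].
  pose hi := [set u : Z * R | 1 / 2 <= u.2].
  have clo : closed lo.
    move/continuous_closedP: (@snd_continuous Z R) => /(_ [set y | y <= 1 / 2]).
    by apply; exact: closed_le.
  have chi : closed hi.
    move/continuous_closedP: (@snd_continuous Z R) => /(_ [set y | 1 / 2 <= y]).
    by apply; exact: closed_ge.
  have cD : closed (B' `*` I01) by apply: closed_setX => //; exact: closed_I01.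
  rewrite (_ : _ `*` _ = (B' `*` I01) `&` lo `|` (B' `*` I01) `&` hi); last first.
    apply/seteqP; split=> u; last by case=> -[].
    by move=> uD; have [?|/ltW ?] := leP u.2 (1 / 2); [left|right].
  apply: cont_onU.
    apply: (@eq_cont_on _ _ _ (d \o (fun u => (u.1, 2 * u.2)))).
      by move=> u [_ /= le]; rewrite /h' le.
    apply: (@cont_on_comp _ _ _ _ (B' `*` I01)) => //.
      by move=> u [[/= Bu uI] le]; split=> //; exact: loI.
    apply: cont_on_pair; first exact: closedI.
      by apply: cont_onT; [exact: closedI|exact: fst_continuous].
    apply: cont_onT; first exact: closedI.
    by move=> u; apply: cvgM; [exact: cvg_cst|exact: snd_continuous].
  apply: (@eq_cont_on _ _ _ (h \o (fun u => (rt u.1, 2 * u.2 - 1)))).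
    move=> [z t] [[/= Bz tI] ge]; rewrite /h' /=; case: ifP => // le.
    have -> : t = 1 / 2 by apply/eqP; rewrite eq_le le ge.
    have -> : 2 * (1 / 2) - 1 = 0 :> R by field.
    have -> : 2 * (1 / 2) = 1 :> R by field.
    by rewrite (st_0 st) //; exact: rt_in.
  have cA : closed (B' `*` I01 `&` hi) by exact: closedI.
  apply: (@cont_on_comp _ _ _ _ (B `*` I01)).
  - by apply: closed_setX => //; exact: closed_I01.
  - by move=> u [[/= Bu uI] ge]; split; [exact: rt_in|exact: hiI].
  - apply: cont_on_pair => //.
      apply: (@cont_on_comp _ _ _ _ B' fst rt) => //; first by move=> u [[]].
      by apply: cont_onT => //; exact: fst_continuous.
    apply: cont_onT => // u; apply: cvgB; last exact: cvg_cst.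
    by apply: cvgM; [exact: cvg_cst|exact: snd_continuous].
  - exact: st_cont st.
- move=> z t Bz tI; rewrite /h' /=; case: ifPn => [le|].
    by apply: d_in => //; exact: loI.
  rewrite -ltNge => /ltW ge; left.
  by apply: (st_in st); [exact: rt_in|exact: hiI].
- move=> z Bz; rewrite /h' /= ifT; last by rewrite divr_ge0.
  by rewrite mulr0 d0.
(* During the slide [rt] of the moving point is constant by [rt_d]; afterwards the points are in
   [B], where [rt] is the identity and [st_pres] applies. *)
- move=> z w t [Bz Bw zw] tI; rewrite /h' /=; case: ifPn => [le|].
    have t2 := loI _ tI le.
    by rewrite !rt_d //; split=> //; exact: d_in.
  rewrite -ltNge => /ltW ge; have t2 := hiI _ tI ge.
  have Bhz := st_in st (rt_in _ Bz) t2; have Bhw := st_in st (rt_in _ Bw) t2.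
  by split; [left|left|rewrite (rtB _ Bhz) (rtB _ Bhw); exact: (st_pres st zw t2)].
- move=> z w [Bz Bw zw].
  have half : (1 <= 1 / 2 :> R) = false by apply/negbTE; rewrite -ltNge; lra.
  rewrite /h' /= half.
  have -> : 2 * 1 - 1 = 1 :> R by ring.
  exact: (st_1 st zw).
- move=> z d' Bz zd; have rd : dim_le d' (rt z).
    case: (BP Bz) => [Bz'|[c cf zc]]; first by rewrite rtB.
    have cS : Delta p.+1 c by case: cf.
    rewrite zc /rt db //; last exact: I01_1.
    have [i iv ci] := push_in_1 v cS.
    have [c' c'S ->] := push_facet (push_in_std v cS (I01_1 R)) ci.
    exists p, (pull (injn_of (@lift_inj _ i)) b), c'; split=> //.
      by apply: (free_dim cf); rewrite -zc.
    by rewrite simplex_pt_push.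
  have [k [w [kd kw zw]]] := st_crit st (rt_in _ Bz) rd.
  have [_ Bw] := st_sub st zw.
  by exists k, w; split=> //; split=> //; [left|rewrite (rtB w)].
- move=> z w k l [Bz Bw zw] kz lw.
  (* The free part has no critical points, so critical points of [B'] are fixed by [rt]. *)
  have crB u m : B' u -> critical_pt f m u -> B u.
    by move=> /BP[//|[c cf ->]] /(xcrit cf).
  have Bz' := crB _ _ Bz kz; have Bw' := crB _ _ Bw lw.
  by move: zw; rewrite !rtB // => zw; exact: (st_uniq st zw kz lw).
Qed.

End CollapseStage.
End Collapse.

(** * Induction over subcomplexes *)

Section FullStage.
Variables (R : realType) (X : symDelta) (f : forall p, X p.+1 -> R).
Hypothesis Xfin : finite_complex X.
Hypothesis fmorse : discrete_morse f.
Local Notation Z := (realization R X).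
Local Notation Delta p := (stdsimplex R p.+1).

Definition body (K : forall p, set (X p.+1)) : set Z :=
  [set z | exists p (y : X p.+1) c, [/\ K p y, Delta p c & z = simplex_pt y c]].

Lemma simplex_pt_open_eq p q (x : X p.+1) (y : X q.+1) a c :
  opensimplex R p.+1 a -> opensimplex R q.+1 c -> simplex_pt x a = simplex_pt y c ->
  q = p /\ face x y.
Proof.
move=> ao co ac.
have [t [_ tx]] := simplex_pt_eq ao (opensimplex_std co) ac.
have [s _] := simplex_pt_eq co (opensimplex_std ao) (esym ac).
split; last by exists t.
by have := injn_le t; have := injn_le s; lia.
Qed.

Lemma critical_face p q (x : X p.+1) (y : X q.+1) :
  q = p -> face x y -> critical f y -> critical f x.
Proof.
by move=> qp; case: p / qp x => x /orb_face yx; exact: critical_orb.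
Qed.

Lemma simplex_pt_face p q (x : X p.+1) (y : X q.+1) :
  face y x -> forall c, Delta q c -> exists2 c', Delta p c' &
    simplex_pt y c = simplex_pt x c'.
Proof.
move=> [t <-] c cS; exists (push_fun t c); first exact: push_std.
by rewrite simplex_pt_push.
Qed.

Lemma face_sym_dim p q (x : X p.+1) (y : X q.+1) : q = p -> face x y -> face y x.
Proof.
by move=> qp; case: p / qp x => x /orb_face h; apply/orb_face/orb_sym.
Qed.

Lemma body_remove_critical (K : forall p, set (X p.+1)) p (x : X p.+1) :
  K p x -> (forall q (y : X q.+1), K q y -> face x y -> q = p) ->
  body K = body (remove_star K x) `|` simplex_pt x @` Delta p.
Proof.
move=> Kx xmax; apply/seteqP; split=> [z [q [y [c [Ky cS ->]]]]|z].
  have [xy|nxy] := pselect (face x y); last by left; exists q, y, c.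
  right; have yx := face_sym_dim (xmax _ _ Ky xy) xy.
  by have [c' c'S ->] := simplex_pt_face yx cS; exists c'.
move=> [[q [y [c [[Ky _] cS ->]]]]|[c cS <-]]; first by exists q, y, c.
by exists p, x, c.
Qed.

Lemma body_remove_pair (K : forall p, set (X p.+1)) p (a : X p.+1) (b : X p.+2) :
  K p.+1 b -> face a b ->
  (forall q (y : X q.+1), K q y -> face a y -> q = p \/ q = p.+1 /\ face y b) ->
  body K = body (remove_star K a) `|` simplex_pt b @` Delta p.+1.
Proof.
move=> Kb ab amax; apply/seteqP; split=> [z [q [y [c [Ky cS ->]]]]|z].
  have [ay|nay] := pselect (face a y); last by left; exists q, y, c.
  right; have yb : face y b.
    have [qp|[]//] := amax _ _ Ky ay.
    exact: face_trans (face_sym_dim qp ay) ab.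
  by have [c' c'S ->] := simplex_pt_face yb cS; exists c'.
move=> [[q [y [c [[Ky _] cS ->]]]]|[c cS <-]]; first by exists q, y, c.
by exists p.+1, b, c.
Qed.

(** A simplex through an interior point of [x] has [x], hence [a], among its faces, and so was
    removed with the star. *)
Lemma open_not_removed (K : forall p, set (X p.+1)) p (x : X p.+1) q (a : X q.+1) c :
  face a x -> opensimplex R p.+1 c ->
  ~ body (remove_star K a) (simplex_pt x c).
Proof.
move=> ax co [r [y [d [[_ ay] dS /(simplex_pt_eq co dS)[t [_ tx]]]]]].
by apply: ay; apply: face_trans ax _; exists t.
Qed.

Lemma stage_empty (K : forall p, set (X p.+1)) : (forall p x, ~ K p x) ->
  stage f (body K) (fun _ _ => False) fst.
Proof.
move=> K0; have -> : body K = set0.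
  by apply/seteqP; split=> // z [p [x [c [Kx]]]]; case: (K0 p x).
split=> //; first exact: closed0.
- by rewrite (_ : [set u | _] = set0); [exact: closed0|apply/seteqP; split].
- move=> C cC; rewrite (_ : _ `&` _ = set0); first exact: closed0.
  by apply/seteqP; split=> // u [[]].
Qed.

Lemma remove_stage (K : forall p, set (X p.+1)) p (a : X p.+1) E h :
  subcomplex f K -> removable f K a -> stage f (body (remove_star K a)) E h ->
  exists E' h', stage f (body K) E' h'.
Proof.
move=> Ksub rem; case: rem => {p a} [p x cx Kx xmax|p a b ab Kb _ amax] st.
  rewrite (body_remove_critical Kx xmax).
  have [||h' st'] := @attach_stage R X f Xfin _ _ _ p x st cx.
  - case: p x cx Kx xmax st => [|p] x cx Kx xmax st c i cS ci.
      case: cS => _; rewrite big_ord_recl big_ord0 (ord1 i) in ci *.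
      by rewrite ci addr0 => /esym/eqP; rewrite oner_eq0.
    have [c' c'S ->] := push_facet cS ci; rewrite simplex_pt_push //.
    exists p, (pull (injn_of (@lift_inj _ i)) x), c'; split=> //; split.
      exact: (sub_face Ksub).
    by move=> /face_le; rewrite ltnn.
  - by move=> c co; apply: open_not_removed => //; exists (injn_id _); exact: pull_id.
  by do 2 eexists; exact: st'.
have /permissibleP[r [rab ru rl]] := ab.1.
have [v [rv vr]] := injn_miss r.
have fab := permissible_face ab.1.
rewrite (body_remove_pair Kb fab amax).
apply: (@collapse_stage R X f Xfin _ _ _ p a b r v st rv vr rab ru rl).
- move=> c i cS iv ci.
  have [c' c'S ->] := push_facet cS ci; rewrite simplex_pt_push //.
  exists p, (pull (injn_of (@lift_inj _ i)) b), c'; split=> //; split.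
    exact: (sub_face Ksub).
  (* If [a] were a face of the facet opposite to [i], it would be glued to [b] with an image missing
     [i], whereas [range r] contains [i]: condition (1) again. *)
  move=> [u ua]; have := vr i (elimN eqP iv) => -[j rj].
  have gu : glues (injn_comp (injn_of (@lift_inj _ i)) u) a b by rewrite /glues pull_comp.
  have : range r i by exists j.
  rewrite (ru _ _ rab gu) => -[l _]; rewrite injn_compE injn_ofE => /eqP.
  by rewrite eq_sym (negbTE (neq_lift _ _)).
- move=> c cf; have [cv|cv] := eqVneq (c 0 v) 0; last first.
    by apply: open_not_removed fab _; exact: (free_open cf cv).
  have [c0 c0o ->] := free_facet rv vr cf cv.
  rewrite simplex_pt_push ?rab; last exact: opensimplex_std.
  by apply: open_not_removed => //; exists (injn_id _); exact: pull_id.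
- move=> c k cf [x [cx [d dO cd]]]; have [cv|cv] := eqVneq (c 0 v) 0; last first.
    have [kp bx] := simplex_pt_open_eq (free_open cf cv) dO cd.
    exact: (critical_down (critical_face kp bx cx) ab).
  have [c0 c0o cr] := free_facet rv vr cf cv.
  move: cd; rewrite cr simplex_pt_push ?rab; last exact: opensimplex_std.
  move=> /(simplex_pt_open_eq c0o dO)[kp ax].
  exact: (critical_up (critical_face kp ax cx) ab).
Qed.

Lemma subcomplex_stage (K : forall p, set (X p.+1)) : subcomplex f K ->
  exists E h, stage f (body K) E h.
Proof.
pose simps (L : forall p, set (X p.+1)) : set (simplices X) :=
  [set s | L _ (tagged s)].
have sfin L : finite_set (simps L) by apply: sub_finite_set Xfin.
elim: {K}_.+1 {-2}K (ltnSn #|` fset_set (simps K)|) => // n IH K.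
rewrite ltnS => Kn Ksub.
have [Kne|K0] := pselect (exists p (x : X p.+1), K p x); last first.
  exists (fun _ _ => False), fst; apply: stage_empty => p x Kx.
  by apply: K0; exists p, x.
have [p [a [Ka rem]]] := exists_removable fmorse Ksub Xfin Kne.
have [|E [h st]] := IH (remove_star K a) _ (remove_star_sub fmorse Ksub rem).
  apply: leq_trans Kn; apply: fproper_ltn_card; rewrite fproperE; apply/andP; split.
    by apply/fsubsetP => s; rewrite !in_fset_set // !inE => -[].
  apply/negP => /fsubsetP/(_ (existT _ p a)); rewrite !in_fset_set // !inE => /(_ Ka).
  by move=> [_]; apply; exists (injn_id _); exact: pull_id.
exact: remove_stage st.
Qed.

Lemma full_stage : exists E h, stage f [set: Z] E h.
Proof.
have -> : [set: Z] = body (fun p => [set: X p.+1]).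
  apply/seteqP; split=> // z _; have [p [x [a [[aS _] ->]]]] := simplex_pt_surj z.
  by exists p, x, a.
by apply: subcomplex_stage; split.
Qed.

End FullStage.

(** * The ball, the simplex and the orthogonal representation *)

Section StandardRep.
Variables (R : realType) (p : nat).
Local Notation n := (p.+1%:R : R).
Local Notation Delta := (stdsimplex R p.+1).
Local Notation bary := (barycenter R p).

(** Origin of [y] and [x]: [rep_mx] consists of all rows but the first of the Householder reflection
    exchanging the first basis vector with the vector all of whose entries are [- y]. *)
Let y : R := (Num.sqrt n)^-1.
Let x : R := y ^+ 2 / (1 + y).

(** Together with the constant row [y], the rows of [rep_mx] form an orthonormal
    basis. *)
Definition rep_mx : 'M[R]_(p, p.+1) :=
  \matrix_(i, j) if unlift ord0 j is Some k then (i == k)%:R - x else - y.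

Local Notation U := rep_mx.

Let y_gt0 : 0 < y. Proof. by rewrite invr_gt0 sqrtr_gt0 ltr0n. Qed.

Let y2 : y ^+ 2 = n^-1.
Proof. by rewrite exprVn sqr_sqrtr // ler0n. Qed.

Let px : p%:R * x = 1 - y.
Proof.
have y1 : 1 + y != 0 by rewrite gt_eqF // addr_gt0.
have ny : n * y ^+ 2 = 1 by rewrite y2 divff // pnatr_eq0.
rewrite /x mulrA; apply: (mulIf y1); rewrite divfK //.
move: ny; rewrite -natr1 mulrDl mul1r => e.
by rewrite -[p%:R * _](addrK (y ^+ 2)) e; ring.
Qed.

Let xx : x *+ 2 - p%:R * x ^+ 2 = n^-1.
Proof.
have y1 : 1 + y != 0 by rewrite gt_eqF // addr_gt0.
rewrite expr2 mulrA px -y2 (_ : y ^+ 2 = x * (1 + y)); last by rewrite divfK.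
by ring.
Qed.

Let U0 i : U i ord0 = - y.
Proof. by rewrite mxE unlift_none. Qed.

Let Ul i k : U i (lift ord0 k) = (i == k)%:R - x.
Proof. by rewrite mxE liftK. Qed.

Let sum_delta (I : finType) (i : I) (F : I -> R) : \sum_k (i == k)%:R * F k = F i.
Proof.
rewrite (bigD1 i) //= eqxx mul1r big1 ?addr0 // => k ki.
by rewrite eq_sym (negbTE ki) mul0r.
Qed.

Lemma rep_mx_sum i : \sum_j U i j = 0.
Proof.
rewrite big_ord_recl U0; under eq_bigr do rewrite Ul.
rewrite sumrB sumr_const card_ord -[x *+ p]mulr_natl px.
have -> : \sum_(k < p) (i == k)%:R = 1 :> R.
  by under eq_bigr do rewrite -[_%:R]mulr1; rewrite (sum_delta i (fun=> 1)).
by ring.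
Qed.

Let sum_dd i k : \sum_(l < p) ((i == l)%:R - x) * ((k == l)%:R - x) =
  (i == k)%:R - n^-1.
Proof.
rewrite (eq_bigr (fun l => (i == l)%:R * ((k == l)%:R - x) +
    ((k == l)%:R * (- x) + x ^+ 2))); last by move=> l _; ring.
rewrite !big_split /= (sum_delta i) (sum_delta k (fun=> - x)) sumr_const card_ord.
by rewrite -[x ^+ 2 *+ p]mulr_natl -xx eq_sym; ring.
Qed.

Lemma rep_mx_orth : U *m U^T = 1%:M.
Proof.
apply/matrixP => i k; rewrite [LHS]mxE [RHS]mxE big_ord_recl [U^T _ _]mxE !U0.
under eq_bigr do rewrite [U^T _ _]mxE !Ul.
by rewrite sum_dd mulrNN -expr2 y2 addrC subrK.
Qed.

Definition avg_mx : 'M[R]_p.+1 := const_mx n^-1.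

(** [U] completed by the constant row [y] is square with orthonormal rows, so its columns are
    orthonormal too; the constant row contributes [avg_mx]. *)
Lemma rep_mx_proj : U^T *m U = 1%:M - avg_mx.
Proof.
pose W := col_mx (const_mx y : 'rV_p.+1) U.
have WW : W *m W^T = 1%:M :> 'M[R]_(1 + p).
  rewrite tr_col_mx mul_col_row rep_mx_orth -[RHS]submxK /=; congr block_mx.
  - rewrite scalar_mx_block block_mxKul; apply/matrixP => i j.
    rewrite !mxE (eq_bigr (fun=> y ^+ 2)) => [|k _]; last by rewrite !mxE.
    by rewrite sumr_const card_ord y2 -[_ *+ p.+1]mulr_natl divff ?pnatr_eq0 // !ord1.
  - rewrite scalar_mx_block block_mxKur; apply/matrixP => i j; rewrite !mxE.
    rewrite (eq_bigr (fun k => y * U j k)) => [|k _]; last by rewrite !mxE.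
    by rewrite -mulr_sumr rep_mx_sum mulr0.
  - rewrite scalar_mx_block block_mxKdl; apply/matrixP => i j; rewrite !mxE.
    rewrite (eq_bigr (fun k => U i k * y)) => [|k _]; last by rewrite !mxE.
    by rewrite -mulr_suml rep_mx_sum mul0r.
  - by rewrite scalar_mx_block block_mxKdr.
have := mulmx1C WW; rewrite tr_col_mx mul_row_col => /(canRL (addKr _)) ->.
rewrite addrC; congr (_ - _); apply/matrixP => i j; rewrite !mxE big_ord1 !mxE.
by rewrite -expr2 y2.
Qed.

Lemma avg_perm (s : 'S_p.+1) : perm_mx s *m avg_mx = avg_mx.
Proof.
apply/matrixP => i j; rewrite !mxE.
rewrite (eq_bigr (fun k => (s i == k)%:R * n^-1)) => [|k _]; last by rewrite !mxE.
by rewrite sum_delta.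
Qed.

Lemma rep_mx_avg : U *m avg_mx = 0.
Proof.
apply/matrixP => i j; rewrite !mxE.
rewrite (eq_bigr (fun k => U i k * n^-1)) => [|k _]; last by rewrite [avg_mx _ _]mxE.
by rewrite -mulr_suml rep_mx_sum mul0r.
Qed.

(** The standard representation of the symmetric group: permutation of coordinates on the hyperplane
    of sum 0, in the orthonormal basis given by the rows of [U]. *)
Definition std_rep (s : 'S_p.+1) : 'M[R]_p := U *m perm_mx s *m U^T.

Lemma std_rep1 : std_rep 1 = 1%:M.
Proof. by rewrite /std_rep perm_mx1 mulmx1 rep_mx_orth. Qed.

Lemma std_repU s : std_rep s *m U = U *m perm_mx s.
Proof.
rewrite /std_rep -mulmxA rep_mx_proj mulmxBr mulmx1 -!mulmxA avg_perm.
by rewrite rep_mx_avg subr0.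
Qed.

Lemma std_repM s t : std_rep (s * t) = std_rep s *m std_rep t.
Proof. by rewrite [std_rep t]/std_rep !mulmxA std_repU /std_rep perm_mxM !mulmxA. Qed.

Lemma std_rep_tr s : (std_rep s)^T = std_rep s^-1.
Proof. by rewrite /std_rep !trmx_mul trmxK tr_perm_mx mulmxA. Qed.

Lemma std_rep_orth s : std_rep s *m (std_rep s)^T = 1%:M.
Proof. by rewrite std_rep_tr -std_repM mulgV std_rep1. Qed.

Lemma std_rep_inv s : invmx (std_rep s) = std_rep s^-1.
Proof.
have [u _] := mulmx1_unit (std_rep_orth s).
by rewrite -[LHS]mulmx1 -(std_rep_orth s) std_rep_tr mulKmx.
Qed.

(** [std_rep s] determines the permutation matrix on the hyperplane of sum 0, and all permutation
    matrices agree on constant vectors. *)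
Lemma std_rep_inj : injective std_rep.
Proof.
move=> s t st; have : U^T *m (U *m perm_mx s) = U^T *m (U *m perm_mx t).
  by rewrite -!std_repU st.
rewrite !mulmxA rep_mx_proj !mulmxBl !mul1mx.
have avgp (w : 'S_p.+1) : avg_mx *m perm_mx w = avg_mx.
  by apply: trmx_inj; rewrite trmx_mul tr_perm_mx trmx_const avg_perm.
rewrite !avgp => /(canRL (subrK _)); rewrite subrK => /matrixP e.
apply/permP => i; have /eqP := e i (s i); rewrite !mxE eqxx.
by case: (t i =P s i) => [->//|_]; rewrite oner_eq0.
Qed.

Lemma push_perm (s : 'S_p.+1) (a : 'rV[R]_p.+1) :
  push_fun (injn_perm s) a = a *m perm_mx s.
Proof.
apply/rowP => j; rewrite !mxE big_mkcond; apply: eq_bigr => i _.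
by rewrite !mxE injn_permE; case: eqP; rewrite ?mulr1 ?mulr0.
Qed.

(** * The equivariant radial map from the ball to the simplex *)

Definition eucl_norm (w : 'cV[R]_p) : R := Num.sqrt (sqnorm w).

(** On vectors of sum 0, the gauge of the simplex centered at its barycenter. *)
Definition gauge (v : 'rV[R]_p.+1) : R := - (n * \big[Num.min/0]_i v 0 i).

(** Radial rescaling; at [w = 0] the ratio is [0 / 0 = 0]. *)
Definition ball_to_simplex (w : 'cV[R]_p) : 'rV[R]_p.+1 :=
  bary + (eucl_norm w / gauge (w^T *m U)) *: (w^T *m U).

Lemma sqnorm_ge0 (w : 'cV[R]_p) : 0 <= sqnorm w.
Proof. by apply: sumr_ge0 => i _; exact: sqr_ge0. Qed.

Lemma sqnorm_eq0 (w : 'cV[R]_p) : sqnorm w = 0 -> w = 0.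
Proof.
move=> w0; apply/colP => i; rewrite mxE; apply/eqP.
move/eqP: w0; rewrite psumr_eq0 => [/allP/(_ i)|j _]; last exact: sqr_ge0.
by rewrite mem_index_enum sqrf_eq0; exact.
Qed.

Lemma sqnormE (w : 'cV[R]_p) : sqnorm w = (w^T *m w) 0 0.
Proof. by rewrite mxE; apply: eq_bigr => i _; rewrite mxE expr2. Qed.

Lemma eucl_norm_eq0 (w : 'cV[R]_p) : eucl_norm w = 0 -> w = 0.
Proof.
move=> /eqP; rewrite sqrtr_eq0 => w0; apply: sqnorm_eq0.
by apply/eqP; rewrite eq_le w0 sqnorm_ge0.
Qed.

Lemma eucl_norm0 : eucl_norm 0 = 0.
Proof.
by rewrite /eucl_norm /sqnorm big1 ?sqrtr0 // => i _; rewrite mxE expr0n.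
Qed.

Lemma eucl_normZ c (w : 'cV[R]_p) : 0 <= c -> eucl_norm (c *: w) = c * eucl_norm w.
Proof.
move=> c0; rewrite /eucl_norm (_ : sqnorm (c *: w) = c ^+ 2 * sqnorm w).
  by rewrite sqrtrM ?sqr_ge0 // sqrtr_sqr ger0_norm.
by rewrite /sqnorm mulr_sumr; apply: eq_bigr => i _; rewrite mxE exprMn.
Qed.

Lemma sqnorm_orth (A : 'M[R]_p) (w : 'cV[R]_p) :
  A *m A^T = 1%:M -> sqnorm (A *m w) = sqnorm w.
Proof.
move=> /mulmx1C AA; rewrite !sqnormE trmx_mul mulmxA -(mulmxA w^T) AA.
by rewrite mulmx1.
Qed.

Lemma rep_sum0 (w : 'cV[R]_p) : \sum_j (w^T *m U) 0 j = 0.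
Proof.
under eq_bigr do rewrite mxE; rewrite exchange_big big1 // => i _.
by rewrite -mulr_sumr rep_mx_sum mulr0.
Qed.

Lemma repK (w : 'cV[R]_p) : (w^T *m U) *m U^T = w^T.
Proof. by rewrite -mulmxA rep_mx_orth mulmx1. Qed.

Lemma rep_onto (v : 'rV[R]_p.+1) : \sum_j v 0 j = 0 -> (U *m v^T)^T *m U = v.
Proof.
move=> v0; rewrite trmx_mul trmxK -mulmxA rep_mx_proj mulmxBr mulmx1.
rewrite (_ : v *m avg_mx = 0) ?subr0 //; apply/rowP => j; rewrite !mxE.
by under eq_bigr do rewrite [avg_mx _ _]mxE; rewrite -mulr_suml v0 mul0r.
Qed.

Lemma gauge_ge (v : 'rV[R]_p.+1) j : - (n * v 0 j) <= gauge v.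
Proof. by rewrite lerN2 ler_pM2l ?ltr0n // bigmin_le. Qed.

Lemma gauge_ge0 (v : 'rV[R]_p.+1) : 0 <= gauge v.
Proof. by rewrite oppr_ge0 pmulr_rle0 ?ltr0n // bigmin_le_id. Qed.

(** The initial value 0 of the minimum is harmless, as a vector of sum 0 has a nonpositive
    coordinate. *)
Lemma gauge_attained (v : 'rV[R]_p.+1) : \sum_j v 0 j = 0 ->
  exists j, gauge v = - (n * v 0 j).
Proof.
move=> v0; have [k vk] : exists k : 'I_p.+1, v 0 k <= 0.
  apply: contrapT => /forallNP vneg.
  have vpos k : 0 < v 0 k by rewrite ltNge; apply/negP; exact: vneg.
  have : 0 < \sum_j v 0 j.
    rewrite (bigD1 ord0) //= ltr_wpDr ?vpos //.
    by apply: sumr_ge0 => j _; exact: ltW.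
  by rewrite v0 ltxx.
have [j vj] : exists j, forall l, v 0 j <= v 0 l.
  case: (@arg_minP _ _ _ k xpredT (fun j => v 0 j) isT) => j _ h.
  by exists j => l; exact: h.
exists j; congr (- (n * _)); apply/eqP; rewrite eq_le bigmin_le /=.
by apply/bigmin_geP; split=> [|l _]; [exact: le_trans (vj k) vk|exact: vj].
Qed.

(** With [- M] the least coordinate, each coordinate is minus the sum of the [p] others and so at
    most [p * M]. This yields both definiteness of the gauge and continuity of [ball_to_simplex] at
    0. *)
Lemma gauge_bound (v : 'rV[R]_p.+1) j : \sum_j v 0 j = 0 -> `|v 0 j| <= gauge v.
Proof.
move=> v0; have [k gk] := gauge_attained v0.
pose M := - v 0 k; have vM l : - v 0 l <= M.
  by have := gauge_ge v l; rewrite gk lerN2 ler_pM2l ?ltr0n // /M lerN2.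
have M0 : 0 <= M.
  have := gauge_ge0 v; rewrite gk oppr_ge0 pmulr_rle0 ?ltr0n //.
  by rewrite /M oppr_ge0.
have gM : gauge v = n * M by rewrite gk /M mulrN.
rewrite ler_norml gM; apply/andP; split.
  rewrite lerNl; apply: le_trans (vM j) _.
  by rewrite ler_peMl // ler1n.
have -> : v 0 j = \sum_(l | l != j) - v 0 l.
  by move/eqP: v0; rewrite (bigD1 j) //= addr_eq0 sumrN => /eqP.
apply: (@le_trans _ _ (\sum_(l | l != j) M)); first exact: ler_sum.
rewrite sumr_const -[M *+ _]mulr_natl ler_wpM2r // ler_nat.
by rewrite cardC1 card_ord.
Qed.

Lemma gauge_eq0 (v : 'rV[R]_p.+1) : \sum_j v 0 j = 0 -> gauge v = 0 -> v = 0.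
Proof.
move=> v0 g0; apply/rowP => j; rewrite mxE; apply/eqP.
by rewrite -normr_le0 -g0; exact: gauge_bound.
Qed.

Lemma gaugeZ c (v : 'rV[R]_p.+1) : \sum_j v 0 j = 0 -> 0 <= c ->
  gauge (c *: v) = c * gauge v.
Proof.
move=> v0 c0; have cv0 : \sum_j (c *: v) 0 j = 0.
  by under eq_bigr do rewrite mxE; rewrite -mulr_sumr v0 mulr0.
have [j gj] := gauge_attained v0; have [k gk] := gauge_attained cv0.
apply/eqP; rewrite eq_le; apply/andP; split.
  rewrite gk mxE mulrCA -mulrN ler_wpM2l //; exact: gauge_ge.
have -> : c * gauge v = - (n * (c *: v) 0 j) by rewrite gj mxE mulrN mulrCA.
exact: gauge_ge.
Qed.

Lemma ball_to_simplexE (w : 'cV[R]_p) j : ball_to_simplex w 0 j =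
  n^-1 + eucl_norm w / gauge (w^T *m U) * (w^T *m U) 0 j.
Proof. by rewrite [LHS]mxE [bary _ _]mxE [X in _ + X]mxE. Qed.

Let gauge_rep_gt0 (w : 'cV[R]_p) : w != 0 -> 0 < gauge (w^T *m U).
Proof.
move=> w0; rewrite lt_neqAle gauge_ge0 andbT eq_sym; apply: contra_neq w0.
move=> /(gauge_eq0 (rep_sum0 w)) e; apply: trmx_inj.
by rewrite -repK e mul0mx trmx0.
Qed.

Lemma eucl_norm_ge0 (w : 'cV[R]_p) : 0 <= eucl_norm w.
Proof. exact: sqrtr_ge0. Qed.

Let ratio_ge0 (w : 'cV[R]_p) : 0 <= eucl_norm w / gauge (w^T *m U).
Proof. by rewrite divr_ge0 ?eucl_norm_ge0 ?gauge_ge0. Qed.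

(** Together with [ball_to_simplex_attained], this computes the least coordinate of the image, from
    which the norm of [w] is recovered: spheres go to level sets of the least coordinate, the unit
    sphere to the boundary. *)
Lemma ball_to_simplex_ge (w : 'cV[R]_p) j :
  (1 - eucl_norm w) / n <= ball_to_simplex w 0 j.
Proof.
rewrite ball_to_simplexE mulrBl mul1r lerD2l.
have [->|w0] := eqVneq w 0.
  by rewrite trmx0 mul0mx mxE mulr0 oppr_le0 divr_ge0 ?eucl_norm_ge0.
have g0 := gauge_rep_gt0 w0.
rewrite -mulrA -mulrN ler_wpM2l ?eucl_norm_ge0 //.
rewrite ler_pdivlMl // mulrN lerNl ler_pdivlMr ?ltr0n // mulNr mulrC.
exact: gauge_ge.
Qed.

Lemma ball_to_simplex_attained (w : 'cV[R]_p) :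
  exists j, ball_to_simplex w 0 j = (1 - eucl_norm w) / n.
Proof.
have [->|w0] := eqVneq w 0.
  exists ord0; rewrite ball_to_simplexE trmx0 mul0mx mxE mulr0 addr0.
  by rewrite eucl_norm0 subr0 mul1r.
have g0 := gauge_rep_gt0 w0.
have [j gj] := gauge_attained (rep_sum0 w); exists j.
rewrite ball_to_simplexE mulrBl mul1r; congr (_ + _).
have -> : (w^T *m U) 0 j = - (gauge (w^T *m U) / n).
  by rewrite gj mulNr opprK mulrAC divff ?mul1r // pnatr_eq0.
by rewrite mulrN mulrA divfK // gt_eqF.
Qed.

Lemma ball_to_simplex_sum (w : 'cV[R]_p) : \sum_j ball_to_simplex w 0 j = 1.
Proof.
under eq_bigr do rewrite ball_to_simplexE.
rewrite big_split /= -mulr_sumr rep_sum0 mulr0 addr0 sumr_const card_ord.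
by rewrite -[_ *+ _]mulr_natl divff // pnatr_eq0.
Qed.

Lemma ball_to_simplex_std (w : 'cV[R]_p) :
  eucl_norm w <= 1 -> Delta (ball_to_simplex w).
Proof.
move=> w1; split=> [j|]; last exact: ball_to_simplex_sum.
by apply: le_trans (ball_to_simplex_ge w j); rewrite divr_ge0 // subr_ge0.
Qed.

Lemma ball_to_simplex_open (w : 'cV[R]_p) :
  eucl_norm w < 1 -> opensimplex R p.+1 (ball_to_simplex w).
Proof.
move=> w1; split=> [|j]; first exact: ball_to_simplex_std (ltW w1).
by apply: lt_le_trans (ball_to_simplex_ge w j); rewrite divr_gt0 ?ltr0n // subr_gt0.
Qed.

Lemma ball_to_simplex_boundary (w : 'cV[R]_p) :
  eucl_norm w = 1 -> exists j, ball_to_simplex w 0 j = 0.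
Proof.
by move=> w1; have [j] := ball_to_simplex_attained w; rewrite w1 subrr mul0r; exists j.
Qed.

Lemma ball_to_simplex_norm (w w' : 'cV[R]_p) :
  ball_to_simplex w = ball_to_simplex w' -> eucl_norm w' <= eucl_norm w.
Proof.
move=> ww; have [j wj] := ball_to_simplex_attained w'.
have := ball_to_simplex_ge w j; rewrite ww wj ler_pM2r ?invr_gt0 ?ltr0n //.
by rewrite lerD2l lerN2.
Qed.

Lemma ball_to_simplex_inj : injective ball_to_simplex.
Proof.
move=> w w' ww; have nn : eucl_norm w = eucl_norm w'.
  by apply/eqP; rewrite eq_le !ball_to_simplex_norm.
have [w0|w0] := eqVneq w 0.
  by rewrite w0; apply/esym/eucl_norm_eq0; rewrite -nn w0 eucl_norm0.
have nw0 : 0 < eucl_norm w.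
  rewrite lt_neqAle eucl_norm_ge0 andbT eq_sym.
  by apply: contra_neq w0; exact: eucl_norm_eq0.
have w'0 : w' != 0.
  by apply: contra_neq w0 => w'0; apply: eucl_norm_eq0; rewrite nn w'0 eucl_norm0.
have l0 : 0 < eucl_norm w / gauge (w^T *m U) by rewrite divr_gt0 ?gauge_rep_gt0.
have l'0 : 0 < eucl_norm w' / gauge (w'^T *m U) by rewrite divr_gt0 -?nn ?gauge_rep_gt0.
move: ww => /addrI /(congr1 (fun v => v *m U^T)); rewrite -!scalemxAl !repK.
rewrite -!linearZ => /trmx_inj ww.
have := congr1 eucl_norm ww; rewrite !eucl_normZ ?ltW // -nn.
move=> /(mulIf (lt0r_neq0 nw0)) ll; move: ww; rewrite -nn -ll.
by move/(can_inj (scalerK (lt0r_neq0 l0))).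
Qed.

Lemma ball_to_simplex_onto (a : 'rV[R]_p.+1) : Delta a ->
  exists2 w, eucl_norm w <= 1 & ball_to_simplex w = a.
Proof.
move=> aS; pose v := a - bary; pose w0 := U *m v^T; pose N := eucl_norm w0.
have v0 : \sum_j v 0 j = 0.
  under eq_bigr do rewrite !mxE.
  rewrite sumrB aS.2 sumr_const card_ord -[_ *+ _]mulr_natl divff ?pnatr_eq0 //.
  by rewrite subrr.
have w0v : w0^T *m U = v := rep_onto v0.
have g1 : gauge v <= 1.
  have [j ->] := gauge_attained v0; rewrite !mxE mulrBr divff ?pnatr_eq0 //.
  by rewrite opprB lerBlDr lerDl mulr_ge0 // aS.1.
have [vz|vnz] := eqVneq v 0.
  exists 0; first by rewrite eucl_norm0 ler01.
  apply/esym/eqP; rewrite /ball_to_simplex trmx0 mul0mx scaler0 addr0 -subr_eq0.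
  by rewrite -/v vz.
have g0 : gauge v != 0 by apply: contra_neq vnz; exact: gauge_eq0.
have N0 : N != 0.
  apply: contra_neq vnz => /eucl_norm_eq0 w00.
  by rewrite -w0v w00 trmx0 mul0mx.
have c0 : 0 <= gauge v / N by rewrite divr_ge0 ?gauge_ge0 ?eucl_norm_ge0.
exists (gauge v / N *: w0).
  by rewrite eucl_normZ // -/N divfK.
rewrite /ball_to_simplex eucl_normZ // -/N divfK // linearZ /= -scalemxAl w0v.
rewrite gaugeZ // scalerA (_ : _ * _ = 1) ?scale1r; last by field; rewrite g0 N0.
by rewrite /v addrC subrK.
Qed.

Lemma gauge_perm (v : 'rV[R]_p.+1) (s : 'S_p.+1) : gauge (v *m perm_mx s) = gauge v.
Proof.
rewrite /gauge; congr (- (n * _)).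
rewrite (reindex_inj (@perm_inj _ s)); apply: eq_bigr => i _.
by rewrite -push_perm -(injn_permE s) push_fun_im.
Qed.

(** The transpose comes from [w] being a column while permutation matrices act on rows from the
    right; as the matrix is orthogonal, it is the action of [s^-1]. *)
Lemma ball_to_simplex_equiv (s : 'S_p.+1) (w : 'cV[R]_p) :
  ball_to_simplex ((std_rep s)^T *m w) = push_fun (injn_perm s) (ball_to_simplex w).
Proof.
rewrite push_perm /ball_to_simplex /eucl_norm sqnorm_orth; last first.
  by rewrite trmxK; apply: mulmx1C; exact: std_rep_orth.
rewrite trmx_mul trmxK -mulmxA std_repU mulmxA gauge_perm mulmxDl -scalemxAl.
congr (_ + _); apply/rowP => j; rewrite -push_perm.
rewrite (_ : j = injn_perm s (s^-1%g j)); last by rewrite injn_permE permKV.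
by rewrite push_fun_im !mxE.
Qed.

Lemma sqnorm_continuous : continuous (@sqnorm R p).
Proof.
apply: continuous_sum => i w.
apply: (@continuous_comp _ _ _ (fun w : 'cV[R]_p => w i 0) (fun x => x ^+ 2)).
  exact: coord_continuous.
exact: exprn_continuous.
Qed.

Lemma eucl_norm_continuous : continuous eucl_norm.
Proof.
move=> w; apply: (@continuous_comp _ _ _ (@sqnorm R p) Num.sqrt).
  exact: sqnorm_continuous.
exact: sqrt_continuous.
Qed.

Let rep_continuous j : continuous (fun w : 'cV[R]_p => (w^T *m U) 0 j).
Proof.
rewrite (_ : (fun w => _) = fun w : 'cV[R]_p => \sum_i w i 0 * U i j).
  apply: continuous_sum => i w.
  apply: (@continuousM R 'cV[R]_p (fun w => w i 0) (fun=> U i j) w).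
    exact: coord_continuous.
  exact: cst_continuous.
by apply/funext => w; rewrite mxE; apply: eq_bigr => i _; rewrite mxE.
Qed.

Let gauge_continuous : continuous (fun w : 'cV[R]_p => gauge (w^T *m U)).
Proof.
have c : continuous (fun m : R => - (n * m)).
  by move=> m; apply: cvgN; exact: mulrl_continuous.
move=> w; apply: (@continuous_comp _ _ _
  (fun w : 'cV[R]_p => \big[Num.min/0]_j (w^T *m U) 0 j) (fun m => - (n * m))).
  exact: (@continuous_bigmin R _ _ _ _ (fun j (w : 'cV[R]_p) => (w^T *m U) 0 j)).
exact: c.
Qed.

Lemma ball_to_simplex_continuous : continuous ball_to_simplex.
Proof.
apply: continuous_mx => i j; rewrite ord1 => w.
under eq_fun do rewrite ball_to_simplexE.
apply: (@continuousD R R _ (fun=> n^-1)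
  (fun w : 'cV[R]_p => eucl_norm w / gauge (w^T *m U) * (w^T *m U) 0 j)).
  exact: cst_continuous.
have [->|w0] := eqVneq w 0; last first.
  apply: (@continuousM R 'cV[R]_p (fun w => eucl_norm w / gauge (w^T *m U))
    (fun w => (w^T *m U) 0 j)); last exact: rep_continuous.
  apply: (@continuousM R 'cV[R]_p eucl_norm (fun w => (gauge (w^T *m U))^-1)).
    exact: eucl_norm_continuous.
  apply: (@continuousV R 'cV[R]_p (fun w => gauge (w^T *m U))).
    by rewrite gt_eqF //; exact: gauge_rep_gt0.
  exact: gauge_continuous.
rewrite /prop_for /continuous_at.
rewrite trmx0 mul0mx [X in _ --> X](_ : _ = 0); last by rewrite mxE mulr0.
have cn := @eucl_norm_continuous 0; rewrite /continuous_at eucl_norm0 in cn.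
(* At the origin the ratio has no limit argument of its own; [gauge_bound] squeezes its product with
   the coordinate between two multiples of the norm. *)
have le u : - eucl_norm u <= eucl_norm u / gauge (u^T *m U) * (u^T *m U) 0 j <=
    eucl_norm u.
  rewrite -ler_norml normrM ger0_norm ?ratio_ge0 //.
  have [g0|g0] := eqVneq (gauge (u^T *m U)) 0.
    by rewrite g0 invr0 mulr0 mul0r eucl_norm_ge0.
  have gp : 0 < gauge (u^T *m U) by rewrite lt_neqAle eq_sym g0 gauge_ge0.
  rewrite mulrAC (ler_pdivrMr _ _ gp).
  by rewrite ler_wpM2l ?eucl_norm_ge0 //; exact: gauge_bound (rep_sum0 u).
apply: (@squeeze_cvgr _ (nbhs (0 : 'cV[R]_p)) _ R (fun w => - eucl_norm w)
  eucl_norm _ _ 0) => //.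
  exact: filterE.
have := cvgN cn; rewrite oppr0; exact.
Qed.

End StandardRep.

(** * The symmetric CW-complex *)

Lemma cont_on_setT (S T : topologicalType) (g : S -> T) :
  cont_on [set: S] g <-> continuous g.
Proof.
by rewrite (cont_onP _ closedT) continuous_subspace_setT.
Qed.

Section Ball.
Variables (R : realType) (p : nat).

Lemma closed_cball : closed (cball R p).
Proof.
have /continuous_closedP := @sqnorm_continuous R p.
by move=> /(_ [set x | x <= 1]); apply; exact: closed_le.
Qed.

Lemma compact_cball : compact (cball R p).
Proof.
have K : compact [set v : 'rV[R]_p | forall i, v ord0 i \in `[-1, 1]].
  by have := @rV_compact R p (fun=> `[-1, 1]%classic) (fun=> @segment_compact R (-1) 1).
have ctr : continuous (fun v : 'rV[R]_p => v^T).
  apply: continuous_mx => i j.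
  rewrite (_ : (fun v => _) = fun v : 'rV[R]_p => v j i); first exact: coord_continuous.
  by apply/funext => v; rewrite mxE.
have kT : compact ((fun v : 'rV[R]_p => v^T) @`
    [set v : 'rV[R]_p | forall i, v ord0 i \in `[-1, 1]]).
  by apply: continuous_compact K; exact: continuous_subspaceT.
apply: (subclosed_compact closed_cball kT) => w w1; exists w^T; last exact: trmxK.
move=> i; rewrite mxE in_itv /= -ler_norml.
rewrite -(ler_pXn2r (n := 2)) ?nnegrE // expr1n -normrX ger0_norm ?sqr_ge0 //.
apply: le_trans w1; rewrite /sqnorm (bigD1 i) //= lerDl.
by apply: sumr_ge0 => j _; exact: sqr_ge0.
Qed.

Lemma eucl_norm_le1 (w : 'cV[R]_p) : (eucl_norm w <= 1) = (sqnorm w <= 1).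
Proof. by rewrite -[X in _ <= X]sqrtr1 ler_sqrt. Qed.

Lemma eucl_norm_lt1 (w : 'cV[R]_p) : (eucl_norm w < 1) = (sqnorm w < 1).
Proof. by rewrite -[X in _ < X]sqrtr1 ltr_sqrt. Qed.

Lemma cball0 : (0 : 'cV[R]_p) \in cball R p.
Proof.
apply/mem_set; rewrite /cball /= /sqnorm big1 ?ler01 // => i _.
by rewrite mxE expr0n.
Qed.

Lemma compact_cball_type : compact [set: cball R p].
Proof.
exact: (@compact_set_type _ (cball R p)
  (exist (fun w => w \in cball R p) 0 cball0) closed_cball compact_cball).
Qed.

End Ball.

(** * Automorphism groups as finite orthogonal groups *)

Section SymAut.
Variables (R : realType) (X : symDelta) (p : nat) (a : X p.+1).

Lemma sym_autP (s : 'S_p.+1) : s \in sym_aut a <-> pull (injn_perm s) a = a.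
Proof. by rewrite inE; split=> /eqP. Qed.

Lemma sym_aut1 : 1%g \in sym_aut a.
Proof.
apply/sym_autP; rewrite (_ : injn_perm 1 = injn_id _) ?pull_id //.
by apply: injn_eq => i; rewrite injn_permE injn_idE perm1.
Qed.

Lemma sym_autM s t : s \in sym_aut a -> t \in sym_aut a -> (s * t)%g \in sym_aut a.
Proof.
move=> /sym_autP sa /sym_autP ta; apply/sym_autP.
rewrite (_ : injn_perm (s * t)%g = injn_comp (injn_perm t) (injn_perm s)).
  by rewrite pull_comp ta sa.
by apply: injn_eq => j; rewrite injn_compE !injn_permE permM.
Qed.

Lemma sym_autV s : s \in sym_aut a -> s^-1%g \in sym_aut a.
Proof.
move=> /sym_autP sa; apply/sym_autP; rewrite -[in LHS]sa -pull_comp.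
rewrite (_ : injn_comp _ _ = injn_id _) ?pull_id //.
by apply: injn_eq => j; rewrite injn_compE !injn_permE injn_idE permKV.
Qed.

Definition aut_rep_set : set 'M[R]_p := [set std_rep R s | s in [set` sym_aut a]].

Lemma aut_rep_finite : finite_set aut_rep_set.
Proof. by apply: finite_image; exact: finite_finset. Qed.

Lemma aut_rep_orth A : aut_rep_set A -> A *m A^T = 1%:M.
Proof. by move=> [s _ <-]; exact: std_rep_orth. Qed.

Lemma aut_rep_1 : aut_rep_set 1%:M.
Proof. by exists 1%g; [exact: sym_aut1|exact: std_rep1]. Qed.

Lemma aut_rep_M A B : aut_rep_set A -> aut_rep_set B -> aut_rep_set (A *m B).
Proof.
move=> [s sa <-] [t ta <-]; exists (s * t)%g; last exact: std_repM.
exact: sym_autM.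
Qed.

Lemma aut_rep_V A : aut_rep_set A -> aut_rep_set (invmx A).
Proof.
move=> [s sa <-]; exists s^-1%g; first exact: sym_autV.
by rewrite std_rep_inv.
Qed.

Definition aut_rep : finOrthGroup R p :=
  FinOrthGroup aut_rep_finite aut_rep_orth aut_rep_1 aut_rep_M aut_rep_V.

Lemma aut_rep_isog : orth_isog (sym_aut a) aut_rep.
Proof.
exists (@std_rep R p); split; last by move=> s t _ _; exact: std_repM.
split; [by move=> s sa; exists s| |by move=> A [s sa <-]; exists s].
by move=> s t _ _; exact: std_rep_inj.
Qed.

End SymAut.

Section Quotient.
Variables (R : realType) (X : symDelta) (f : forall p, X p.+1 -> R).
Hypothesis Xfin : finite_complex X.
Local Notation Z := (realization R X).
Local Notation I01 := (`[0, 1]%classic : set R).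
Local Notation Delta p := (stdsimplex R p.+1).
Variables (E : Z -> Z -> Prop) (h : Z * R -> Z).
Hypothesis st : stage f [set: Z] E h.
Local Open Scope quotient_scope.

Let eqE (z w : Z) : bool := `[< E z w >].

Lemma stage_equiv_refl : reflexive eqE.
Proof. by move=> z; apply/asboolP; exact: (st_refl st). Qed.

Lemma stage_equiv_sym : symmetric eqE.
Proof. by move=> z w; apply/asbool_equiv_eq; split; exact: (st_sym st). Qed.

Lemma stage_equiv_trans : transitive eqE.
Proof.
by move=> w z u /asboolP zw /asboolP wu; apply/asboolP; exact: st_trans st _ _ _ zw wu.
Qed.

Definition stage_equiv :=
  EquivRel eqE stage_equiv_refl stage_equiv_sym stage_equiv_trans.

Definition stage_quot : topologicalType := quotient_topology {eq_quot stage_equiv}.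
Local Notation Y := stage_quot.

Definition stage_pi (z : Z) : Y := \pi_Y z.

Lemma stage_piP z w : stage_pi z = stage_pi w <-> E z w.
Proof.
split=> [/eqmodP/asboolP//|zw]; apply/eqmodP; exact/asboolP.
Qed.

Lemma stage_pi_surj (y : Y) : stage_pi (generic_quotient.repr y) = y.
Proof. exact: reprK. Qed.

Lemma stage_pi_continuous : continuous stage_pi.
Proof. exact: pi_continuous. Qed.

Lemma stage_quot_hausdorff : hausdorff_space Y.
Proof.
apply: (@quotient_hausdorff R).
- exact: realization_compact.
- exact: realization_hausdorff.
- rewrite (_ : [set u | _] = [set u : Z * Z | E u.1 u.2]); first exact: st_Eclosed st.
  by apply/seteqP; split=> u /=; move/stage_piP.
Qed.

(** The inverse [g] is [h (_, 1)], which descends by [st_1]; the homotopy on the quotient is [h]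
    itself, which descends by [st_pres]. *)
Lemma realization_homotopy_equivalent : homotopy_equivalent R Z Y.
Proof.
pose g (y : Y) : Z := h (generic_quotient.repr y, 1).
have gpi z : g (stage_pi z) = h (z, 1).
  by apply: (st_1 st); apply/stage_piP; rewrite stage_pi_surj.
have c1 : closed ([set: Z] `*` I01).
  by apply: closed_setX; [exact: closedT|exact: closed_I01].
(* Time is reversed because the required homotopies start at the composites and end at the
   identity. *)
have crev : cont_on ([set: Z] `*` I01) (h \o (fun u => (u.1, 1 - u.2))).
  apply: (@cont_on_comp _ _ _ _ ([set: Z] `*` I01)) => //.
  - move=> [z t] [_ /= /I01P/andP[t0 t1]]; split=> //; apply/I01P/andP; split=> /=; lra.
  - apply: cont_onT => //; apply: continuous_pair; first exact: fst_continuous.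
    by move=> u; apply: cvgB; [exact: cvg_cst|exact: snd_continuous].
  - exact: st_cont st.
have cg : continuous g.
  apply/quotient_continuous/cont_on_setT.
  rewrite (_ : g \o _ = h \o (fun z => (z, 1))); last by apply/funext => z; exact: gpi.
  apply: (@cont_on_comp _ _ _ _ ([set: Z] `*` I01)) => //.
  - by move=> z _; split=> //; exact: I01_1.
  - apply/cont_on_setT; apply: continuous_pair => z; first exact: cvg_id.
    exact: cst_continuous.
  - exact: st_cont st.
exists stage_pi, g; split=> //; first exact: stage_pi_continuous.
- exists (fun u => h (u.1, 1 - u.2)); split=> [|z|z] /=.
  + by apply/(cont_onP _ c1).
  + by rewrite subr0 gpi.
  + by rewrite subrr (st_0 st).
- exists (fun u => stage_pi (h (generic_quotient.repr u.1, 1 - u.2))); split=> [|y|y] /=.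
  + have cY : closed ([set: Y] `*` I01).
      by apply: closed_setX; [exact: closedT|exact: closed_I01].
    apply/(cont_onP _ cY).
    rewrite (_ : _ `*` _ = (fun u => (stage_pi u.1, u.2)) @` ([set: Z] `*` I01)).
      apply: cont_on_image => //.
      * by apply: compact_setX; [exact: realization_compact|exact: segment_compact].
      * by apply: hausdorff_prod; [exact: stage_quot_hausdorff|exact: Rhausdorff].
      * apply: cont_onT => //; apply: continuous_pair; last exact: snd_continuous.
        move=> u; apply: (@continuous_comp _ _ _ fst stage_pi); first exact: fst_continuous.
        exact: stage_pi_continuous.
      apply: (@eq_cont_on _ _ _ (stage_pi \o (h \o (fun u => (u.1, 1 - u.2))))).
        move=> [z t] [_ /= /I01P/andP[t0 t1]] /=; apply/stage_piP; apply: (st_pres st).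
          by apply/stage_piP; rewrite stage_pi_surj.
        by apply/I01P/andP; split; lra.
      apply: (@cont_on_comp _ _ _ _ [set: Z]) => //.
      exact/cont_on_setT/stage_pi_continuous.
    apply/seteqP; split=> [[y t] [_ /= tI]|_ [[z t] [_ /= tI] <-]] //.
    by exists (generic_quotient.repr y, t) => //; congr pair; exact: stage_pi_surj.
  + by rewrite subr0.
  + by rewrite subrr (st_0 st) // stage_pi_surj.
Qed.

(** It takes a set of simplices rather than a representative, so that it can itself be the bijection
    from critical orbits to cells. *)
Definition cell_of p (O : set (X p.+1)) : set Y :=
  [set y | exists b c, [/\ O b, opensimplex R p.+1 c & y = stage_pi (simplex_pt b c)]].

Lemma push_open p (t : injn p.+1 p.+1) (c : 'rV[R]_p.+1) :
  opensimplex R p.+1 c -> opensimplex R p.+1 (push_fun t c).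
Proof.
move=> [cS c0]; split=> [|j]; first exact: push_std.
have [t' [tt' _]] := injn_permV t.
by rewrite (_ : j = t (t' j)) ?push_fun_im // -injn_compE tt' injn_idE.
Qed.

Lemma cell_of_orbit p (a : X p.+1) y : cell_of (sym_orbit a) y <->
  exists2 c, opensimplex R p.+1 c & y = stage_pi (simplex_pt a c).
Proof.
split=> [[b [c [/sym_orbitP[t <-] co ->]]]|[c co ->]].
  exists (push_fun t c); first exact: push_open.
  by rewrite simplex_pt_push //; exact: opensimplex_std.
by exists a, c; split=> //; apply/sym_orbitP; exact: orb_refl.
Qed.

Lemma cell_meet p q (a : X p.+1) (b : X q.+1) y :
  critical f a -> critical f b ->
  cell_of (sym_orbit a) y -> cell_of (sym_orbit b) y -> q = p /\ face a b.
Proof.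
move=> ca cb /cell_of_orbit[c co ->] /cell_of_orbit[d dO /stage_piP zw].
apply: (simplex_pt_open_eq co dO).
by apply: (st_uniq st zw (k := p) (l := q)); [exists a|exists b]; split=> //;
  [exists c|exists d].
Qed.

Lemma cell_of_eq p q (a : X p.+1) (b : X q.+1) :
  q = p -> face a b -> cell_of (sym_orbit a) = cell_of (sym_orbit b).
Proof.
move=> qp; case: p / qp a => a /orb_face ba.
by congr cell_of; apply/sym_orbit_eq/orb_sym.
Qed.

(** [st_crit] gives a critical representative of dimension at most [d], and by [st_uniq] all
    critical representatives of a class coincide. *)
Lemma cell_of_dim p (a : X p.+1) z d : critical f a -> dim_le d z ->
  cell_of (sym_orbit a) (stage_pi z) -> (p <= d)%N.
Proof.
move=> ca zd az; have [k [w [kd [b [cb [c co wc]]] zw]]] := st_crit st I zd.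
have bz : cell_of (sym_orbit b) (stage_pi z).
  by apply/cell_of_orbit; exists c => //; rewrite -wc; apply/stage_piP.
by have [kp _] := cell_meet ca cb az bz; rewrite -kp.
Qed.

Lemma barycenter_open p : opensimplex R p.+1 (barycenter R p).
Proof.
by split=> [|i]; [exact: barycenter_std|rewrite mxE invr_gt0 ltr0n].
Qed.

Lemma cell_of_nonempty p (a : X p.+1) :
  cell_of (sym_orbit a) (stage_pi (simplex_pt a (barycenter R p))).
Proof. by apply/cell_of_orbit; eexists; first exact: barycenter_open. Qed.

Definition morse_cells : set (set Y) :=
  [set C | exists p (a : X p.+1), critical f a /\ C = cell_of (sym_orbit a)].

Definition morse_dim (C : set Y) : nat :=
  xget 0%N [set p | exists a : X p.+1, critical f a /\ C = cell_of (sym_orbit a)].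

Lemma morse_dimE p (a : X p.+1) : critical f a -> morse_dim (cell_of (sym_orbit a)) = p.
Proof.
move=> ca; rewrite /morse_dim; case: xgetP => [q _ [b [cb ab]]|/(_ p) []].
  have ay := cell_of_nonempty a; have by_ := ay; rewrite ab in by_.
  by have [pq _] := cell_meet cb ca by_ ay; rewrite pq.
by exists a.
Qed.

Lemma morse_cells_finite : finite_set morse_cells.
Proof.
apply: (@sub_finite_set _ _
  ((fun s : simplices X => cell_of (sym_orbit (tagged s))) @` setT)).
  by move=> C [p [a [_ ->]]]; exists (existT _ p a).
exact: finite_image.
Qed.

Lemma morse_cells_partition : partition morse_cells id [set: Y].
Proof.
split.
- apply/seteqP; split=> // y _; rewrite -(stage_pi_surj y).
  set z := generic_quotient.repr y.
  have [q [x [c [[cS _] zc]]]] := simplex_pt_surj z.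
  have zd : dim_le q z by exists q, x, c.
  have [k [w [_ [b [cb [d dO wd]]] zw]]] := st_crit st I zd.
  exists (cell_of (sym_orbit b)); first by exists k, b.
  by apply/cell_of_orbit; exists d => //; rewrite -wd; apply/stage_piP.
- move=> C D [p [a [ca ->]]] [q [b [cb ->]]] [y [ay by_]].
  by have [qp ab] := cell_meet ca cb ay by_; exact: cell_of_eq.
- by move=> C [p [a [_ ->]]]; eexists; exact: cell_of_nonempty.
Qed.

Section CharacteristicMap.
Variables (p : nat) (a : X p.+1).
Hypothesis ca : critical f a.
Local Notation G := (aut_rep R a).

Definition char_ball (u : cball R p) : Y :=
  stage_pi (simplex_pt a (ball_to_simplex (val u))).

Definition char_map (u : ball_quot G) : Y := char_ball (generic_quotient.repr u).

Let ball_std (u : cball R p) : Delta p (ball_to_simplex (val u)).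
Proof.
by apply: ball_to_simplex_std; rewrite eucl_norm_le1; exact: set_mem (valP u).
Qed.

Lemma char_ball_equiv (u v : cball R p) : ball_pi G u = ball_pi G v ->
  char_ball u = char_ball v.
Proof.
move=> /eqmodP/asboolP[A [s sa <-] vu].
rewrite /char_ball vu -[s]invgK -std_rep_tr ball_to_simplex_equiv.
rewrite simplex_pt_push; last exact: ball_std.
by have /sym_autP -> := sym_autV sa.
Qed.

Lemma char_mapE (u : cball R p) : char_map (ball_pi G u) = char_ball u.
Proof. by apply: char_ball_equiv; exact: reprK. Qed.

Lemma ball_pi_surj (q : ball_quot G) : exists u, q = ball_pi G u.
Proof. by exists (generic_quotient.repr q); rewrite /ball_pi reprK. Qed.

Lemma char_ball_continuous : continuous char_ball.
Proof.
apply/cont_on_setT; apply: (@cont_on_comp _ _ _ _ [set: Z]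
  (fun u : cball R p => simplex_pt a (ball_to_simplex (val u))) stage_pi) => //.
  apply: cont_on_simplex_pt; [exact: closedT| |by move=> u _; exact: ball_std].
  apply/cont_on_setT => u.
  apply: (@continuous_comp _ _ _ (val : cball R p -> 'cV[R]_p) (@ball_to_simplex R p)).
    exact: initial_continuous.
  exact: ball_to_simplex_continuous.
exact/cont_on_setT/stage_pi_continuous.
Qed.

Lemma char_map_continuous : continuous char_map.
Proof.
apply/quotient_continuous.
rewrite (_ : char_map \o _ = char_ball); first exact: char_ball_continuous.
by apply/funext => u; exact: char_mapE.
Qed.

Lemma ball_quot_compact : compact [set: ball_quot G].
Proof.
rewrite (_ : [set: _] = ball_pi G @` setT).
  apply: continuous_compact; last exact: compact_cball_type.
  by apply: continuous_subspaceT; exact: pi_continuous.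
by apply/seteqP; split=> // q _; have [u ->] := ball_pi_surj q; exists u.
Qed.

Lemma char_map_closed (D : set (ball_quot G)) : closed D -> closed (char_map @` D).
Proof.
move=> cD; apply: compact_closed; first exact: stage_quot_hausdorff.
apply: continuous_compact; first exact/continuous_subspaceT/char_map_continuous.
exact: subclosed_compact cD ball_quot_compact _.
Qed.

Lemma char_ball_boundary (u : cball R p) : sqnorm (val u) = 1 ->
  exists d, (d < p)%N /\ dim_le d (simplex_pt a (ball_to_simplex (val u))).
Proof.
move=> u1; have [|j uj] := @ball_to_simplex_boundary R p (val u).
  by rewrite /eucl_norm u1 sqrtr1.
have uS := ball_std u; move: (ball_to_simplex _) j uS uj.
(* The ball of dimension 0 has empty boundary. *)
case: p a u u1 => [|q] b u u1 c j cS cj.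
  by move/eqP: u1; rewrite /sqnorm big_ord0 eq_sym oner_eq0.
have [c' c'S ->] := push_facet cS cj.
exists q; split=> //; rewrite simplex_pt_push //.
by exists q, (pull (injn_of (@lift_inj _ j)) b), c'.
Qed.

Lemma char_ball_outside (u : cball R p) : sqnorm (val u) = 1 ->
  ~ cell_of (sym_orbit a) (char_ball u).
Proof.
move=> /char_ball_boundary[d [dp ud]] au.
by have := cell_of_dim ca ud au; rewrite leqNgt dp.
Qed.

Lemma ball_dichotomy (u : cball R p) : sqnorm (val u) < 1 \/ sqnorm (val u) = 1.
Proof.
have := set_mem (valP u); rewrite /cball /= le_eqVlt.
by move=> /orP[/eqP|]; [right|left].
Qed.

Lemma char_ball_inside (u : cball R p) : sqnorm (val u) < 1 ->
  cell_of (sym_orbit a) (char_ball u).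
Proof.
move=> u1; apply/cell_of_orbit; eexists; last by [].
by apply: ball_to_simplex_open; rewrite eucl_norm_lt1.
Qed.

Lemma char_map_bij :
  set_bij (@ball_quot_interior R p G) (cell_of (sym_orbit a)) char_map.
Proof.
split.
- by move=> _ [u u1 <-]; rewrite char_mapE; exact: char_ball_inside.
- move=> _ _ /set_mem[u u1 <-] /set_mem[v v1 <-]; rewrite !char_mapE.
  rewrite /= -!eucl_norm_lt1 in u1 v1.
  have uo := ball_to_simplex_open u1; have vo := ball_to_simplex_open v1.
  move=> /stage_piP uv.
  have {}uv : simplex_pt a (ball_to_simplex (val u)) =
              simplex_pt a (ball_to_simplex (val v)).
    (* The quotient adds no identification inside an open critical simplex, so only the
       automorphisms of [a] remain, and these are the elements of [G]. *)
    apply: (st_uniq st uv (k := p) (l := p)); exists a; split=> //.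
      by exists (ball_to_simplex (val u)).
    by exists (ball_to_simplex (val v)).
  have [t [+ ta]] := simplex_pt_eq uo (opensimplex_std vo) uv.
  have [s ts] := injn_endo_perm t; rewrite {t}ts in ta *.
  rewrite -ball_to_simplex_equiv => /ball_to_simplex_inj vu.
  apply/eqmodP/asboolP; exists (std_rep R s^-1); last by rewrite -std_rep_tr.
  by exists s^-1%g => //; apply/sym_autV/sym_autP.
- move=> y /cell_of_orbit[c co ->].
  have [w w1 wc] := ball_to_simplex_onto (opensimplex_std co).
  have wB : w \in cball R p by apply/mem_set; rewrite /cball /= -eucl_norm_le1.
  pose u : cball R p := exist _ w wB.
  exists (ball_pi G u); last by rewrite char_mapE /char_ball /= wc.
  exists u => //; have [//|u1] := ball_dichotomy u.
  have [j] : exists j, ball_to_simplex w 0 j = 0.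
    by apply: ball_to_simplex_boundary; rewrite /eucl_norm u1 sqrtr1.
  by rewrite wc => cj; case: co => _ /(_ j); rewrite cj ltxx.
Qed.

(** The inverse is continuous because [char_map] is a closed map and sends boundary points outside
    the cell: the trace on the cell of the image of [D] then comes from interior points of [D]
    only. *)
Lemma char_map_homeo :
  maps_homeomorphically (@ball_quot_interior R p G) (cell_of (sym_orbit a)) char_map.
Proof.
have [_ cinj csurj] := char_map_bij.
split; [exact: char_map_bij|exact/continuous_subspaceT/char_map_continuous|].
pose u0 : ball_quot G := ball_pi G (exist (fun w => w \in cball R p) 0 (cball0 R p)).
pose g y := xget u0 [set u | @ball_quot_interior R p G u /\ char_map u = y].
have gP y : cell_of (sym_orbit a) y ->
    @ball_quot_interior R p G (g y) /\ char_map (g y) = y.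
  move=> /csurj[u uI uy]; rewrite /g; case: xgetP => [v _ []//|/(_ u) []].
  by split.
exists g; split; last first.
  move=> u uI; have [] := gP (char_map u).
    by have [cf _ _] := char_map_bij; exact: cf.
  by move=> gI /cinj; apply; exact: mem_set.
apply/continuous_closedP => D cD; apply/closed_subspaceP.
exists (char_map @` D); first exact: char_map_closed.
apply/seteqP; split=> y [] /=; last first.
  by move=> gD yC; split=> //; exists (g y) => //; have [] := gP y yC.
move=> [d dD <-] yC; split=> //; have [gI gd] := gP _ yC.
suff dg : g (char_map d) = d by rewrite -dg in dD.
apply: cinj; [exact: mem_set|apply: mem_set|by rewrite gd].
have [u du] := ball_pi_surj d; exists u => //=.
have [//|u1] := ball_dichotomy u.
by case: (char_ball_outside u1); rewrite -char_mapE -du.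
Qed.

(** The cell is the image of the closed ball minus the image of the sphere, both compact. *)
Lemma cell_of_locally_closed : locally_closed (cell_of (sym_orbit a)).
Proof.
pose S := [set u : cball R p | sqnorm (val u) = 1].
exists (~` (char_ball @` S)), (char_ball @` setT); split.
- apply: closed_openC; apply: compact_closed; first exact: stage_quot_hausdorff.
  apply: continuous_compact; first exact/continuous_subspaceT/char_ball_continuous.
  apply: (subclosed_compact _ (@compact_cball_type R p)) => //.
  have cs : continuous (@sqnorm R p \o (val : cball R p -> 'cV_p)).
    move=> u; apply: continuous_comp; first exact: initial_continuous.
    exact: sqnorm_continuous.
  by move/continuous_closedP: cs => /(_ [set x | x = 1]); apply; exact: closed_eq.
- apply: compact_closed; first exact: stage_quot_hausdorff.
  apply: continuous_compact; last exact: compact_cball_type.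
  exact/continuous_subspaceT/char_ball_continuous.
apply/seteqP; split=> [y yC|y [nS [u _ uy]]].
  split; first by move=> [u u1 uy]; apply: (char_ball_outside u1); rewrite uy.
  have [_ _ csurj] := char_map_bij; have [q _ <-] := csurj _ yC.
  by have [u ->] := ball_pi_surj q; exists u => //; rewrite char_mapE.
rewrite -uy in nS *; have [u1|u1] := ball_dichotomy u; first exact: char_ball_inside.
by case: nS; exists u.
Qed.

Lemma cell_of_is_cell : is_cell morse_cells morse_dim (cell_of (sym_orbit a)) G.
Proof.
split; first exact: morse_dimE.
exists char_map => /=; split.
- exact: char_map_continuous.
- exact: char_map_homeo.
- by apply: sub_finite_set morse_cells_finite => D [].
move=> _ [[q [b [cb ->]]] [y [by_ [_ [u u1 <-]]]]]; rewrite char_mapE => uy.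
have [d [dp ud]] := char_ball_boundary u1; rewrite morse_dimE //.
apply: leq_ltn_trans dp; apply: (cell_of_dim cb ud).
by rewrite -[stage_pi _]/(char_ball u) uy.
Qed.

End CharacteristicMap.

Lemma morse_locally_closed C : morse_cells C -> locally_closed C.
Proof. by move=> [p [a [ca ->]]]; exact: cell_of_locally_closed. Qed.

Lemma morse_cell C : morse_cells C -> exists p (G : finOrthGroup R p),
  is_cell morse_cells morse_dim C G.
Proof.
by move=> [p [a [ca ->]]]; exists p, (aut_rep R a); exact: cell_of_is_cell.
Qed.

Lemma morse_closed (A : set Y) :
  closed A <-> forall C, morse_cells C -> closed (A `&` closure C).
Proof.
split=> [cA C _|h0]; first by apply: closedI => //; exact: closed_closure.
have -> : A = \bigcup_(C in morse_cells) (A `&` closure C).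
  apply/seteqP; split=> [y Ay|y [C _ []//]].
  have [+ _ _] := morse_cells_partition => /seteqP[_ /(_ y I)[C CM Cy]].
  by exists C => //; split=> //; exact: subset_closure.
by apply: closed_bigcup => //; exact: morse_cells_finite.
Qed.

Definition morse_cw : symCW R := SymCW stage_quot_hausdorff morse_cells_partition
  morse_locally_closed morse_cell morse_closed.

End Quotient.

Theorem theorem1p1 (R : realType) (X : symDelta) (f : forall p, X p.+1 -> R)
    (Xfin : finite_complex X) (Xne : nonempty_complex X)
    (fmorse : discrete_morse f) :
  exists Y : symCW R,
    homotopy_equivalent R (realization R X) Y /\
    exists cell : forall p, set (X p.+1) -> set Y,
      forall p,
        set_bij (critical_orbits f p) (cells_of_dim Y p) (cell p) /\
        forall a : X p.+1, critical f a ->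
          exists G : finOrthGroup R p,
            is_cell (cw_cells Y) (cw_dim Y) (cell p (sym_orbit a)) G /\
            orth_isog (sym_aut a) G.
Proof.
have [E [h st]] := full_stage Xfin fmorse.
exists (morse_cw Xfin st); split.
  exact: realization_homotopy_equivalent.
exists (fun p => @cell_of R X f E h st p) => p; split; last first.
  move=> a ca; exists (aut_rep R a); split; last exact: aut_rep_isog.
  exact: cell_of_is_cell.
split.
- move=> _ [a ca <-]; split; first by exists p, a.
  exact: morse_dimE.
- move=> _ _ /set_mem[a ca <-] /set_mem[b cb <-] ab; apply/sym_orbit_eq.
  have ay := cell_of_nonempty st a; have by_ := ay; rewrite ab in by_.
  by have [_ /orb_face/orb_sym] := cell_meet ca cb ay by_.
- move=> C [[q [b [cb Cb]]] Cp].
  have qp : q = p by rewrite -Cp Cb /=; apply/esym/morse_dimE.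
  case: p / qp Cp => _; exists (sym_orbit b); first by exists b.
  by rewrite Cb.
Qed.
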